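(* Let $\mathcal{M}$ be an $\omega$-categorical structure which is $MS$-measurable with dimension-measure $h=(\mathrm{d},\mu)$. Then $\mathcal{M}$ is also $MS$-measurable via a dimension-measure $h'=(SU,\mu')$, whose dimension is $SU$-rank and where $\mu'$ agrees with $\mu$ on complete types over finite sets of parameters. Hence, if an $\omega$-categorical structure is $MS$-measurable, there is a dimension-measure on it whose dimension is given by $SU$-rank.
   Context: For a structure $\mathcal{M}$, $\mathrm{Def}(M)$ is the set of non-empty subsets of the powers $M^n$ ($n\ge 1$) definable with parameters. $\mathcal{M}$ is $MS$-measurable with dimension-measure $h:\mathrm{Def}(M)\to\mathbb{N}\times\mathbb{R}^{>0}$, $h(X)=(\mathrm{d}(X),\mu(X))$, if: (1) for each formula $\phi(\overline{x},\overline{y})$, $h(\phi(M^{|\overline{x}|},\overline{a}))$ takes finitely many values as $\overline{a}$ varies, and for each value $v$ the set of $\overline{a}$ with $h(\phi(M^{|\overline{x}|},\overline{a}))=v$ is $\emptyset$-definable; (2) $h(\{\overline{a}\})=(0,1)$ for every $\overline{a}\in M^n$; (3) for disjoint definable $X,Y\subseteq M^n$, $\mu(X\cup Y)=\mu(X)+\mu(Y)$ if $\mathrm{d}(X)=\mathrm{d}(Y)$, and $\mu(X\cup Y)=\mu(Y)$ if $\mathrm{d}(X)<\mathrm{d}(Y)$ [$\mathrm{d}$ being a dimension, $\mathrm{d}(X\cup Y)=\max\{\mathrm{d}(X),\mathrm{d}(Y)\}$]; (4) (Fubini) if $X\subseteq M^n$ is definable, $\pi:M^n\to M^m$ ($1\le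 m<n$) is a projection to $m$ coordinates, and $h(\pi^{-1}(\overline{a})\cap X)=(k,\nu)$ for all $\overline{a}\in\pi(X)$, then $\mathrm{d}(X)=\mathrm{d}(\pi(X))+k$ and $\mu(X)=\mu(\pi(X))\nu$. $MS$-measurable structures are known to be supersimple of finite $SU$-rank. The $SU$-rank of a definable set is the maximum of the $SU$-ranks of complete types (over a set of parameters defining it) containing it. For tuples $\overline{a},\overline{b}$ in an $\omega$-categorical $\mathcal{M}$, $\mu(\mathrm{tp}(\overline{a}/\overline{b}))$ means $\mu(\phi(M^{|\overline{x}|},\overline{b}))$ for any $\phi(\overline{x},\overline{b})$ isolating $\mathrm{tp}(\overline{a}/\overline{b})$. *)

(* Defs.v *)
From HB Require Import structures.
From mathcomp Require Import all_boot all_order all_algebra.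
From mathcomp Require Import all_classical all_reals.
Set Implicit Arguments.
Unset Strict Implicit.
Unset Printing Implicit Defensive.
Import Order.TTheory GRing.Theory Num.Theory.
Local Open Scope classical_set_scope.

(** * First-order logic over a countable language *)

Record language := Language {
  fsym : countType; far : fsym -> nat;
  rsym : countType; rar : rsym -> nat }.

(* [term L n] and [formula L n]: the free variables are indexed by ['I_n].
   Equality is a logical symbol; the other connectives are the classical
   abbreviations. *)
Inductive term (L : language) (n : nat) : Type :=
| Var of 'I_n
| App (f : fsym L) of 'I_(far f) -> term L n.

Inductive formula (L : language) (n : nat) : Type :=
| Bot
| Equ of term L n & term L n
| Rel (r : rsym L) of 'I_(rar r) -> term L n
| Imp of formula L n & formula L n
| All of formula L n.+1.

Record structure (L : language) := Structure {
  carrier :> Type;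
  finterp : forall f : fsym L, ('I_(far f) -> carrier) -> carrier;
  rinterp : forall r : rsym L, ('I_(rar r) -> carrier) -> Prop }.
Arguments finterp {L} s f v : rename.
Arguments rinterp {L} s r v : rename.

Definition fcons (T : Type) n (x : T) (v : 'I_n -> T) : 'I_n.+1 -> T :=
  fun i => if unlift ord0 i is Some j then v j else x.

Definition fcat (T : Type) n m (a : 'I_n -> T) (b : 'I_m -> T) :
    'I_(n + m) -> T :=
  fun i => match fintype.split i with inl j => a j | inr k => b k end.

Fixpoint eval (L : language) (M : structure L) n (v : 'I_n -> M)
    (t : term L n) : M :=
  match t with
  | Var i => v i
  | App f ts => finterp M f (fun i => eval v (ts i))
  end.

(* [All phi] binds the variable [ord0] of [phi]. *)
Fixpoint sat (L : language) (M : structure L) n (v : 'I_n -> M)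
    (phi : formula L n) {struct phi} : Prop :=
  match phi with
  | Bot => False
  | Equ t u => eval v t = eval v u
  | Rel r ts => rinterp M r (fun i => eval v (ts i))
  | Imp p q => sat v p -> sat v q
  | All p => forall x : M, sat (fcons x v) p
  end.

Definition elementary (L : language) (M N : structure L) (f : M -> N) : Prop :=
  forall n (phi : formula L n) (v : 'I_n -> M), sat v phi <-> sat (f \o v) phi.

Definition elem_equiv (L : language) (M N : structure L) : Prop :=
  forall (phi : formula L 0) (v : 'I_0 -> M) (w : 'I_0 -> N),
    sat v phi <-> sat w phi.

Definition isomorphic (L : language) (M N : structure L) : Prop :=
  exists f : M -> N, [/\ bijective f,
    (forall (s : fsym L) (v : 'I_(far s) -> M),
       f (finterp M s v) = finterp N s (f \o v)) &
    (forall (s : rsym L) (v : 'I_(rar s) -> M),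
       rinterp M s v <-> rinterp N s (f \o v))].

Definition countably_infinite (T : Type) : Prop :=
  countable [set: T] /\ infinite_set [set: T].

(* Th(M) has exactly one model of cardinality aleph_0 up to isomorphism;
   M itself may be uncountable. *)
Definition omega_categorical (L : language) (M : structure L) : Prop :=
  (exists N : structure L, countably_infinite N /\ elem_equiv M N) /\
  (forall N1 N2 : structure L,
     countably_infinite N1 -> elem_equiv M N1 ->
     countably_infinite N2 -> elem_equiv M N2 -> isomorphic N1 N2).

(** * Definable sets *)

(* A formula phi(x, b) in n variables, with parameters b in M. *)
Record pformula (L : language) (M : structure L) (n : nat) := PFormula {
  parity : nat;
  pfml : formula L (n + parity);
  pparam : 'I_parity -> M }.
Arguments parity {L M n} theta : rename.
Arguments pfml {L M n} theta : rename.
Arguments pparam {L M n} theta _ : rename.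

Definition psat (L : language) (M : structure L) n (theta : pformula M n)
    (x : 'I_n -> M) : Prop :=
  sat (fcat x (pparam theta)) (pfml theta).

Definition pover (L : language) (M : structure L) n (A : set M)
    (theta : pformula M n) : Prop :=
  forall i, A (pparam theta i).

Definition ppush (L : language) (M N : structure L) (f : M -> N) n
    (theta : pformula M n) : pformula N n :=
  PFormula (pfml theta) (f \o pparam theta).

Definition definable (L : language) (M : structure L) n
    (X : set ('I_n -> M)) : Prop :=
  exists theta : pformula M n, X = psat theta.

Definition definable0 (L : language) (M : structure L) n
    (X : set ('I_n -> M)) : Prop :=
  exists phi : formula L n, X = [set x | sat x phi].

(* Membership in Def(M). *)
Definition inDef (L : language) (M : structure L) n
    (X : set ('I_n -> M)) : Prop :=
  [/\ (0 < n)%N, X !=set0 & definable X].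

(** * MS-measurability *)

(* The values of [h] outside [inDef] are junk and are never constrained. *)
Definition dim_meas_fun (R : realType) (L : language) (M : structure L) :=
  forall n : nat, set ('I_n -> M) -> nat * R.

Definition fibre (L : language) (M : structure L) n m
    (phi : formula L (n + m)) (b : 'I_m -> M) : set ('I_n -> M) :=
  [set x | sat (fcat x b) phi].

(* The coordinate projection M^n -> M^m selecting the coordinates s. *)
Definition coord_proj (T : Type) n m (s : 'I_m -> 'I_n) (x : 'I_n -> T) : 'I_m -> T :=
  x \o s.

Record dimension_measure (R : realType) (L : language) (M : structure L)
    (h : dim_meas_fun R M) : Prop := DimensionMeasure {
  dm_pos : forall n (X : set ('I_n -> M)), inDef X -> (0 < (h n X).2)%R;
  dm_fin : forall n m (phi : formula L (n + m)), (0 < n)%N ->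
    finite_set [set h n (fibre phi b) | b in [set b | fibre phi b !=set0]];
  dm_def : forall n m (phi : formula L (n + m)) (v : nat * R), (0 < n)%N ->
    definable0 [set b : 'I_m -> M |
      fibre phi b !=set0 /\ h n (fibre phi b) = v];
  dm_point : forall n (a : 'I_n -> M), (0 < n)%N -> h n [set a] = (0%N, 1%R);
  dm_dimU : forall n (X Y : set ('I_n -> M)), inDef X -> inDef Y ->
    (h n (X `|` Y)).1 = maxn (h n X).1 (h n Y).1;
  dm_measU_eq : forall n (X Y : set ('I_n -> M)), inDef X -> inDef Y ->
    X `&` Y = set0 -> (h n X).1 = (h n Y).1 ->
    (h n (X `|` Y)).2 = ((h n X).2 + (h n Y).2)%R;
  dm_measU_lt : forall n (X Y : set ('I_n -> M)), inDef X -> inDef Y ->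
    X `&` Y = set0 -> ((h n X).1 < (h n Y).1)%N ->
    (h n (X `|` Y)).2 = (h n Y).2;
  dm_fubini : forall n m (s : 'I_m -> 'I_n) (X : set ('I_n -> M))
      (k : nat) (nu : R),
    (1 <= m < n)%N -> injective s -> inDef X ->
    (forall a, (coord_proj s @` X) a -> h n (coord_proj s @^-1` [set a] `&` X) = (k, nu)) ->
    (h n X).1 = ((h m (coord_proj s @` X)).1 + k)%N /\
    (h n X).2 = ((h m (coord_proj s @` X)).2 * nu)%R }.

Definition MS_measurable (R : realType) (L : language) (M : structure L) : Prop :=
  exists h : dim_meas_fun R M, dimension_measure h.

(* phi(x, b) isolates tp(a / b). *)
Definition isolates (L : language) (M : structure L) n m
    (phi : formula L (n + m)) (a : 'I_n -> M) (b : 'I_m -> M) : Prop :=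
  fibre phi b a /\
  forall psi : formula L (n + m), fibre psi b a -> fibre phi b `<=` fibre psi b.

Definition agree_on_types (R : realType) (L : language) (M : structure L)
    (h h' : dim_meas_fun R M) : Prop :=
  forall n m (phi : formula L (n + m)) (a : 'I_n -> M) (b : 'I_m -> M),
    (0 < n)%N -> isolates phi a b ->
    (h' n (fibre phi b)).2 = (h n (fibre phi b)).2.

(** * Forking and SU-rank *)

(* No monster model is fixed: wherever one usually says "in the monster", an
   elementary extension of the current structure is quantified, and a complete
   type over A is given as tp(a / A) for a tuple a in such an extension. *)

Definition same_type (L : language) (N : structure L) (A : set N) n
    (c c' : 'I_n -> N) : Prop :=
  forall theta : pformula N n, pover A theta -> psat theta c <-> psat theta c'.

Definition divides (L : language) (N : structure L) (A : set N) n
    (theta : pformula N n) : Prop :=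
  exists (N' : structure L) (f : N -> N')
         (c : nat -> 'I_(parity theta) -> N') (k : nat),
    [/\ elementary f,
        (forall i, same_type (f @` A) (f \o pparam theta) (c i)) &
        (forall s : 'I_k -> nat, injective s ->
           ~ exists x : 'I_n -> N', forall j, fibre (pfml theta) (c (s j)) x)].

Definition forks (L : language) (N : structure L) (A : set N) n
    (theta : pformula N n) : Prop :=
  exists (N' : structure L) (f : N -> N') (k : nat)
         (psi : 'I_k -> pformula N' n),
    [/\ elementary f,
        (forall j, divides (f @` A) (psi j)) &
        (forall x : 'I_n -> N', psat (ppush f theta) x ->
           exists j, psat (psi j) x)].

(* tp(a / B) forks over A. *)
Definition type_forks (L : language) (N : structure L) (A B : set N) n
    (a : 'I_n -> N) : Prop :=
  exists theta : pformula N n, [/\ pover B theta, psat theta a & forks A theta].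

(* SU(a / A) >= k.  The forking extension of tp(a / A) is realised by a itself,
   which is no restriction as the elementary extension N' is arbitrary. *)
Fixpoint SU_ge (L : language) n (k : nat) (N : structure L) (A : set N)
    (a : 'I_n -> N) {struct k} : Prop :=
  if k is k'.+1 then
    exists (N' : structure L) (f : N -> N') (B : set N'),
      [/\ elementary f, f @` A `<=` B, type_forks (f @` A) B (f \o a) &
          SU_ge k' B (f \o a)]
  else True.

Definition SU_eq (L : language) n (N : structure L) (A : set N)
    (a : 'I_n -> N) (k : nat) : Prop :=
  SU_ge k A a /\ ~ SU_ge k.+1 A a.

(* r is the maximum of SU(p), for p a complete type over A containing theta. *)
Definition SU_max (L : language) (M : structure L) n (A : set M)
    (theta : pformula M n) (r : nat) : Prop :=
  (exists (N : structure L) (f : M -> N) (a : 'I_n -> N),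
     [/\ elementary f, psat (ppush f theta) a & SU_eq (f @` A) a r]) /\
  (forall (N : structure L) (f : M -> N) (a : 'I_n -> N),
     elementary f -> psat (ppush f theta) a ->
     exists2 s, (s <= r)%N & SU_eq (f @` A) a s).

(* For definable X the rank does not depend on the parameter set A over which
   X is defined, so r is required to be the value for every such A. *)
Definition SU_rank (L : language) (M : structure L) n
    (X : set ('I_n -> M)) (r : nat) : Prop :=
  forall (A : set M) (theta : pformula M n),
    pover A theta -> X = psat theta -> SU_max A theta r.

Definition dim_is_SU (R : realType) (L : language) (M : structure L)
    (h : dim_meas_fun R M) : Prop :=
  forall n (X : set ('I_n -> M)), inDef X -> SU_rank X (h n X).1.

(* Main.v *)
(** Write [d(a/b)] for the [h]-dimension of [tp(a/b)]. By Fubini it is additive,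
    [d(ac/b) = d(a/bc) + d(c/b)], so a single integer-valued function [delta]
    on finite tuples, monotone and submodular, governs it.

    A drop of [d] is the same thing as forking. If [phi(x,c)] divides over [b]
    and is realised by [a] with [d(a/bc) = d(a/b)], then infinitely many copies
    of [tp(a/bc)], all of the same dimension and measure, sit inside [tp(a/b)]
    with no point in [k] of them, contradicting finite additivity. Conversely,
    if [d(a/bc) < d(a/b)], take copies [c_i] of [c] over [b] with each [c_i]
    [d]-independent from the previous ones; any realisation of [m] of the
    formulas isolating the [tp(a/bc_i)] loses at least [m] from [d(a/b)], so
    they are [(d(a/b)+1)]-inconsistent. Hence SU-rank is the maximal length of a
    chain of drops of [d], and additivity of [d] makes it additive
    (Lascar equality) and invariant under extensions that preserve [d].

    Finally, a definable [X] over [b] gets as new measure the sum, over [k], of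
    the [mu]-measure of the points of maximal SU-rank over [b] with
    [d(x/b) = k]. It does not depend on [b] since enlarging [b] only removes
    subsets of lower [d]-dimension; Fubini for it reduces to the case where the
    projection is a complete type over [b], where it is Fubini for [h].

    Types over finite sets are controlled through the Ryll-Nardzewski theorem.
    The omitting-types step is replaced by building an atomic elementary
    submodel inside the countable model. *)

Require Import Defs.
From HB Require Import structures.
From mathcomp Require Import all_boot all_order all_algebra.
From mathcomp Require Import all_classical all_reals.
From mathcomp Require Import zify.
Set Implicit Arguments.
Unset Strict Implicit.
Unset Printing Implicit Defensive.
Import Order.TTheory GRing.Theory Num.Theory.
Local Open Scope classical_set_scope.

(** * Tuples, formulas and compactness *)

(** The obstacle is that nothing forces types of equal SU-rank to have equal [d], nor types of
    larger [d] to have larger rank. Keeping only the part of largest [d] among the points of maximal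
    rank would break additivity for disjoint sets of equal SU-rank; hence a sum over all values of
    [d]. On a complete type both rank and [d] are constant and the sum has a single nonzero term,
    which is why the measure is unchanged there. Forking is defined over arbitrary sets and in
    arbitrary elementary extensions, whereas [h] sees only definable subsets of powers of [M]. Two
    reductions bridge the gap. The type of a finite tuple in any model of the theory is realised in
    [M], so [d] makes sense everywhere. And since [d] takes natural values, [d(a/b)] is minimal for
    some finite [b] inside a given [A], and this [b] then stands for [A]. Automorphisms never occur:
    equality of types of finite tuples, together with the extension of partial elementary maps by
    one more element, replaces the homogeneity of a monster model. *)

Definition fnil (T : Type) (i : 'I_0) : T := False_rect T (notF (ltn_ord i)).

Lemma pair_ext (A B : Type) (x y : A * B) : y.1 = x.1 -> y.2 = x.2 -> x = y.
Proof. by case: x y => [a b] [a' b'] /= -> ->. Qed.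

Lemma In_map_mem (T : Type) (T' : eqType) (f : T -> T') x s : List.In x s -> f x \in map f s.
Proof. by elim: s => //= y s IH [->|/IH xs]; rewrite inE ?eqxx ?xs ?orbT. Qed.

Section Tuples.
Variables (T T' : Type).

Lemma fcons0 n (x : T) (v : 'I_n -> T) : fcons x v ord0 = x.
Proof. by rewrite /fcons unlift_none. Qed.

Lemma fconsS n (x : T) (v : 'I_n -> T) j : fcons x v (lift ord0 j) = v j.
Proof. by rewrite /fcons liftK. Qed.

Lemma fcons_comp n (f : T -> T') (x : T) (v : 'I_n -> T) :
  f \o fcons x v = fcons (f x) (f \o v).
Proof. by apply/funext => i; rewrite /fcons /=; case: unlift. Qed.

Lemma fcons_eta n (v : 'I_n.+1 -> T) : v = fcons (v ord0) (v \o lift ord0).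
Proof. by apply/funext => i; rewrite /fcons; case: unliftP => [j|] ->. Qed.

Lemma fcatl n m (a : 'I_n -> T) (b : 'I_m -> T) i : fcat a b (lshift m i) = a i.
Proof. by rewrite /fcat (unsplitK (inl _)). Qed.

Lemma fcatr n m (a : 'I_n -> T) (b : 'I_m -> T) i : fcat a b (rshift n i) = b i.
Proof. by rewrite /fcat (unsplitK (inr _)). Qed.

Lemma fcat_eta n m (v : 'I_(n + m) -> T) :
  v = fcat (v \o @lshift n m) (v \o @rshift n m).
Proof.
by apply/funext => i; rewrite -(splitK i); case: fintype.split => j;
  rewrite /= ?fcatl ?fcatr.
Qed.

Lemma fcat_fcons n m x (a : 'I_n -> T) (b : 'I_m -> T) :
  fcat (fcons x a) b = fcons x (fcat a b) :> ('I_(n + m).+1 -> T).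
Proof.
apply/funext => i; rewrite [RHS]/fcons; case: unliftP => [j|] ->; last first.
  have -> : ord0 = lshift m (@ord0 n) :> 'I_(n.+1 + m) by apply/val_inj.
  by rewrite fcatl fcons0.
rewrite -(splitK j); case: fintype.split => k /=.
  have -> : lift ord0 (lshift m k) = lshift m (lift ord0 k) :> 'I_(n.+1 + m).
    exact/val_inj.
  by rewrite !fcatl fconsS.
have -> : lift ord0 (rshift n k) = rshift n.+1 k :> 'I_(n.+1 + m) by apply/val_inj.
by rewrite !fcatr.
Qed.

End Tuples.

(** * Renaming of variables, derived connectives, elementary maps *)

Section Syntax.
Variable L : language.
Implicit Types M N : structure L.

Fixpoint trename n m (r : 'I_n -> 'I_m) (t : term L n) : term L m :=
  match t with
  | Var i => Var L (r i)
  | App f ts => App (fun i => trename r (ts i))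
  end.

Definition rlift n m (r : 'I_n -> 'I_m) : 'I_n.+1 -> 'I_m.+1 :=
  fcons ord0 (lift ord0 \o r).

Fixpoint frename n m (r : 'I_n -> 'I_m) (p : formula L n) {struct p} : formula L m :=
  match p with
  | Bot => Bot L m
  | Equ t u => Equ (trename r t) (trename r u)
  | Rel s ts => Rel (fun i => trename r (ts i))
  | Imp p q => Imp (frename r p) (frename r q)
  | All p => All (frename (rlift r) p)
  end.

Lemma eval_trename M n m (r : 'I_n -> 'I_m) (v : 'I_m -> M) t :
  eval v (trename r t) = eval (v \o r) t.
Proof. by elim: t => //= f ts IH; congr finterp; apply/funext. Qed.

Lemma sat_frename M n m (r : 'I_n -> 'I_m) (v : 'I_m -> M) p :
  sat v (frename r p) <-> sat (v \o r) p.
Proof.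
elim: p m r v => {n} [n|n t u|n s ts|n p IHp q IHq|n p IH] m r v //=.
- by rewrite !eval_trename.
- by rewrite (_ : (fun i => _) = (fun i => eval (v \o r) (ts i)));
    last by apply/funext => i; rewrite eval_trename.
- by rewrite IHp IHq.
- suff E x : fcons x v \o rlift r = fcons x (v \o r).
    by split=> H x; move: (H x); rewrite IH E.
  rewrite /rlift fcons_comp fcons0; congr fcons; apply/funext => i /=.
  by rewrite fconsS.
Qed.

Definition Neg n (p : formula L n) := Imp p (Bot L n).
Definition And n (p q : formula L n) := Neg (Imp p (Neg q)).
Definition Ex n (p : formula L n.+1) := Neg (All (Neg p)).
Definition bigAnd n (s : seq (formula L n)) := foldr (@And n) (Neg (Bot L n)) s.
Definition bigOr n (s : seq (formula L n)) := Neg (bigAnd (map (@Neg n) s)).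
Fixpoint allN n : formula L n -> formula L 0 :=
  match n with 0 => id | n.+1 => fun p => allN (All p) end.
Fixpoint exN m n : formula L (m + n) -> formula L n :=
  match m with 0 => id | m.+1 => fun p => exN (Ex (p : formula L (m + n).+1)) end.

Section Sat.
Variables (M : structure L) (n : nat) (v : 'I_n -> M).
Implicit Types p q : formula L n.

Lemma sat_And p q : sat v (And p q) <-> sat v p /\ sat v q.
Proof.
split=> [H|[hp hq] H]; last exact: (H hp hq).
by split; apply: contrapT => h; apply: H => hp hq //; apply: h.
Qed.

Lemma sat_Ex (p : formula L n.+1) : sat v (Ex p) <-> exists x, sat (fcons x v) p.
Proof.
split=> [H|[x px] H]; last exact: (H x).
by apply: contrapT => h; apply: H => x px; apply: h; exists x.
Qed.

Lemma sat_bigAnd s : sat v (bigAnd s) <-> forall p, List.In p s -> sat v p.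
Proof.
elim: s => [|p s IH]; first by split=> // _ [].
have -> : bigAnd (p :: s) = And p (bigAnd s) by [].
rewrite sat_And IH; split=> [[hp H] q [<-//|/H]//|H].
by split; [apply: H; left|move=> q qs; apply: H; right].
Qed.

Lemma sat_bigOr s : sat v (bigOr s) <-> exists2 p, List.In p s & sat v p.
Proof.
split=> [H|[p ps hp] /sat_bigAnd H].
  apply: contrapT => h; apply: H; apply/sat_bigAnd => q /List.in_map_iff[p [<- ps]] hp.
  by apply: h; exists p.
by apply: (H (Neg p)) => //; apply: List.in_map.
Qed.
End Sat.

Lemma sat_allN M n (p : formula L n) (v0 : 'I_0 -> M) :
  sat v0 (allN p) <-> forall v : 'I_n -> M, sat v p.
Proof.
elim: n p => [|n IH] p /=.
  split=> [H v|]; last exact.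
  by rewrite (_ : v = v0) //; apply/funext => -[].
rewrite IH; split=> [H v|H v x]; last exact: H.
by rewrite (fcons_eta v); apply: H.
Qed.

Lemma sat_exN M m n (p : formula L (m + n)) (w : 'I_n -> M) :
  sat w (exN p) <-> exists v : 'I_m -> M, sat (fcat v w) p.
Proof.
elim: m p => [|m IH] p /=.
  have E (v : 'I_0 -> M) : fcat v w = w :> ('I_(0 + n) -> M).
    apply/funext => i; rewrite -[in RHS](splitK i) /fcat.
    by case: fintype.split => [[]|j] //=; congr w; apply/val_inj.
  split=> [H|[v]]; last by rewrite E.
  by exists (@fnil M); rewrite E.
rewrite IH; split=> [[v /sat_Ex[x H]]|[v H]].
  by exists (fcons x v); rewrite fcat_fcons.
exists (v \o lift ord0); apply/sat_Ex; exists (v ord0).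
by rewrite -fcat_fcons -fcons_eta.
Qed.

Lemma elem_equiv_refl M : elem_equiv M M.
Proof. by move=> p v w; rewrite (_ : v = w) //; apply/funext => -[]. Qed.

Lemma elem_equiv_allN M N n (p : formula L n) : elem_equiv M N ->
  (forall v : 'I_n -> M, sat v p) <-> (forall v : 'I_n -> N, sat v p).
Proof.
by move=> E; rewrite -(sat_allN p (@fnil M)) -(sat_allN p (@fnil N)).
Qed.

Lemma elem_equiv_sym M N : elem_equiv M N -> elem_equiv N M.
Proof. by move=> E p v w; rewrite (E p w v). Qed.

Lemma elem_equiv_trans M N N' : elem_equiv M N -> elem_equiv N N' -> elem_equiv M N'.
Proof.
move=> E E' p v w; by rewrite (E p v (@fnil N)) (E' p _ w).
Qed.

Lemma elementary_equiv M N (f : M -> N) : elementary f -> elem_equiv M N.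
Proof. by move=> ef p v w; rewrite (ef _ p v) (_ : f \o v = w) //; apply/funext => -[]. Qed.

Lemma elementary_id M : elementary (@id M).
Proof. by []. Qed.

Lemma elementary_comp (M1 M2 M3 : structure L) (f : M1 -> M2) (g : M2 -> M3) :
  elementary f -> elementary g -> elementary (g \o f).
Proof. by move=> ef eg n p v; rewrite (ef _ p v) (eg _ p (f \o v)). Qed.

Lemma isomorphic_elementary M N : isomorphic M N -> exists f : M -> N,
  bijective f /\ elementary f.
Proof.
move=> [f [[g fK gK] Ff Fr]]; exists f; split; first by exists g.
have Et n (v : 'I_n -> M) t : f (eval v t) = eval (f \o v) t.
  by elim: t => //= s ts IH; rewrite Ff; congr finterp; apply/funext.
move=> n p v; elim: p v => {n} [n|n t u|n s ts|n p IHp q IHq|n p IH] v //=.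
- by rewrite -!Et; split=> [->//|]; apply: (can_inj fK).
- rewrite Fr (_ : f \o _ = (fun i => eval (f \o v) (ts i))) //.
  by apply/funext => i; rewrite /= Et.
- by rewrite IHp IHq.
- split=> H x; first by have := H (g x); rewrite IH fcons_comp gK.
  by rewrite IH fcons_comp.
Qed.

End Syntax.

(** * Ultrapowers, the theorem of Los and compactness *)

Section Ultrapower.
Variables (L : language) (N : structure L) (I : Type) (U : set_system I).
Hypothesis UU : UltraFilter U.

Let UF : ProperFilter U. Proof. exact: ultra_proper. Qed.

Definition ueq (f g : I -> N) := U [set i | f i = g i].

Lemma ueq_refl f : ueq f f.
Proof. by apply: filterS filterT => i _ /=. Qed.

Lemma ueq_sym f g : ueq f g -> ueq g f.
Proof. by apply: filterS => i /= ->. Qed.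

Lemma ueq_trans f g k : ueq f g -> ueq g k -> ueq f k.
Proof. by move=> fg gk; apply: filterS (filterI fg gk) => i /= [-> ->]. Qed.

(** A choice of representatives takes the place of a quotient: the carrier consists of the functions
    fixed by [ucanon], so that equality in it amounts to [ueq]. *)
Definition ucanon (f : I -> N) : I -> N :=
  @xget {classic (I -> N)} f [set g | ueq f g].

Lemma ucanonP f : ueq f (ucanon f).
Proof. by rewrite /ucanon; case: xgetP => [g _ //|_]; apply: ueq_refl. Qed.

Lemma ucanon_eq f g : ueq f g -> ucanon f = ucanon g.
Proof.
move=> fg; rewrite /ucanon (_ : [set k | ueq f k] = [set k | ueq g k]).
  rewrite /xget; case: pselect => // -[]; exists g.
  by apply/asboolP; apply: ueq_refl.
by apply/seteqP; split=> k; apply: ueq_trans => //; apply: ueq_sym.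
Qed.

Definition ucarrier := {f : I -> N | ucanon f = f}.

Definition upi (f : I -> N) : ucarrier :=
  exist _ (ucanon f) (esym (ucanon_eq (ucanonP f))).

Definition upower : structure L := @Structure L ucarrier
  (fun f v => upi (fun i => finterp N f (fun j => sval (v j) i)))
  (fun r v => U [set i | rinterp N r (fun j => sval (v j) i)]).

Lemma ufin_forall n (P : 'I_n -> I -> Prop) :
  (forall j, U (P j)) -> U [set i | forall j, P j i].
Proof.
move=> H; suff : U [set i | forall j, j \in enum 'I_n -> P j i].
  by apply: filterS => i Hi j; apply: Hi; rewrite mem_enum.
elim: (enum _) => [|j s IH]; first by apply: filterS filterT => i _ j.
by apply: filterS (filterI (H j) IH) => i [Pj Ps] k; rewrite inE => /orP[/eqP->|/Ps].
Qed.

Lemma upower_eval n (v : 'I_n -> upower) t :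
  ueq (fun i => eval (fun j => sval (v j) i) t) (sval (eval v t)).
Proof.
elim: t => [j|f ts IH] /=; first exact: ueq_refl.
apply: ueq_trans (ucanonP _).
by apply: filterS (ufin_forall IH) => i Hi; congr finterp; apply/funext.
Qed.

Theorem Los n (v : 'I_n -> upower) p :
  sat v p <-> U [set i | sat (fun j => sval (v j) i) p].
Proof.
elim: p v => {n} [n|n t u|n s ts|n p IHp q IHq|n p IH] v /=.
- by split=> //; rewrite (_ : [set _ | False] = set0) //; apply: filter_not_empty.
- have Et := upower_eval v t; have Eu := upower_eval v u.
  split=> [E|E].
    by rewrite E in Et; apply: filterS (filterI Et Eu) => i /= [-> ->].
  have /ucanon_eq : ueq (sval (eval v t)) (sval (eval v u)).
    by apply: ueq_trans (ueq_sym Et) (ueq_trans E Eu).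
  case: (eval v t) (eval v u) => [f hf] [g hg] /=; rewrite hf hg => E'.
  by move: hf hg; rewrite E' => hf hg; congr exist; apply: Prop_irrelevance.
- have H := ufin_forall (fun j => upower_eval v (ts j)).
  have E i : (forall j, eval (fun k => sval (v k) i) (ts j) = sval (eval v (ts j)) i) ->
    (fun j => eval (fun k => sval (v k) i) (ts j)) = (fun j => sval (eval v (ts j)) i).
    by move=> ?; apply/funext.
  by split=> H'; apply: filterS (filterI H H') => i /= [/E ->].
- rewrite IHp IHq; split=> [H|H Hp]; last first.
    by apply: filterS (filterI H Hp) => i /= [h /h].
  case: (in_ultra_setVsetC [set i | sat (fun j => sval (v j) i) p] UU) => [/H|].
    by apply: filterS => i /= + _.
  by apply: filterS => i /= np /np.
- have E (g : I -> N) : U [set i | (fun j => sval (fcons (upi g) v j) i) =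
      fcons (g i) (fun j => sval (v j) i)].
    apply: filterS (ucanonP g) => i /= Hi; apply/funext => j.
    by rewrite {1 2}/fcons; case: unlift.
  split=> [H|H x].
    case: (in_ultra_setVsetC [set i | sat (fun j => sval (v j) i) (All p)] UU) => // nU.
    have [i0 /existsNP[x0 _]] := filter_ex nU.
    (* A counterexample is chosen at every index that has one; [x0], taken from one such index,
       fills the other places. *)
    have /choice[g Hg] : forall i, exists x, (~ sat (fun j => sval (v j) i) (All p)) ->
      ~ sat (fcons x (fun j => sval (v j) i)) p.
      move=> i; case: (pselect (sat (fun j => sval (v j) i) (All p))) => [h|/existsNP[x hx]].
        by exists x0.
      by exists x.
    have /IH := H (upi g) => Hs; exfalso.
    have [i /= [[ni si] ei]] := filter_ex (filterI (filterI nU Hs) (E g)).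
    by apply: (Hg i ni); rewrite -ei.
  apply/IH; apply: filterS (filterI H (E (sval x))) => i /= [h e].
  rewrite (_ : x = upi (sval x)) ?e; first exact: h.
  by case: x {e h} => x hx; rewrite /upi /=; apply: eq_exist; rewrite hx.
Qed.

Lemma upower_elementary : elementary (fun x : N => upi (fun=> x) : upower).
Proof.
move=> n p v; rewrite Los.
have E : U [set i | (fun j => sval (upi (fun=> v j)) i) = v].
  apply: filterS (ufin_forall (fun j => ucanonP (fun=> v j))) => i /= Hi.
  by apply/funext => j; rewrite /= -Hi.
split=> H; first by apply: filterS E => i /= ei; rewrite /comp ei.
by have [i /= [+ ei]] := filter_ex (filterI H E); rewrite /comp ei.
Qed.

End Ultrapower.

(** The model is an ultrapower of [N] itself, so the embedding is the diagonal one and no diagram of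
    [N] has to be written down. The indices are the finite lists [js], each with its own solution
    [w js], and the ultrafilter contains every set of the lists that extend a given one. *)
Theorem compactness (L : language) (N : structure L) (V : Type) (J : eqType)
    (n : J -> nat) (p : forall j, formula L (n j)) (r : forall j, 'I_(n j) -> V + N) :
  (forall js : seq J, exists v : V -> N, forall j, j \in js ->
     sat (fun i => match r j i with inl x => v x | inr a => a end) (p j)) ->
  exists (N' : structure L) (f : N -> N') (v : V -> N'), elementary f /\
    forall j, sat (fun i => match r j i with inl x => v x | inr a => f a end) (p j).
Proof.
move=> /choice[w Hw].
pose F : set_system (seq J) := [set S | exists l0 : seq J, forall l : seq J, {subset l0 <= l} -> S l].
have FF : ProperFilter F.
  apply: Build_ProperFilter_ex; first by move=> S [l0 H]; exists l0; apply: H.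
  split.
  - by exists [::].
  - move=> A B [l hl] [k hk]; exists (l ++ k) => s hs; split; [apply: hl|apply: hk];
      by move=> x xs; apply: hs; rewrite mem_cat xs ?orbT.
  - by move=> A B AB [l hl]; exists l => s /hl /AB.
have [U [UU FU]] := ultraFilterLemma FF; have UF : ProperFilter U by apply: ultra_proper.
pose f (x : N) : upower N UU := upi UU (fun=> x).
pose v' x : upower N UU := upi UU (fun js => w js x).
exists (upower N UU), f, v'; split; first exact: upower_elementary.
move=> j; apply/Los => //.
have E : U [set js | (fun i => sval (match r j i with inl x => v' x | inr a => f a end) js) =
  (fun i => match r j i with inl x => w js x | inr a => a end)].
  have H : forall i, U [set js | sval (match r j i with inl x => v' x | inr a => f a end) js =
      match r j i with inl x => w js x | inr a => a end].
    by move=> i; case: (r j i) => x; apply: (ueq_sym UU (ucanonP UU _)).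
  by apply: filterS (ufin_forall UU H) => js /= h; apply/funext.
have Uj : U [set js | j \in js] by apply: FU; exists [:: j] => l; apply; rewrite inE.
by apply: filterS (filterI E Uj) => js /= [-> jjs]; apply: Hw.
Qed.

(** * Countable Tarski-Vaught chains *)

HB.instance Definition _ (L : language) (M : structure L) := gen_eqMixin (carrier M).

Section Countability.
Variable L : language.

Fixpoint tenc n (t : term L n) : GenTree.tree nat :=
  match t with
  | Var i => GenTree.Leaf (i : nat)
  | App f ts => GenTree.Node (pickle f) [seq tenc (ts i) | i <- enum 'I_(far f)]
  end.

Fixpoint fenc n (p : formula L n) : GenTree.tree nat :=
  match p with
  | Bot => GenTree.Node 0 [::]
  | Equ t u => GenTree.Node 1 [:: tenc t; tenc u]
  | Rel r ts => GenTree.Node 2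
      (GenTree.Leaf (pickle r) :: [seq tenc (ts i) | i <- enum 'I_(rar r)])
  | Imp p q => GenTree.Node 3 [:: fenc p; fenc q]
  | All p => GenTree.Node 4 [:: fenc p]
  end.

Lemma tenc_inj n : injective (@tenc n).
Proof.
elim=> [i|f ts IH] [j|g us] //=; first by case=> /val_inj ->.
case=> /(pcan_inj pickleK) E; case: g / E us => us /eq_in_map E.
by congr App; apply/funext => i; apply/IH/E; rewrite mem_enum.
Qed.

Lemma fenc_inj n : injective (@fenc n).
Proof.
move=> p; elim: p => {n} [n|n t u|n r ts|n p IHp q IHq|n p IH] [|t' u'|r' ts'|p' q'|p'] //=.
- by move=> [/tenc_inj -> /tenc_inj ->].
- case=> /(pcan_inj pickleK) E; case: r' / E ts' => us /eq_in_map E.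
  by congr Rel; apply/funext => i; apply/tenc_inj/E; rewrite mem_enum.
- by move=> [/IHp -> /IHq ->].
- by move=> [/IH ->].
Qed.

(** A Tarski-Vaught requirement: a witness for [tfml] with parameters at the positions [tidx] of a
    list. Positions instead of elements keep the requirements countable in number, whatever the
    model. *)
Record task := Task { tar : nat; tfml : formula L tar.+1; tidx : 'I_tar -> nat }.

Arguments tidx t _ : rename, clear implicits.

Lemma task_enum : exists e : nat -> option task, forall t, exists k, e k = Some t.
Proof.
pose code t := pickle (tar t, fenc (tfml t), [seq tidx t i | i <- enum 'I_(tar t)]).
have code_inj : injective code.
  move=> [n p r] [m q s] /(pcan_inj pickleK)/= [E]; case: m / E q s => q s.
  move=> /fenc_inj -> /eq_in_map E; congr Task; apply/funext => i.
  by apply: E; rewrite mem_enum.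
exists (fun k => if pselect (exists t, code t = k) is left h then Some (projT1 (cid h)) else None).
move=> t; exists (code t); case: pselect => [h|[]]; last by exists t.
by congr Some; case: (cid h) => t' /= /code_inj.
Qed.

End Countability.
Arguments tidx {L} t _ : rename.

Section TarskiVaught.
Variables (L : language) (N : structure L).
Implicit Types S : set N.

Definition tv_set S := forall n (p : formula L n.+1) (v : 'I_n -> N),
  (forall i, S (v i)) -> (exists x, sat (fcons x v) p) ->
  exists2 x, S x & sat (fcons x v) p.

Lemma tv_submodel S : tv_set S ->
  exists (N' : structure L) (f : N' -> N), elementary f /\ range f = S.
Proof.
move=> tv.
have Sf (f : Defs.fsym L) (v : 'I_(far f) -> {x | S x}) : S (finterp N f (fun i => sval (v i))).
  (* Closure under [f] is the Tarski-Vaught property of the formula [x = f(v)]. *)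
  pose p := Equ (Var L (@ord0 (far f))) (App (fun i => Var L (lift ord0 i))).
  have [] := tv _ p (fun i => sval (v i)).
  - by move=> i; apply: svalP.
  - exists (finterp N f (fun i => sval (v i))) => /=; rewrite fcons0; congr finterp.
    by apply/funext => i; rewrite fconsS.
  - move=> x Sx /=; rewrite fcons0 => E; rewrite E in Sx; move: Sx; congr (S (finterp N f _)).
    by apply/funext => i; rewrite fconsS.
pose N' := @Structure L {x | S x} (fun f v => exist _ _ (Sf f v))
  (fun r v => rinterp N r (fun i => sval (v i))).
exists N', (fun x : N' => sval x); split; last first.
  apply/seteqP; split=> [_ [x _ <-]|x Sx]; first exact: svalP.
  by exists (exist _ x Sx).
have Et n (v : 'I_n -> N') t : sval (eval v t) = eval (fun i => sval (v i)) t.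
  by elim: t => //= f ts IH; congr finterp; apply/funext.
have fcons_sval n (x : N') (v : 'I_n -> N') :
  (fun i => sval (fcons x v i)) = fcons (sval x) (fun i => sval (v i)).
  exact: (fcons_comp (fun x : N' => sval x)).
move=> n p v; rewrite /comp; elim: p v => {n} [n|n t u|n r ts|n p IHp q IHq|n p IH] v //=.
- rewrite -!Et; split=> [->//|].
  by case: (eval v t) (eval v u) => [x hx] [y hy] /= E; apply: eq_exist.
- rewrite (_ : (fun i => sval (eval v (ts i))) = (fun i => eval (fun i => sval (v i)) (ts i))) //.
  by apply/funext => i.
- by rewrite IHp IHq.
- split=> [H x|H x].
    apply: contrapT => nx; have [] := tv _ (Neg p) (fun i => sval (v i)).
    + by move=> i; apply: svalP.
    + by exists x.
    + move=> y Sy; apply; have := H (exist _ y Sy).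
      by rewrite IH fcons_sval.
  by rewrite IH fcons_sval; apply: H.
Qed.

(* [P] constrains the finite stages: [True] gives downward Loewenheim-Skolem, and
   containment in an atomic tuple gives an atomic submodel. *)
Lemma tv_chain (P : seq N -> Prop) s0 : P s0 ->
  (forall s n (p : formula L n.+1) (v : 'I_n -> N), P s -> (forall i, v i \in s) ->
    (exists x, sat (fcons x v) p) -> exists2 x, sat (fcons x v) p & P (rcons s x)) ->
  exists S, [/\ tv_set S, countable S, {subset s0 <= S} &
    forall t : seq N, {subset t <= S} -> exists2 s, P s & {subset t <= s}].
Proof.
move=> P0 ext; have [e eP] := task_enum L.
pose solved (s s' : seq N) (t : task L) := (forall i, tidx t i < size s)%N -> forall x0,
  let v := fun i => nth x0 s (tidx t i) in
  (exists x, sat (fcons x v) (tfml t)) -> exists2 x, x \in s' & sat (fcons x v) (tfml t).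
(* Stage [k] answers all requirements numbered up to [k], and they return at each later stage,
   because a requirement has content only once its positions exist in the list. *)
have step k s : exists s', P s -> [/\ P s', exists t, s' = s ++ t &
    forall j t, (j <= k)%N -> e j = Some t -> solved s s' t].
  case: (pselect (P s)) => [Ps|]; last by exists s.
  suff [s' H] : exists s', [/\ P s', exists t, s' = s ++ t &
    forall j t, (j < k.+1)%N -> e j = Some t -> solved s s' t] by exists s'.
  elim: k.+1 => [|{}k [s' [Ps' [t ts'] H]]].
    by exists s; split=> //; exists [::]; rewrite cats0.
  case: (pselect (exists s'', [/\ P s'', exists t, s'' = s' ++ t &
     forall t, e k = Some t -> solved s s'' t])).
    move=> [s'' [Ps'' [t'' E] H']]; exists s''; split=> //.
      by exists (t ++ t''); rewrite catA -ts'.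
    move=> j u; rewrite ltnS leq_eqVlt => /orP[/eqP->|jk ju]; first exact: H'.
    move=> hu x0 v hv; have [x xs' xv] := H _ _ jk ju hu x0 hv.
    by exists x => //; rewrite E mem_cat xs'.
  move=> nex; exfalso; apply: nex.
  case E : (e k) => [[n p r]|]; last first.
    by exists s'; split=> //; exists [::]; rewrite cats0.
  case: (pselect (solved s s' (Task p r))) => [sol|].
    by exists s'; split=> //; [exists [::]; rewrite cats0|move=> u [<-]].
  move=> /not_implyP[hr /existsNP[x0 /not_implyP[hx nx]]].
  have [|x px Px] := ext s' n p (fun i => nth x0 s (r i)) Ps' _ hx.
    by move=> i; rewrite ts' mem_cat mem_nth.
  exists (rcons s' x); split=> //; first by exists [:: x]; rewrite cats1.
  move=> u [<-] _ y0 /= _; exists x; first by rewrite mem_rcons inE eqxx.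
  rewrite (_ : (fun i => nth y0 s (r i)) = (fun i => nth x0 s (r i))) //.
  by apply/funext => i; apply/set_nth_default/hr.
have /choice[F HF] : forall ks : nat * seq N, exists s', P ks.2 -> [/\ P s', exists t, s' = ks.2 ++ t &
    forall j t, (j <= ks.1)%N -> e j = Some t -> solved ks.2 s' t].
  by move=> [k s]; apply: step.
pose st := fix st k := if k is k.+1 then F (k, st k) else s0.
have Pst k : P (st k) by elim: k => //= k /(HF (k, _))[].
have mono i j : (i <= j)%N -> exists t, st j = st i ++ t.
  move=> /subnK <-; elim: (j - i)%N => [|d [t IH]]; first by exists [::]; rewrite cats0.
  rewrite addSn /=; have [_ [u ->] _] := HF (d + i, st (d + i)) (Pst _).
  by exists (t ++ u); rewrite IH catA.
pose S := \bigcup_k [set` st k].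
have Sfin (t : seq N) : {subset t <= S} -> exists k, {subset t <= st k}.
  elim: t => [|x t IH] h; first by exists 0.
  have [|k hk] := IH; first by move=> y yt; apply: h; rewrite inE yt orbT.
  have [j _ /= hj] : S x by apply/set_mem/h; rewrite inE eqxx.
  exists (maxn k j) => y; rewrite inE => /orP[/eqP->|/hk].
    by have [u ->] := mono j (maxn k j) (leq_maxr _ _); rewrite mem_cat hj.
  by have [u ->] := mono k (maxn k j) (leq_maxl _ _); rewrite mem_cat => ->.
exists S; split.
- move=> n p v Sv [x hx]; have [k hk] : exists k, {subset codom v <= st k}.
    by apply: Sfin => y /codomP[i ->]; apply/mem_set/Sv.
  have hv i : v i \in st k by apply/hk/codom_f.
  pose r i := index (v i) (st k).
  have [j ej] := eP (Task p r).
  (* At stage [K] the parameters are present and requirement [j] is among those treated. *)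
  pose K := maxn k j.
  have [_ _ H] := HF (K, st K) (Pst _).
  have [u eu] := mono k K (leq_maxl _ _).
  have rank i : (r i < size (st k))%N by rewrite index_mem.
  have ev : (fun i => nth x (st K) (r i)) = v.
    by apply/funext => i; rewrite eu nth_cat rank nth_index.
  have [||y yS hy] := H j _ (leq_maxr _ _) ej _ x.
  - by move=> i /=; rewrite eu size_cat; apply: leq_trans (leq_addr _ _).
  - by exists x; rewrite /= ev.
  exists y; last by move: hy; rewrite /= ev.
  by exists K.+1.
- apply: bigcup_countable => // k _; exact: finite_set_countable.
- by move=> x xs; apply/mem_set; exists 0.
- by move=> t /Sfin[k hk]; exists (st k).
Qed.

End TarskiVaught.

(** * The Ryll-Nardzewski theorem *)

Lemma mem_In (T : eqType) (x : T) s : x \in s -> List.In x s.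
Proof. by elim: s => //= y s IH; rewrite inE => /orP[/eqP->|/IH]; [left|right]. Qed.

Section RyllNardzewski.
Variable L : language.
Implicit Types N : structure L.

Lemma elementary_inj N N' (f : N -> N') : elementary f -> injective f.
Proof.
move=> ef x y fxy; pose v (i : 'I_2) := if i == ord0 then x else y.
have := ef _ (Equ (Var L (@ord0 1)) (Var L (@ord_max 1))) v.
by rewrite /= /v /= => -[_ ->].
Qed.

Lemma countable_tuples (T : Type) n : countable [set: T] ->
  exists e : nat -> option ('I_n -> T), forall v, exists k, e k = Some v.
Proof.
case/countable_injP => f finj; pose code (v : 'I_n -> T) := pickle [seq f (v i) | i <- enum 'I_n].
have code_inj : injective code.
  move=> v w /(pcan_inj pickleK)/eq_in_map E; apply/funext => i.
  by apply: finj; rewrite ?in_setT //; apply: E; rewrite mem_enum.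
exists (fun k => if pselect (exists t, code t = k) is left h then Some (projT1 (cid h)) else None).
move=> t; exists (code t); case: pselect => [h|[]]; last by exists t.
by congr Some; case: (cid h) => t' /= /code_inj.
Qed.

(** If [N'] were exhausted by a list of length [k], the sentence that every [k]-tuple misses some
    element would hold in [N] and fail in [N']. *)
Lemma elem_equiv_infinite N N' : elem_equiv N N' -> infinite_set [set: N] ->
  infinite_set [set: N'].
Proof.
move=> E infN /finite_seqP[s Es]; set k := size s.
pose p : formula L k := Ex (bigAnd [seq Neg (Equ (Var L ord0) (Var L (lift ord0 i))) | i <- enum 'I_k]).
have [/(_ _) H _] := elem_equiv_allN p E.
have {}H v : sat v p := H _ v.
have pE (N1 : structure L) (v : 'I_k -> N1) : sat v p <-> exists x, forall i, x <> v i.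
  rewrite sat_Ex; split=> -[x hx]; exists x.
    move=> i; move/sat_bigAnd: hx => /(_ (Neg (Equ (Var L ord0) (Var L (lift ord0 i))))) /=.
    rewrite fcons0 fconsS; apply; apply/List.in_map_iff; exists i; split=> //.
    by apply: mem_In; rewrite mem_enum.
  apply/sat_bigAnd => q /List.in_map_iff[i [<- _]] /=.
  by rewrite fcons0 fconsS; apply: hx.
have Hp (v : 'I_k -> N) : sat v p.
  apply/pE; apply: contrapT => /forallNP h; apply: infN.
  apply: (@sub_finite_set _ _ [set` codom v]); last exact: finite_seq.
  move=> x _ /=; move: (h x) => /existsNP[i /contrapT ->]; exact: codom_f.
have /pE[x hx] : sat (tnth (in_tuple s)) p by apply: H.
have : x \in s by have : [set: N'] x by []; rewrite Es.
by move=> /(tnthP (in_tuple s))[i E']; apply: (hx i).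
Qed.

Section Countable.
Variables M N0 : structure L.
Hypothesis Mcat : forall N1 N2 : structure L,
  countably_infinite N1 -> elem_equiv M N1 ->
  countably_infinite N2 -> elem_equiv M N2 -> isomorphic N1 N2.
Hypotheses (cN0 : countably_infinite N0) (eN0 : elem_equiv M N0).

(** By categoricity a countable elementary submodel of any model of the theory is a copy of [N0];
    whatever is found in such a submodel can therefore be pulled back to [N0]. *)
Lemma countable_embedding N S : elem_equiv M N -> tv_set S -> countable S ->
  exists g : N0 -> N, elementary g /\ range g = S.
Proof.
move=> eN tvS cS; have [N' [f [ef rf]]] := tv_submodel tvS.
have eN' : elem_equiv M N'.
  by apply: elem_equiv_trans eN _; apply/elem_equiv_sym/(elementary_equiv ef).
have cN' : countably_infinite N'.
  split.
    have /countable_injP[c cinj] : countable (range f) by rewrite rf.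
    apply/countable_injP; exists (c \o f) => x y _ _ /cinj E.
    by apply: (elementary_inj ef); apply: E; apply/mem_set; [exists x|exists y].
  apply: (elem_equiv_infinite _ (proj2 cN0)).
  by apply: elem_equiv_trans eN'; apply: elem_equiv_sym.
have [h [[k hK kK] eh]] := isomorphic_elementary (Mcat cN0 eN0 cN' eN').
exists (f \o h); split; first exact: elementary_comp.
rewrite -rf; apply/seteqP; split=> _ [x _ <-]; first by exists (h x).
by exists (k x) => //=; rewrite kK.
Qed.

(** A realisation exists in an elementary extension by compactness, and lies in a countable
    elementary submodel of it, which is a copy of [N0]. *)
Lemma countable_realize n (F : nat -> formula L n) :
  (forall k, exists v : 'I_n -> N0, forall i, (i < k)%N -> sat v (F i)) ->
  exists v : 'I_n -> N0, forall i, sat v (F i).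
Proof.
move=> H; have [|N [f [v [ef Hv]]]] := @compactness L N0 'I_n nat (fun=> n) F (fun _ i => inl i).
  move=> js; have [v hv] := H (\max_(j <- js) j).+1; exists v => j jj.
  by apply: hv; rewrite ltnS; apply: leq_bigmax_seq.
have [s n' p w _ _ [x hx]|S [tvS cS s0S _]] := @tv_chain L N (fun=> True) (codom v) I.
  by exists x.
have eN : elem_equiv M N by apply: elem_equiv_trans eN0 (elementary_equiv ef).
have [g [eg rg]] := countable_embedding eN tvS cS.
have /choice[w hw] : forall i, exists x, g x = v i.
  by move=> i; have := set_mem (s0S _ (codom_f v i)); rewrite -rg => -[x _ <-]; exists x.
by exists w => i; apply/eg; rewrite (_ : g \o w = v) //; apply/funext.
Qed.

(** Either [p] isolates a type of the theory or no tuple of [N0] satisfies it; the second case lets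
    [Bot] serve as a default value. *)
Definition complete n (p : formula L n) := forall q : formula L n,
  (exists2 v : 'I_n -> N0, sat v p & sat v q) -> forall v : 'I_n -> N0, sat v p -> sat v q.

(* Otherwise, halving [p] repeatedly so as to exclude the tuples of the countable
   model one after the other gives a type which that model does not realise. *)
Lemma complete_dense n (p : formula L n) : (exists v : 'I_n -> N0, sat v p) ->
  exists q, [/\ exists v : 'I_n -> N0, sat v q, complete q &
    forall v : 'I_n -> N0, sat v q -> sat v p].
Proof.
move=> satp; apply: contrapT => nq; have [e eP] := countable_tuples n (proj1 cN0).
pose good q := (exists v : 'I_n -> N0, sat v q) /\ forall v : 'I_n -> N0, sat v q -> sat v p.
have step (kq : nat * formula L n) : exists q', good kq.2 -> [/\ good q',
    forall v : 'I_n -> N0, sat v q' -> sat v kq.2 & forall v, e kq.1 = Some v -> ~ sat v q'].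
  move: kq => [k q] /=; case: (pselect (good q)) => [gq|]; last by exists q.
  case: (e k) => [v|]; last by exists q => _; split.
  have : ~ complete q by move=> cq; apply: nq; exists q; case: gq.
  move=> /existsNP[r /not_implyP[[v1 v1q v1r] /existsNP[v2 /not_implyP[v2q v2r]]]].
  case: gq => _ qp; case: (pselect (sat v r)) => vr.
    exists (And q (Neg r)) => _; split; last by move=> _ [<-] /sat_And[_ /(_ vr)].
      split; first by exists v2; apply/sat_And.
      by move=> u /sat_And[/qp].
    by move=> u /sat_And[].
  exists (And q r) => _; split; last by move=> _ [<-] /sat_And[_].
    split; first by exists v1; apply/sat_And.
    by move=> u /sat_And[/qp].
  by move=> u /sat_And[].
have /choice[F HF] := step.
pose st := fix st k := if k is k.+1 then F (k, st k) else p.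
have gst k : good (st k) by elim: k => [|k /(HF (k, _))[]].
have mono i j : (i <= j)%N -> forall v : 'I_n -> N0, sat v (st j) -> sat v (st i).
  move=> /subnK <-; elim: (j - i)%N => [|d IH] v //; rewrite addSn /= => h.
  by have [_ H _] := HF (d + i, st (d + i)) (gst _); apply/IH/H.
have [|v hv] := @countable_realize n st.
  by move=> k; have [[v hv] _] := gst k; exists v => i /ltnW/mono; apply.
have [k ek] := eP v; have [_ _ H] := HF (k, st k) (gst _).
exact: (H v ek (hv k.+1)).
Qed.

(** The chain keeps its finite stages inside tuples that satisfy a complete formula, so the submodel
    obtained is atomic. As it is a copy of [N0], [N0] is atomic too. *)
Lemma complete_atomic n (w : 'I_n -> N0) : exists2 q, complete q & sat w q.
Proof.
pose P (s : seq N0) := exists m (v : 'I_m -> N0) q,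
  [/\ complete q, sat v q & {subset s <= codom v}].
have [||S [tvS cS _ hS]] := @tv_chain L N0 P [::].
(* There is only one empty tuple, so every formula without free variables is complete. *)
- exists 0, (@fnil N0), (Neg (Bot L 0)); split=> // q [u _ uq] v _.
  by rewrite (_ : v = u) //; apply/funext => -[].
- move=> s n' p u [m [v [q [cq vq sv]]]] us [x xp].
  have /choice[r hr] : forall i, exists j, v j = u i.
    by move=> i; have /codomP[j ->] := sv _ (us i); exists j.
  have uE : v \o r = u by apply/funext.
  have rlE y (v' : 'I_m -> N0) : fcons y v' \o rlift r = fcons y (v' \o r).
    by rewrite /rlift fcons_comp fcons0; congr fcons; apply/funext => i /=; rewrite fconsS.
  (* A complete [q'] below [p'] isolates a way of adding a witness for [p] to some tuple satisfying
     [q]. Completeness of [q] then makes [Ex q'] true at the given tuple [v]. *)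
  pose p' := And (frename (rlift r) p) (frename (lift ord0) q).
  have p'E (y : N0) (v' : 'I_m -> N0) : sat (fcons y v') p' <-> sat (fcons y (v' \o r)) p /\ sat v' q.
    rewrite sat_And !sat_frename rlE (_ : _ \o _ = v') //.
    by apply/funext => i /=; rewrite fconsS.
  have [|q' [[v1 v1q'] cq' q'p']] := @complete_dense m.+1 p'.
    by exists (fcons x v); apply/p'E; rewrite uE.
  have /sat_Ex[y yq'] : sat v (Ex q').
    apply: (cq (Ex q')) vq; rewrite (fcons_eta v1) in v1q'.
    exists (v1 \o lift ord0); first by have /p'E[] := q'p' _ v1q'.
    by apply/sat_Ex; exists (v1 ord0).
  exists y; first by have /p'E[] := q'p' _ yq'; rewrite uE.
  exists m.+1, (fcons y v), q'; split=> // z.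
  rewrite mem_rcons inE => /orP[/eqP->|/sv/codomP[j ->]].
    by rewrite -[y in y \in _](fcons0 y v); apply: codom_f.
  by rewrite -(fconsS y v j); apply: codom_f.
have [g [eg rg]] := countable_embedding eN0 tvS cS.
have [|s [m [v [q [cq vq sv]]]] ws] := hS (codom (g \o w)).
  by move=> x /codomP[i ->]; apply/mem_set; rewrite -rg; exists (w i).
have /choice[r hr] : forall i, exists j, v j = g (w i).
  by move=> i; have /ws/sv/codomP[j E] := codom_f (g \o w) i; exists j.
pose eqs := [seq Equ (Var L (rshift m i)) (Var L (lshift n (r i))) | i <- enum 'I_n].
(* A subtuple of an atomic tuple is atomic: [t] says that [u] is the subtuple along [r] of some
   tuple satisfying [q]. *)
pose t := exN (And (frename (@lshift m n) q) (bigAnd eqs)).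
have tE (u : 'I_n -> N0) : sat u t <-> exists2 y : 'I_m -> N0, sat y q & u = y \o r.
  have E y : (fcat y u) \o @lshift m n = y by apply/funext => i /=; rewrite fcatl.
  rewrite sat_exN; split=> [[y /sat_And[/sat_frename]]|[y yq uy]].
    rewrite E => yq /sat_bigAnd h; exists y => //; apply/funext => i.
    have := h (Equ (Var L (rshift m i)) (Var L (lshift n (r i)))).
    rewrite /= fcatl fcatr; apply; apply/List.in_map_iff; exists i; split=> //.
    by apply: mem_In; rewrite mem_enum.
  exists y; apply/sat_And; split; first by apply/sat_frename; rewrite E.
  by apply/sat_bigAnd => _ /List.in_map_iff[i [<- _]] /=; rewrite fcatl fcatr uy.
exists t; last by apply/eg/tE; exists v => //; apply/funext => i /=; rewrite hr.
move=> k [u /tE[y yq ->] yk] u' /tE[y' y'q ->].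
apply/sat_frename; apply: (cq (frename r k)) y'q; exists y => //.
exact/sat_frename.
Qed.

(** Otherwise the negations of the complete formulas of all tuples of [N0] would be finitely
    satisfiable, hence satisfied together by a tuple that violates its own complete formula. *)
Lemma finitely_many_types n : exists l : seq (formula L n),
  (forall p, List.In p l -> complete p) /\
  forall v : 'I_n -> N0, exists2 p, List.In p l & sat v p.
Proof.
have [e eP] := countable_tuples n (proj1 cN0).
have /choice[F HF] : forall i, exists p : formula L n, complete p /\
    forall v, e i = Some v -> sat v p.
  move=> i; case: (e i) => [v|]; last by exists (Bot L n); split=> // q [].
  by have [q cq vq] := complete_atomic v; exists q; split=> // _ [<-].
apply: contrapT => nl; have [|v hv] := @countable_realize n (fun i => Neg (F i)).
  move=> k; apply: contrapT => /forallNP h; apply: nl.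
  exists (map F (iota 0 k)); split; first by move=> _ /List.in_map_iff[i [<- _]]; case: (HF i).
  move=> v; move: (h v) => /existsNP[i /not_implyP[ik /contrapT vi]]; exists (F i) => //.
  by apply/List.in_map_iff; exists i; split=> //; apply: mem_In; rewrite mem_iota.
have [k ek] := eP v; have [_ /(_ _ ek)] := HF k; exact: hv.
Qed.

End Countable.

(** One list serves all models of the theory, because types are going to be compared between [M] and
    its various elementary extensions. *)
Theorem Ryll_Nardzewski (M : structure L) n : omega_categorical M ->
  exists l : seq (formula L n),
  (forall N (v : 'I_n -> N), elem_equiv M N -> exists2 p, List.In p l & sat v p) /\
  (forall N N' (v : 'I_n -> N) (w : 'I_n -> N') p, elem_equiv M N -> elem_equiv M N' ->
     List.In p l -> sat v p -> sat w p -> forall q, sat v q -> sat w q).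
Proof.
move=> [[N0 [cN0 eN0]] cat]; have [l [lc lP]] := finitely_many_types cat cN0 eN0 n.
have eq0 N : elem_equiv M N -> elem_equiv N0 N.
  by apply: elem_equiv_trans; apply: elem_equiv_sym.
exists l; split.
  move=> N v /eq0 eN; apply/sat_bigOr; move: v; apply/(elem_equiv_allN _ eN) => v.
  exact/sat_bigOr.
move=> N N' v w p /eq0 eN /eq0 eN' pl vp wp q vq.
have : forall v : 'I_n -> N0, sat v (Imp p q).
  apply: lc => //; apply: contrapT => h.
  have /(elem_equiv_allN _ eN)/(_ v vp) : forall u : 'I_n -> N0, sat u (Imp p (Neg q)).
    by move=> u up uq; apply: h; exists u.
  exact.
by move=> /(elem_equiv_allN _ eN')/(_ w); apply.
Qed.
End RyllNardzewski.

(** * Types of finite tuples *)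

Section Codom.
Variable T : Type.

Lemma codom_fcons n (x : T) (v : 'I_n -> T) : codom (fcons x v) = x :: codom v.
Proof.
rewrite !codomE enum_ordSl /= fcons0 -map_comp; congr cons.
by apply: eq_map => i /=; rewrite fconsS.
Qed.

Lemma codom_fcat n m (a : 'I_n -> T) (b : 'I_m -> T) :
  codom (fcat a b) = codom a ++ codom b.
Proof.
elim: n a => [|n IH] a.
  have -> : codom a = [::] by apply: size0nil; rewrite size_codom card_ord.
  rewrite /= !codomE; apply: eq_map => i; rewrite -(fcatr a b i).
  by congr fcat; apply/val_inj.
rewrite (fcons_eta a) codom_fcons /= -IH -codom_fcons.
by rewrite -[fcat (fcons _ _) _]/(fcat (fcons _ _) _ : 'I_(n + m).+1 -> T) fcat_fcons.
Qed.

Lemma size_codom_ord n (v : 'I_n -> T) : size (codom v) = n.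
Proof. by rewrite size_codom card_ord. Qed.

Lemma size_codom_eq n (v w : 'I_n -> T) : size (codom v) = size (codom w).
Proof. by rewrite !size_codom_ord. Qed.

Lemma codom_comp (T' : Type) n (f : T -> T') (v : 'I_n -> T) :
  codom (f \o v) = map f (codom v).
Proof. by rewrite !codomE -map_comp. Qed.

Lemma codom_of_seq n (s : seq T) : size s = n -> exists v : 'I_n -> T, codom v = s.
Proof.
move=> sn; exists (tnth (in_tuple s) \o cast_ord (esym sn)).
case: n / sn; rewrite (_ : _ \o _ = tnth (in_tuple s)) ?codom_tnth ?codomE ?map_tnth_enum //.
by apply/funext => i /=; congr tnth; apply/val_inj.
Qed.

Lemma codom_inj n (v w : 'I_n -> T) : codom v = codom w -> v = w.
Proof.
rewrite !codomE => /eq_in_map E; apply/funext => i.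
by apply: E; rewrite mem_enum.
Qed.

End Codom.

(** * Partial elementary maps between models *)

Section PartialElementary.
Variable L : language.
Implicit Types N : structure L.

(* [tpeq s s'] says that [s_i |-> s'_i] is a well-defined partial elementary
   map; stated on pairs, it is insensitive to repetition and reordering. *)
Definition tpeq N N' (s : seq N) (s' : seq N') : Prop := size s = size s' /\
  forall n (v : 'I_n -> N) (w : 'I_n -> N'), (forall i, (v i, w i) \in zip s s') ->
  forall q, sat v q <-> sat w q.

Lemma tpeq_size N N' (s : seq N) (s' : seq N') : tpeq s s' -> size s = size s'.
Proof. by case. Qed.

Lemma tpeq_sym N N' (s : seq N) (s' : seq N') : tpeq s s' -> tpeq s' s.
Proof.
move=> [sz H]; split=> // n v w vw q; apply: iff_sym; apply: H => i.
case/(nthP (v i, w i)): (vw i) => j; rewrite size_zip sz minnn nth_zip // => js [E1 E2].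
apply/(nthP (w i, v i)); exists j; first by rewrite size_zip sz minnn.
by rewrite nth_zip // E1 E2.
Qed.

Lemma tpeq_sub N N' (s t : seq N) (s' t' : seq N') :
  tpeq s s' -> size t = size t' -> {subset zip t t' <= zip s s'} -> tpeq t t'.
Proof. by move=> [_ H] sz st; split=> // n v w vw; apply: H => i; apply: st. Qed.

Lemma tpeq_codom N N' n (v : 'I_n -> N) (w : 'I_n -> N') :
  tpeq (codom v) (codom w) <-> forall q, sat v q <-> sat w q.
Proof.
have E i : (v i, w i) \in zip (codom v) (codom w).
  rewrite !codomE zip_map.
  by apply/(map_f (fun i => (v i, w i))); rewrite mem_enum.
split=> [[_ H]|H]; first exact: H.
split=> [|m a b ab q]; first by rewrite !size_codom_ord.
have /choice[r hr] : forall i, exists j, v j = a i /\ w j = b i.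
  move=> i; have := ab i; rewrite !codomE zip_map.
  by move=> /mapP[j _ [-> ->]]; exists j.
have := H (frename r q); rewrite !sat_frename.
rewrite (_ : v \o r = a); last by apply/funext => i; case: (hr i).
by rewrite (_ : w \o r = b); last by apply/funext => i; case: (hr i).
Qed.

Lemma tpeq_refl N (s : seq N) : tpeq s s.
Proof. by have [v <-] := codom_of_seq (erefl (size s)); apply/tpeq_codom. Qed.

Lemma tpeq_trans N N' N'' (s' : seq N') (s : seq N) (s'' : seq N'') :
  tpeq s s' -> tpeq s' s'' -> tpeq s s''.
Proof.
move=> H H'; have := H; have := H'.
have [v <-] := codom_of_seq (erefl (size s)).
have [v' <-] := codom_of_seq (esym (tpeq_size H)).
have [v'' <-] := codom_of_seq (esym (etrans (tpeq_size H) (tpeq_size H'))).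
by rewrite !tpeq_codom => h h' q; rewrite h'.
Qed.

Lemma tpeq_map N N' (f : N -> N') (s : seq N) : elementary f -> tpeq s (map f s).
Proof.
move=> ef; have [v <-] := codom_of_seq (erefl (size s)).
by rewrite -codom_comp; apply/tpeq_codom => q; apply: ef.
Qed.

Lemma tpeq_nil N N' : elem_equiv N N' -> tpeq (Nil N) (Nil N').
Proof. by move=> E; split=> // -[|n] v w vw q; [exact: E|have := vw ord0]. Qed.

Lemma tpeq_eq N N' (s : seq N) (s' : seq N') x y x' y' : tpeq s s' ->
  (x, y) \in zip s s' -> (x', y') \in zip s s' -> x = x' <-> y = y'.
Proof.
move=> [_ H] xy xy'; pose v (T : Type) (x y : T) (i : 'I_2) := if i == ord0 then x else y.
have [|h1 h2] := H _ (v _ x x') (v _ y y') _ (Equ (Var L (@ord0 1)) (Var L (@ord_max 1))).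
  by move=> i; rewrite /v; case: ifP.
by split; [apply: h1|apply: h2].
Qed.

(** The entries of [t] recur in [s], so the equalities recorded in the type force their images to be
    the corresponding entries of [s']. *)
Lemma tpeq_dcl N N' (s t : seq N) (s' t1 t2 : seq N') : {subset t <= s} ->
  size s = size s' -> tpeq (s ++ t) (s' ++ t1) -> tpeq (s ++ t) (s' ++ t2) -> t1 = t2.
Proof.
move=> ts ss H1 H2; have := tpeq_size H1; have := tpeq_size H2; rewrite !size_cat => S2 S1.
have st : size t = size t1 by lia.
have st' : size t = size t2 by lia.
case: t1 H1 st S1 => [|y0 t1] H1 st S1; first by case: t2 st' {H2 S2} => //; rewrite st.
apply: (@eq_from_nth _ y0) => [|i it]; first by rewrite -st.
case: t ts H1 H2 st st' {S1 S2} => // x0 t ts H1 H2 st st'.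
have /(nthP x0)[j js E] : nth x0 (x0 :: t) i \in s by apply/ts/mem_nth; rewrite st.
have h (t' : seq N') : size (x0 :: t) = size t' -> tpeq (s ++ x0 :: t) (s' ++ t') ->
    nth y0 s' j = nth y0 t' i.
  move=> sz H; apply/(tpeq_eq H _ _ (x := nth x0 s j) (x' := nth x0 (x0 :: t) i)) => //;
    rewrite zip_cat // mem_cat; apply/orP; [left|right].
    by rewrite -nth_zip // mem_nth // size_zip -ss minnn.
  by rewrite -nth_zip // mem_nth // size_zip -sz minnn st.
by rewrite -(h _ st H1) -(h _ st' H2).
Qed.

Lemma tpeq_catC N N' (a b : seq N) (a' b' : seq N') : size a = size a' ->
  tpeq (a ++ b) (a' ++ b') -> tpeq (b ++ a) (b' ++ a').
Proof.
move=> sa H; have := tpeq_size H; rewrite !size_cat => sz.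
have sb : size b = size b' by lia.
apply: (tpeq_sub H); first by rewrite !size_cat sa sb.
by move=> x; rewrite !zip_cat // !mem_cat orbC.
Qed.

Lemma tpeq_catr N N' (a b : seq N) (a' b' : seq N') : size a = size a' ->
  tpeq (a ++ b) (a' ++ b') -> tpeq b b'.
Proof.
move=> sa H; have := tpeq_size H; rewrite !size_cat => sz.
by apply: (tpeq_sub H) => [|x]; [lia|rewrite zip_cat // mem_cat orbC => ->].
Qed.

Lemma tpeq_catl N N' (a b : seq N) (a' b' : seq N') : size a = size a' ->
  tpeq (a ++ b) (a' ++ b') -> tpeq a a'.
Proof.
by move=> sa H; apply: (tpeq_sub H) => // x; rewrite zip_cat // mem_cat => ->.
Qed.

Lemma tpeq_catm N N' (a b c : seq N) (a' b' c' : seq N') : size a = size a' ->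
  size b = size b' -> tpeq (a ++ b ++ c) (a' ++ b' ++ c') -> tpeq (a ++ c) (a' ++ c').
Proof.
move=> sa sb H; have := tpeq_size H; rewrite !size_cat => sz.
apply: (tpeq_sub H) => [|x]; first by rewrite !size_cat; lia.
by rewrite !zip_cat // !mem_cat => /orP[->|->]; rewrite ?orbT.
Qed.

Lemma tpeq_params N (a a' b c : seq N) : {subset c <= b} ->
  tpeq (a ++ b) (a' ++ b) -> size a = size a' -> tpeq (a ++ c) (a' ++ c).
Proof.
move=> cb H sa; apply: (tpeq_sub H); first by rewrite !size_cat sa.
have zz (s : seq N) : zip s s = map (fun x => (x, x)) s by elim: s => //= x s ->.
move=> x; rewrite !zip_cat // !mem_cat => /orP[->//|]; rewrite !zz.
by move=> /mapP[y /cb yb ->]; rewrite map_f ?orbT.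
Qed.

End PartialElementary.

Lemma In_mem (T : eqType) (x : T) s : List.In x s -> x \in s.
Proof. by elim: s => //= y s IH [->|/IH xs]; rewrite inE ?eqxx ?xs ?orbT. Qed.

Section PartialElementaryMore.
Variable L : language.
Implicit Types N : structure L.

Lemma tpeq_zip_sub N N' (s t : seq N) (s' t' : seq N') : {subset t <= s} ->
  size s = size s' -> tpeq (s ++ t) (s' ++ t') -> {subset zip t t' <= zip s s'}.
Proof.
move=> ts ss E; have st : size t = size t' by move: (tpeq_size E); rewrite !size_cat; lia.
move=> [y y'] yt; have ys : y \in s.
  apply: ts; move/(nthP (y, y')): yt => [j]; rewrite size_zip st minnn nth_zip // => jt [<- _].
  by rewrite mem_nth // st.
have [j js Ej] := nthP y ys; have jp : (y, nth y' s' j) \in zip s s'.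
  apply/(nthP (y, y')); exists j; first by rewrite size_zip -ss minnn.
  by rewrite nth_zip // Ej.
suff -> : y' = nth y' s' j by [].
apply/(tpeq_eq E _ _ (x := y) (x' := y)) => //; rewrite zip_cat // mem_cat.
  by rewrite yt orbT.
by rewrite jp.
Qed.

Lemma same_type_tpeq N (A : set N) n (v w : 'I_n -> N) (b : seq N) : {subset b <= A} ->
  same_type A v w -> tpeq (codom v ++ b) (codom w ++ b).
Proof.
move=> bA H; have [u ub] := codom_of_seq (erefl (size b)).
rewrite -ub -!codom_fcat; apply/tpeq_codom => q.
by apply: (H (PFormula q u)) => i; apply/set_mem/bA; have := codom_f u i; rewrite ub.
Qed.

Lemma tpeq_same_type N (A : set N) n (v w : 'I_n -> N) :
  (forall b : seq N, {subset b <= A} -> tpeq (codom v ++ b) (codom w ++ b)) -> same_type A v w.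
Proof.
move=> H th thA; have := H (codom (pparam th)); rewrite -!codom_fcat tpeq_codom.
by apply=> x /codomP[i ->]; apply/mem_set.
Qed.

Lemma psat_tpeq N N' n (th : pformula N n) (x : 'I_n -> N) (c : 'I_(parity th) -> N')
    (y : 'I_n -> N') : tpeq (codom x ++ codom (pparam th)) (codom y ++ codom c) ->
  psat th x -> fibre (pfml th) c y.
Proof. by rewrite -!codom_fcat => /tpeq_codom H; rewrite /psat /fibre H. Qed.

Lemma map_sub_image N N' (f : N -> N') (A : set N) (s : seq N) : {subset s <= A} ->
  {subset map f s <= f @` A}.
Proof. by move=> sA _ /mapP[x /sA /set_mem Ax ->]; apply/mem_set; exists x. Qed.

Lemma subset_image N N' (f : N -> N') (A : set N) (s : seq N') : {subset s <= f @` A} ->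
  exists2 t, {subset t <= A} & s = map f t.
Proof.
elim: s => [|y s IH] h; first by exists [::].
have [|t tA ->] := IH; first by move=> z zs; apply: h; rewrite inE zs orbT.
have /set_mem[x Ax <-] := h y (mem_head _ _); exists (x :: t) => //.
by move=> z; rewrite in_cons => /orP[/eqP->|/tA//]; apply/mem_set.
Qed.

(** The blocks are listed backwards, so that passing from [m] to [m.+1] puts the new block in front,
    where the extension lemmas add elements. *)
Definition flat N n (f : nat -> 'I_n -> N) (m : nat) : seq N :=
  flatten [seq codom (f i) | i <- rev (iota 0 m)].

Lemma flatS N n (f : nat -> 'I_n -> N) m : flat f m.+1 = codom (f m) ++ flat f m.
Proof. by rewrite /flat -[in LHS]addn1 iotaD add0n rev_cat. Qed.

Lemma mem_flat N n (f : nat -> 'I_n -> N) m i : (i < m)%N -> {subset codom (f i) <= flat f m}.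
Proof.
elim: m => // m IH; rewrite ltnS leq_eqVlt flatS => /orP[/eqP->|/IH im] x xs.
  by rewrite mem_cat xs.
by rewrite mem_cat im ?orbT.
Qed.

Lemma zip_flat N N' n (f : nat -> 'I_n -> N) (g : nat -> 'I_n -> N') m i :
  (i < m)%N -> {subset zip (codom (f i)) (codom (g i)) <= zip (flat f m) (flat g m)}.
Proof.
elim: m => // m IH; rewrite ltnS leq_eqVlt !flatS => im x xs.
rewrite zip_cat ?size_codom_ord // mem_cat.
by case/orP: im => [/eqP E|/IH h]; [rewrite -E xs|rewrite h ?orbT].
Qed.

Lemma size_flat N n (f : nat -> 'I_n -> N) m : size (flat f m) = (m * n)%N.
Proof. by elim: m => // m IH; rewrite flatS size_cat size_codom_ord IH mulSn. Qed.

End PartialElementaryMore.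

(** * Homogeneity and definability of types in the theory of M *)

Section OmegaCategorical.
Variables (L : language) (M : structure L).
Hypothesis Mcat : omega_categorical M.
Implicit Types N : structure L.

(** The type of [x :: s] is isolated by a formula [p], and [Ex p] belongs to the type of [s]. This
    is the substitute for saturation in all that follows. *)
Lemma tpeq_ext1 N N' (s : seq N) (s' : seq N') x : elem_equiv M N -> elem_equiv M N' ->
  tpeq s s' -> exists y, tpeq (x :: s) (y :: s').
Proof.
move=> eN eN' H; have := H.
have [v <-] := codom_of_seq (erefl (size s)).
have [w <-] := codom_of_seq (esym (tpeq_size H)).
move=> /tpeq_codom E; have [l [lP lc]] := Ryll_Nardzewski (size s).+1 Mcat.
have [p pl vp] := lP _ (fcons x v) eN.
have /E/sat_Ex[y yp] : sat v (Ex p) by apply/sat_Ex; exists x.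
exists y; rewrite -!codom_fcons; apply/tpeq_codom => q; split.
  exact: (lc _ _ _ _ p).
exact: (lc _ _ _ _ p).
Qed.

Lemma tpeq_ext N N' (s : seq N) (s' : seq N') t : elem_equiv M N -> elem_equiv M N' ->
  tpeq s s' -> exists2 t', size t = size t' & tpeq (t ++ s) (t' ++ s').
Proof.
move=> eN eN' H; elim: t => [|x t [t' sz IH]]; first by exists [::].
by have [y hy] := tpeq_ext1 x eN eN' IH; exists (y :: t') => //=; rewrite sz.
Qed.

Lemma tpeq_copy N (s : seq N) : elem_equiv M N -> exists s0 : seq M, tpeq s0 s.
Proof.
move=> eN; have [s0 _] := tpeq_ext s eN (@elem_equiv_refl L M) (tpeq_nil (elem_equiv_sym eN)).
by rewrite !cats0 => H; exists s0; apply: tpeq_sym.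
Qed.

(** There are finitely many types of [m]-tuples and each is isolated, so any union of types is given
    by a formula, the same in all models. Hence [Q] can be an arbitrary predicate. *)
Lemma definable_types (Q : seq M -> Prop) m : exists p : formula L m,
  forall N (v : 'I_m -> N), elem_equiv M N ->
  sat v p <-> exists2 s, Q s & tpeq s (codom v).
Proof.
have [l [lP lc]] := Ryll_Nardzewski m Mcat.
exists (bigOr (seq.filter (fun p => `[< exists2 v : 'I_m -> M, Q (codom v) & sat v p >]) l)) => N v eN.
rewrite sat_bigOr; split=> [[p /List.filter_In[pl /asboolP[w Qw wp]] vp]|[s Qs H]].
  exists (codom w) => //; apply/tpeq_codom => q.
  by split; apply: (lc _ _ _ _ p) => //; apply: elem_equiv_refl.
have [w ws] := codom_of_seq (etrans (tpeq_size H) (size_codom_ord v)).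
have [p pl vp] := lP _ v eN; exists p => //; apply/List.filter_In; split=> //.
apply/asboolP; exists w; first by rewrite ws.
by move: H; rewrite -ws => /tpeq_codom ->.
Qed.

Lemma finite_types n (b : seq M) : exists l : seq ('I_n -> M),
  forall x : 'I_n -> M, exists2 y, List.In y l & tpeq (codom x ++ b) (codom y ++ b).
Proof.
have [c <-] := codom_of_seq (erefl (size b)).
have [l [lP lc]] := Ryll_Nardzewski (n + size b) Mcat.
have eM := @elem_equiv_refl L M.
have [l' hl'] : exists l', forall (x : 'I_n -> M) p, List.In p l -> sat (fcat x c) p ->
   exists2 y, List.In y l' & sat (fcat y c) p.
  elim: l {lP lc} => [|p l [l' IH]]; first by exists [::].
  case: (pselect (exists x : 'I_n -> M, sat (fcat x c) p)) => [[x xp]|nx].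
    exists (x :: l') => y q [<- _|ql yq]; first by exists x => //; left.
    by have [z zl zq] := IH y q ql yq; exists z => //; right.
  by exists l' => y q [<- yp|ql yq]; [case: nx; exists y|apply: IH yq].
exists l' => x; have [p pl xp] := lP _ (fcat x c) eM.
have [y yl yp] := hl' x p pl xp; exists y => //.
rewrite -!codom_fcat; apply/tpeq_codom => q.
by split; apply: (lc _ _ _ _ p).
Qed.

Definition sumv V N N' (v : V -> N') (f : N -> N') (x : V + N) : N' :=
  match x with inl i => v i | inr a => f a end.

(** Compactness for conditions on types of finite tuples: each [Q j] may be any predicate, such as a
    prescribed dimension, since it is expressed by a formula. *)
Lemma type_compactness N (V : Type) (J : eqType) (l : J -> seq (V + N))
    (Q : J -> seq M -> Prop) : elem_equiv M N ->
  (forall js : seq J, exists v : V -> N, forall j, j \in js ->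
     exists2 s, Q j s & tpeq s (map (sumv v id) (l j))) ->
  exists N' (f : N -> N') (v : V -> N'), elementary f /\
    forall j, exists2 s, Q j s & tpeq s (map (sumv v f) (l j)).
Proof.
move=> eN H.
pose p j := projT1 (cid (definable_types (Q j) (size (l j)))).
have hp j N' (v : 'I__ -> N') : elem_equiv M N' ->
    sat v (p j) <-> exists2 s, Q j s & tpeq s (codom v).
  exact: projT2 (cid (definable_types (Q j) (size (l j)))) _ v.
have E N' (v : V -> N') (f : N -> N') j :
  codom (fun i => match tnth (in_tuple (l j)) i with inl x => v x | inr a => f a end) =
  map (sumv v f) (l j).
  rewrite -[LHS]/(codom (sumv v f \o tnth (in_tuple (l j)))) codom_comp.
  by rewrite (codomE (tnth _)) map_tnth_enum.
have [|N' [f [v [ef Hv]]]] := @compactness L N V J _ p (fun j => tnth (in_tuple (l j))).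
  move=> js; have [v hv] := H js; exists v => j jjs.
  by apply/hp => //; rewrite E; apply: hv.
exists N', f, v; split=> // j; rewrite -E; apply/hp => //.
exact: elem_equiv_trans eN (elementary_equiv ef).
Qed.

(** * The dimension of a tuple *)

Section DimensionMeasure.
Variables (R : realType) (h : dim_meas_fun R M).
Hypothesis hm : dimension_measure h.

Let eM : elem_equiv M M := @elem_equiv_refl L M.

(* Invariance under equality of types over [b]; by Ryll-Nardzewski, this is
   definability over [b]. *)
Definition tinv (b : seq M) n (X : set ('I_n -> M)) :=
  forall x y : 'I_n -> M, tpeq (codom x ++ b) (codom y ++ b) -> X x -> X y.

Definition cls (b : seq M) n (a : 'I_n -> M) : set ('I_n -> M) :=
  [set x | tpeq (codom x ++ b) (codom a ++ b)].

Lemma cls_refl b n (a : 'I_n -> M) : cls b a a.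
Proof. exact: tpeq_refl. Qed.

Lemma tinv_cls b n (a : 'I_n -> M) : tinv b (cls b a).
Proof. by move=> x y xy xa; apply: tpeq_trans xa; apply: tpeq_sym. Qed.

(** Conjugate sets are fibres of one formula; this brings them within reach of the axiom that the
    values of [h] on fibres are definable. *)
Lemma tinv_fibre b n (X : set ('I_n -> M)) b' (X' : set ('I_n -> M)) :
  tinv b X -> tinv b' X' -> tpeq b b' ->
  (forall x x' : 'I_n -> M, tpeq (codom x ++ b) (codom x' ++ b') -> X x <-> X' x') ->
  exists (p : formula L (n + size b)) (v w : 'I_(size b) -> M),
    [/\ codom v = b, codom w = b', X = fibre p v & X' = fibre p w].
Proof.
move=> iX iX' bb H.
have [v vb] := codom_of_seq (erefl (size b)).
have [w wb] := codom_of_seq (esym (tpeq_size bb)).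
have [p hp] := definable_types
  (fun s => exists2 x : 'I_n -> M, X x & s = codom x ++ b) (n + size b).
exists p, v, w; split=> //; apply/seteqP; split=> x.
- move=> Xx; apply/hp => //; exists (codom x ++ b); first by exists x.
  by rewrite codom_fcat vb; apply: tpeq_refl.
- move=> /(hp _ _ eM)[_ [y Xy ->]]; rewrite codom_fcat vb => E.
  exact: iX E Xy.
- move=> Xx; apply/hp => //.
  have [s sz E] := tpeq_ext (codom x) eM eM (tpeq_sym bb).
  have [y ys] := codom_of_seq (etrans (esym sz) (size_codom_ord x)).
  rewrite -ys in E; exists (codom y ++ b); last by rewrite codom_fcat wb; apply: tpeq_sym.
  by exists y => //; apply/(H _ x) => //; apply: tpeq_sym.
- move=> /(hp _ _ eM)[_ [y Xy ->]]; rewrite codom_fcat wb => E.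
  exact/(H _ _ E).
Qed.

Lemma tinv_definable b n (X : set ('I_n -> M)) : tinv b X -> definable X.
Proof.
move=> iX; have [||p [v [_ [_ _ -> _]]]] := tinv_fibre iX iX.
- exact: tpeq_refl.
- by move=> x x' E; split; apply: iX => //; apply: tpeq_sym.
by exists (PFormula p v).
Qed.

Lemma psat_tinv N n (th : pformula N n) (x y : 'I_n -> N) :
  tpeq (codom x ++ codom (pparam th)) (codom y ++ codom (pparam th)) ->
  psat th x -> psat th y.
Proof. by rewrite -!codom_fcat => /tpeq_codom H; rewrite /psat H. Qed.

Lemma definable_tinv n (X : set ('I_n -> M)) : definable X -> exists b, tinv b X.
Proof.
by move=> [th ->]; exists (codom (pparam th)) => x y; apply: psat_tinv.
Qed.

Lemma tinv_inDef b n (X : set ('I_n -> M)) : (0 < n)%N -> tinv b X -> X !=set0 -> inDef X.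
Proof. by move=> n0 iX X0; split=> //; apply: tinv_definable iX. Qed.

Lemma tinv_sub b c n (X : set ('I_n -> M)) : {subset b <= c} -> tinv b X -> tinv c X.
Proof.
by move=> bc iX x y E; apply/iX/(tpeq_params bc E); rewrite !size_codom_ord.
Qed.

(** For a fixed formula, the value of [h] on the fibre at a parameter tuple is a property definable
    without parameters, so it depends only on the type of the tuple. *)
Lemma h_conj b n (X : set ('I_n -> M)) b' (X' : set ('I_n -> M)) : (0 < n)%N ->
  X !=set0 -> tinv b X -> tinv b' X' -> tpeq b b' ->
  (forall x x' : 'I_n -> M, tpeq (codom x ++ b) (codom x' ++ b') -> X x <-> X' x') ->
  X' !=set0 /\ h X' = h X.
Proof.
move=> n0 X0 iX iX' bb H.
have [x Xx] := X0.
have [s sz E] := tpeq_ext (codom x) eM eM bb.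
have [y ys] := codom_of_seq (etrans (esym sz) (size_codom_ord x)).
have X'0 : X' !=set0 by exists y; apply/(H x) => //; rewrite ys.
split=> //.
have [p [v [w [Ev Ew EX EX']]]] := tinv_fibre iX iX' bb H.
have [q /seteqP[qv vq]] := dm_def hm p (h X) n0.
have vw : sat v q <-> sat w q by move: q {qv vq}; apply/tpeq_codom; rewrite Ev Ew.
have /vw/vq[_ <-] : sat v q by apply: qv; rewrite /= -EX.
by rewrite EX'.
Qed.

(** A set invariant over [b] is a finite disjoint union of types over [b]; the induction adds one
    type at a time. *)
Lemma tinv_ind b n (P : set ('I_n -> M) -> Prop) :
  (forall x, P (cls b x)) ->
  (forall X x, tinv b X -> X !=set0 -> X `&` cls b x = set0 -> P X -> P (X `|` cls b x)) ->
  forall X, tinv b X -> X !=set0 -> P X.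
Proof.
move=> P1 PU X; have [l hl] := finite_types n b.
have {hl} : forall x, X x -> exists2 y, List.In y l & tpeq (codom x ++ b) (codom y ++ b).
  by move=> x _; apply: hl.
elim: l X => [|y l IH] X hl iX [x Xx]; first by have [] := hl x Xx.
pose X' := X `\` cls b y.
have iX' : tinv b X'.
  move=> u v uv [Xu nu]; split; first exact: iX uv Xu.
  by move=> vy; apply: nu; apply: tpeq_trans vy.
have hX' u : X' u -> exists2 y, List.In y l & tpeq (codom u ++ b) (codom y ++ b).
  by move=> [Xu nu]; have [z [<-|zl] E] := hl u Xu; [case: nu|exists z].
case: (pselect (X y)) => [Xy|nXy]; last first.
  have <- : X' = X.
    apply/seteqP; split=> [u []//|u Xu]; split=> // uy; apply: nXy; exact: iX uy Xu.
  apply: IH => //; exists x; split=> // xy; apply: nXy; exact: iX xy Xx.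
case: (pselect (X' !=set0)) => [X'0|X'0].
  have -> : X = X' `|` cls b y.
    apply/seteqP; split=> u; last by move=> [[]//|uy]; apply: iX (tpeq_sym uy) Xy.
    by move=> Xu; case: (pselect (cls b y u)) => uy; [right|left].
  by apply: PU => //; [apply/seteqP; split=> // u [[]]|apply: IH].
have -> : X = cls b y; last exact: P1.
apply/seteqP; split=> u; last by move=> uy; apply: iX (tpeq_sym uy) Xy.
by move=> Xu; apply: contrapT => uy; apply: X'0; exists u.
Qed.

Lemma dim_mono n (X Y : set ('I_n -> M)) : inDef X -> inDef Y -> X `<=` Y ->
  ((h X).1 <= (h Y).1)%N.
Proof.
by move=> dX dY XY; have := dm_dimU hm dX dY; rewrite (setUidr XY) => ->; apply: leq_maxl.
Qed.

Lemma cls_inDef b n (x : 'I_n -> M) : (0 < n)%N -> inDef (cls b x).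
Proof. by move=> n0; apply: (@tinv_inDef b) => //; [apply: tinv_cls|exists x; apply: cls_refl]. Qed.

Lemma types_max b n (X : set ('I_n -> M)) : (0 < n)%N -> tinv b X -> X !=set0 ->
  exists2 x, X x & (h (cls b x)).1 = (h X).1.
Proof.
move=> n0; apply: (tinv_ind (P := fun X => exists2 x, X x & (h (cls b x)).1 = (h X).1)).
  by move=> x; exists x => //; apply: cls_refl.
move=> {}X x iX X0 _ [y Xy E].
rewrite (dm_dimU hm (tinv_inDef n0 iX X0) (cls_inDef b x n0)) /maxn.
case: ltnP => _; last by exists y => //; left.
by exists x => //; right; apply: cls_refl.
Qed.

(** Fubini with one-point fibres, whose value is [(0, 1)]. *)
Lemma proj_inj_l n m (W : set ('I_(n + m) -> M)) : (0 < n)%N -> (0 < m)%N -> inDef W ->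
  (forall a (c c' : 'I_m -> M), W (fcat a c) -> W (fcat a c') -> c = c') ->
  h [set a : 'I_n -> M | exists c, W (fcat a c)] = h W.
Proof.
move=> n0 m0 dW Winj.
have EA : [set a : 'I_n -> M | exists c, W (fcat a c)] = coord_proj (@lshift n m) @` W.
  apply/seteqP; split=> [a [c Wac]|_ [z Wz <-]].
    exists (fcat a c) => //; apply/funext => i; exact: fcatl.
  by exists (z \o @rshift n m); rewrite -fcat_eta.
have [] := @dm_fubini _ _ _ _ hm (n + m) n (@lshift n m) W 0 1%R _ (@lshift_inj n m) dW.
- by apply/andP; split=> //; lia.
- move=> _ [z Wz <-]; rewrite (_ : _ `&` _ = [set z]) ?dm_point //; first by lia.
  apply/seteqP; split=> [y [/= E Wy]|_ ->//].
  rewrite (fcat_eta y) (fcat_eta z) in Wy Wz *; congr fcat; first exact: E.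
  move: Wy; rewrite (_ : y \o _ = z \o @lshift n m) // => Wy.
  exact: Winj Wy Wz.
- by rewrite -EA addn0 mulr1 => E1 E2; apply: pair_ext.
Qed.

Lemma proj_inj_r n m (W : set ('I_(n + m) -> M)) : (0 < n)%N -> (0 < m)%N -> inDef W ->
  (forall c (a a' : 'I_n -> M), W (fcat a c) -> W (fcat a' c) -> a = a') ->
  h [set c : 'I_m -> M | exists a, W (fcat a c)] = h W.
Proof.
move=> n0 m0 dW Winj.
have EA : [set c : 'I_m -> M | exists a, W (fcat a c)] = coord_proj (@rshift n m) @` W.
  apply/seteqP; split=> [c [a Wac]|_ [z Wz <-]].
    exists (fcat a c) => //; apply/funext => i; exact: fcatr.
  by exists (z \o @lshift n m); rewrite -fcat_eta.
have [] := @dm_fubini _ _ _ _ hm (n + m) m (@rshift n m) W 0 1%R _ (@rshift_inj n m) dW.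
- by apply/andP; split=> //; lia.
- move=> _ [z Wz <-]; rewrite (_ : _ `&` _ = [set z]) ?dm_point //; first by lia.
  apply/seteqP; split=> [y [/= E Wy]|_ ->//].
  rewrite (fcat_eta y) (fcat_eta z) in Wy Wz *; congr fcat; last exact: E.
  move: Wy; rewrite (_ : y \o @rshift n m = z \o @rshift n m) // => Wy.
  exact: Winj Wy Wz.
- by rewrite -EA addn0 mulr1 => E1 E2; apply: pair_ext.
Qed.

Definition tset N n (s : seq N) : set ('I_n -> M) := [set x | tpeq (codom x) s].
Arguments tset {N} n s.

(* The dimension of [tp(s)], computed on its realisations in [M]. The empty tuple
   needs a separate clause since [h] is unconstrained on [M^0]. *)
Definition delta N (s : seq N) : nat :=
  if size s == 0 then 0 else (h (tset (size s) s)).1.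

Lemma deltaE N n (s : seq N) : size s = n -> (0 < n)%N -> delta s = (h (tset n s)).1.
Proof. by move=> <-; rewrite /delta; case: size. Qed.

Lemma delta_tpeq N N' (s : seq N) (s' : seq N') : tpeq s s' -> delta s = delta s'.
Proof.
move=> E; have sz := tpeq_size E; case: (posnP (size s)) => [s0|s0].
  by rewrite /delta -sz s0.
rewrite (deltaE (erefl (size s))) // (deltaE (esym sz)) //; congr (h _).1.
by apply/seteqP; split=> x xs; apply: tpeq_trans xs _ => //; apply: tpeq_sym.
Qed.

Lemma tset_tinv N n (s : seq N) : tinv [::] (tset n s).
Proof. by move=> x y; rewrite !cats0 => xy xs; apply: tpeq_trans xs; apply: tpeq_sym. Qed.

Lemma tset_nonempty N n (s : seq N) : elem_equiv M N -> size s = n -> tset n s !=set0.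
Proof.
move=> eN sn; have [s0 E] := tpeq_copy s eN.
by have [x xs] := codom_of_seq (etrans (tpeq_size E) sn); exists x; rewrite /tset /= xs.
Qed.

Lemma tset_inDef N n (s : seq N) : elem_equiv M N -> size s = n -> (0 < n)%N ->
  inDef (tset n s).
Proof.
move=> eN sn n0; apply: (tinv_inDef (b := [::])) => //; first exact: tset_tinv.
exact: tset_nonempty.
Qed.

Lemma tset_projl N n m (s t : seq N) : elem_equiv M N -> size s = n -> size t = m ->
  [set a : 'I_n -> M | exists c : 'I_m -> M, tset (n + m) (s ++ t) (fcat a c)] = tset n s.
Proof.
move=> eN sn tm; apply/seteqP; split=> [a [c]|a].
  by rewrite /tset /= codom_fcat; apply: tpeq_catl; rewrite size_codom_ord.
rewrite /tset /= => E; have [u sz E'] := tpeq_ext t eN eM (tpeq_sym E).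
have [c cu] := codom_of_seq (etrans (esym sz) tm); exists c.
rewrite codom_fcat cu; apply: tpeq_catC; first by rewrite sz.
exact: tpeq_sym.
Qed.

Lemma tset_projr N n m (s t : seq N) : elem_equiv M N -> size s = n -> size t = m ->
  [set c : 'I_m -> M | exists a : 'I_n -> M, tset (n + m) (s ++ t) (fcat a c)] = tset m t.
Proof.
move=> eN sn tm; apply/seteqP; split=> [c [a]|c].
  by rewrite /tset /= codom_fcat; apply: tpeq_catr; rewrite size_codom_ord.
rewrite /tset /= => E; have [u sz E'] := tpeq_ext s eN eM (tpeq_sym E).
have [a au] := codom_of_seq (etrans (esym sz) sn); exists a.
by rewrite codom_fcat au; apply: tpeq_sym.
Qed.

(** The halves of a realisation of [tp(s ++ t)] determine each other, so both projections are
    injective and preserve [h]. Hence only the set of entries counts, and tuples may be reordered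
    and repeated at will. *)
Lemma delta_eq N (s t : seq N) : elem_equiv M N -> s =i t -> delta s = delta t.
Proof.
move=> eN st; set n := size s; set m := size t.
have nil (u : seq N) : u =i [::] -> u = [::].
  by case: u => // x u /(_ x); rewrite inE eqxx.
case: (posnP n) => [n0|n0].
  by have -> : t = s; rewrite ?(size0nil n0) //; apply: nil => x; rewrite -st (size0nil n0).
case: (posnP m) => [m0|m0].
  by have -> : s = t; rewrite ?(size0nil m0) //; apply: nil => x; rewrite st (size0nil m0).
rewrite (@deltaE _ n) // (@deltaE _ m) //.
have dW : inDef (tset (n + m) (s ++ t)) by apply: tset_inDef => //; [rewrite size_cat|lia].
rewrite -(tset_projl eN (erefl n) (erefl m)) -(tset_projr eN (erefl n) (erefl m)).
rewrite proj_inj_l // ?proj_inj_r //.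
- move=> c a a'; rewrite /tset /= !codom_fcat => H1 H2; apply: codom_inj.
  apply: (@tpeq_dcl _ _ _ t s (codom c)); first by move=> x; rewrite st.
  + by rewrite size_codom_ord.
  + by apply: tpeq_catC; rewrite ?size_codom_ord //; apply: tpeq_sym.
  + by apply: tpeq_catC; rewrite ?size_codom_ord //; apply: tpeq_sym.
- move=> a c c'; rewrite /tset /= !codom_fcat => H1 H2; apply: codom_inj.
  apply: (@tpeq_dcl _ _ _ s t (codom a)); first by move=> x; rewrite st.
  + by rewrite size_codom_ord.
  + exact: tpeq_sym.
  + exact: tpeq_sym.
Qed.

Lemma graph_conj n m (x x' : 'I_(n + m) -> M) (w w' : 'I_m -> M) :
  tpeq (codom x ++ codom w) (codom x' ++ codom w') ->
  x \o @rshift n m = w -> x' \o @rshift n m = w'.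
Proof.
rewrite (fcat_eta x) (fcat_eta x') !codom_fcat -!catA => E xw.
have rE (y : 'I_(n + m) -> M) : fcat (y \o @lshift n m) (y \o @rshift n m) \o @rshift n m =
  y \o @rshift n m by rewrite -fcat_eta.
rewrite rE in xw; rewrite rE xw in E *; apply: codom_inj.
have {}E := tpeq_catr (etrans (size_codom_ord _) (esym (size_codom_ord _))) E.
have Ew := tpeq_catr (etrans (size_codom_ord _) (esym (size_codom_ord _))) E.
have sw : size (codom w) = size (codom w') by rewrite !size_codom_ord.
apply: (@tpeq_dcl _ _ _ (codom w) (codom w) (codom w')) => //.
  by apply: tpeq_catC; rewrite ?size_codom_ord.
apply: (tpeq_sub Ew); first by rewrite !size_cat sw.
by move=> z; rewrite zip_cat // mem_cat orbb.
Qed.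

(** A fibre of the projection to the last coordinates, kept inside the larger power of [M] as in the
    Fubini axiom; [cls] is its image in the smaller power. *)
Definition graph n m N (t : seq N) (w : 'I_m -> M) : set ('I_(n + m) -> M) :=
  [set z | tpeq (codom z) t /\ z \o @rshift n m = w].

Arguments graph n {m N} t w.

Lemma graph_tinv n m N (t : seq N) (w : 'I_m -> M) : tinv (codom w) (graph n t w).
Proof.
move=> x y E [xt xw]; split; last exact: graph_conj E xw.
by apply: tpeq_trans xt; apply: tpeq_sym; apply: tpeq_catl E; rewrite !size_codom_ord.
Qed.

Lemma graphE n m (a x : 'I_n -> M) (w y : 'I_m -> M) :
  graph n (codom a ++ codom w) w (fcat x y) <-> y = w /\ cls (codom w) a x.
Proof.
rewrite /graph /cls /= codom_fcat.
have -> : fcat x y \o @rshift n m = y by apply/funext => i; apply: fcatr.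
by split=> [[H yb]|[yb H]]; subst y.
Qed.

Lemma graph_nonempty n m (a : 'I_n -> M) (w : 'I_m -> M) :
  graph n (codom a ++ codom w) w !=set0.
Proof. by exists (fcat a w); apply/graphE; split=> //; apply: cls_refl. Qed.

Lemma h_graph n m (a : 'I_n -> M) (w : 'I_m -> M) : (0 < n)%N -> (0 < m)%N ->
  h (graph n (codom a ++ codom w) w) = h (cls (codom w) a).
Proof.
move=> n0 m0; have dW : inDef (graph n (codom a ++ codom w) w).
  by apply: (tinv_inDef (b := codom w)); [lia|apply: graph_tinv|apply: graph_nonempty].
rewrite -(proj_inj_l n0 m0 dW); last by move=> x c c' /graphE[-> _] /graphE[-> _].
congr (h _); apply/seteqP; split=> x; first by move=> [c /graphE[]].
by move=> xa; exists w; apply/graphE.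
Qed.

(** Fubini for the projection of [tp(ab)] onto [tp(b)]: its fibres are conjugate, so [h] takes one
    value on them, namely its value on [tp(a/b)]. *)
Lemma delta_cat_cls b n (a : 'I_n -> M) : (0 < n)%N ->
  delta (codom a ++ b) = ((h (cls b a)).1 + delta b)%N.
Proof.
move=> n0; case: b => [|b0 b]; first rewrite cats0 addn0.
  rewrite (deltaE (size_codom_ord a)) //; congr (h _).1.
  by apply/seteqP; split=> x; rewrite /cls /= !cats0.
set s := b0 :: b; pose m := size s; have m0 : (0 < m)%N by [].
have sz : size (codom a ++ s) = (n + m)%N by rewrite size_cat size_codom_ord.
have dW : inDef (tset (n + m) (codom a ++ s)) by apply: tset_inDef => //; lia.
rewrite (deltaE sz) ?(deltaE (erefl m)) //; last by lia.
have [v vs] := codom_of_seq (erefl m).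
have [] := @dm_fubini _ _ _ _ hm (n + m) m (@rshift n m)
  (tset (n + m) (codom a ++ s)) (h (cls s a)).1 (h (cls s a)).2 _ (@rshift_inj n m) dW.
- by apply/andP; split=> //; lia.
- move=> _ [z Wz <-]; rewrite -surjective_pairing -vs -h_graph //.
  set v' := coord_proj _ z.
  have -> : coord_proj (@rshift n m) @^-1` [set v'] `&` tset (n + m) (codom a ++ codom v) =
      graph n (codom a ++ codom v) v'.
    by apply/seteqP; split=> y [y1 y2].
  have zE : codom z = codom (z \o @lshift n m) ++ codom v' by rewrite {1}(fcat_eta z) codom_fcat.
  have vv : tpeq (codom v) (codom v').
    apply: tpeq_sym; move: Wz; rewrite /tset /= zE -vs.
    by apply: tpeq_catr; rewrite !size_codom_ord.
  have [|||||_ ->//] := @h_conj (codom v) _ (graph n (codom a ++ codom v) v) (codom v')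
    (graph n (codom a ++ codom v) v') _ _ _ _ vv.
  + by lia.
  + exact: graph_nonempty.
  + exact: graph_tinv.
  + exact: graph_tinv.
  + have ss (x x' : 'I_(n + m) -> M) : size (codom x) = size (codom x') by rewrite !size_codom_ord.
    move=> x x' E; split=> -[xt xw]; split; try exact: graph_conj xw.
    * exact: tpeq_trans (tpeq_sym (tpeq_catl (ss _ _) E)) xt.
    * exact: tpeq_trans (tpeq_catl (ss _ _) E) xt.
    * exact: graph_conj (tpeq_sym E) xw.
- move=> E1 _; rewrite E1 addnC; congr (_ + (h _).1)%N.
  rewrite -(tset_projr eM (size_codom_ord a) (erefl m)).
  apply/seteqP; split=> [_ [z Wz <-]|c [x Wx]].
    by exists (z \o @lshift n m); rewrite -fcat_eta.
  by exists (fcat x c) => //; apply/funext => i; apply: fcatr.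
Qed.

Lemma tpeq_copy2 N (b c : seq N) : elem_equiv M N ->
  exists b0 c0 : seq M, size b0 = size b /\ tpeq (b0 ++ c0) (b ++ c).
Proof.
move=> eN; have [c0 E] := tpeq_copy c eN.
have [b0 sz E'] := tpeq_ext b eN eM (tpeq_sym E).
by exists b0, c0; split=> //; apply: tpeq_sym.
Qed.

Lemma tpeq_copy3 N (a b c : seq N) : elem_equiv M N ->
  exists a0 b0 c0 : seq M, [/\ size a0 = size a, size b0 = size b &
    tpeq (a0 ++ b0 ++ c0) (a ++ b ++ c)].
Proof.
move=> eN; have [b0 [c0 [szb E]]] := tpeq_copy2 b c eN.
have [a0 sz E'] := tpeq_ext a eN eM (tpeq_sym E).
by exists a0, b0, c0; split=> //; apply: tpeq_sym.
Qed.

Lemma delta_leq_catM (a b : seq M) : (delta b <= delta (a ++ b))%N.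
Proof.
case: a => [|x a] //; have [v <-] := codom_of_seq (erefl (size (x :: a))).
by rewrite delta_cat_cls // leq_addl.
Qed.

Lemma delta_sub N (s t : seq N) : elem_equiv M N -> {subset s <= t} -> (delta s <= delta t)%N.
Proof.
move=> eN st; rewrite (@delta_eq _ t (t ++ s)) //; last first.
  by move=> x; rewrite mem_cat orb_idr //; apply: st.
have [b0 [c0 [sz E]]] := tpeq_copy2 t s eN.
rewrite -(delta_tpeq E) -(delta_tpeq (tpeq_catr sz E)); exact: delta_leq_catM.
Qed.

(** Rearranged, this is [d(a/bc) <= d(a/b)], which holds because [tp(a/bc)] contains [tp(a/b)]. *)
Lemma delta_submod N (a b c : seq N) : elem_equiv M N ->
  (delta (a ++ b ++ c) + delta b <= delta (a ++ b) + delta (b ++ c))%N.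
Proof.
move=> eN; have [a0 [b0 [c0 [sa sb E]]]] := tpeq_copy3 a b c eN.
have E' := E; rewrite !catA in E'.
have sab : size (a0 ++ b0) = size (a ++ b) by rewrite !size_cat sa sb.
rewrite -(delta_tpeq E) -(delta_tpeq (tpeq_catr sa E)) -(delta_tpeq (tpeq_catl sab E')).
rewrite -(delta_tpeq (tpeq_catl sb (tpeq_catr sa E))) {E E' sab sa}.
case: a0 => [|x a0]; first by rewrite /= addnC.
have [v <-] := codom_of_seq (erefl (size (x :: a0))).
rewrite !delta_cat_cls // -!addnA; rewrite (addnC (delta b0)) leq_add2r.
apply: dim_mono; try exact: cls_inDef.
move=> u; rewrite /cls /= => E; apply: (tpeq_params _ E); last by rewrite !size_codom_ord.
by move=> y yb; rewrite mem_cat yb.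
Qed.

(** Existence of independent copies: among the finitely many types over [bc] that extend [tp(a/b)],
    one has the full dimension. *)
Lemma delta_ext N (a b c : seq N) : elem_equiv M N -> exists a',
  [/\ size a' = size a, tpeq (a' ++ b) (a ++ b) &
    (delta (a' ++ b ++ c) + delta b = delta (a ++ b) + delta (b ++ c))%N].
Proof.
move=> eN; case: a => [|a1 a]; first by exists [::]; split=> //=; [exact: tpeq_refl|rewrite addnC].
move: (a1 :: a) (erefl : 0 < size (a1 :: a))%N => {a1}a a_gt0.
have [a0 [b0 [c0 [sa sb E]]]] := tpeq_copy3 a b c eN.
have Ebc := tpeq_catr sa E.
have Eab : tpeq (a0 ++ b0) (a ++ b).
  by rewrite !catA in E; apply: tpeq_catl E; rewrite !size_cat sa sb.
have [v va] := codom_of_seq sa.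
have [||x xv dx] := @types_max (b0 ++ c0) _ (cls b0 v) a_gt0.
- by apply: (@tinv_sub b0); [move=> y; rewrite mem_cat => ->|apply: tinv_cls].
- by exists v; apply: cls_refl.
have [a' sz Ea'] := tpeq_ext (codom x) eM eN Ebc.
have sz' : size a' = size a by rewrite -sz size_codom_ord.
exists a'; split=> //.
  apply: tpeq_trans Eab; apply: tpeq_sym; rewrite -va; apply: tpeq_trans (tpeq_sym xv) _.
  by rewrite !catA in Ea'; apply: tpeq_catl Ea'; rewrite !size_cat sz sb.
rewrite -(delta_tpeq Ea') -(delta_tpeq Eab) -(delta_tpeq Ebc) -(delta_tpeq (tpeq_catl sb Ebc)).
by rewrite -va !delta_cat_cls // dx; lia.
Qed.

(** * The rank of chains of dimension drops *)

(** As [delta] only sees the set of entries, equalities between concatenations are settled by cases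
    on membership, possibly with the help of a known inclusion. *)
Local Ltac mem_cases := let x := fresh in
  move=> x; rewrite ?mem_cat; repeat case: (x \in _) => //=.
Local Ltac delta_sets := apply: delta_eq => //; mem_cases.
Local Ltac delta_sets_with H := apply: delta_eq => //; let x := fresh in
  move=> x; move: (H x); rewrite ?mem_cat; repeat case: (x \in _) => //=;
  by move=> /(_ isT).

(* [Uge k a b]: there is a chain of k strict drops of the relative dimension
   [delta (a ++ b) - delta b] when the parameters [b] are enlarged. *)
Fixpoint Uge N k (a b : seq N) : Prop :=
  if k is k'.+1 then exists c,
    (delta (a ++ b ++ c) + delta b < delta (a ++ b) + delta (b ++ c))%N /\ Uge k' a (b ++ c)
  else True.

Lemma Uge_tpeq N N' k (a b : seq N) (a' b' : seq N') : elem_equiv M N -> elem_equiv M N' ->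
  size a = size a' -> tpeq (a ++ b) (a' ++ b') -> Uge k a b -> Uge k a' b'.
Proof.
move=> eN eN' sa; elim: k b b' => // k IH b b' E [c [dc Uc]].
have [c' sc E'] := tpeq_ext c eN eN' E.
have {}E' := tpeq_catC sc E'; rewrite -!catA in E'.
exists c'; split; last exact: IH E' Uc.
have sb : size b = size b' by move: (tpeq_size E); rewrite !size_cat; lia.
rewrite -(delta_tpeq E') -(delta_tpeq E) -(delta_tpeq (tpeq_catr sa E)).
by rewrite -(delta_tpeq (tpeq_catr sa E')).
Qed.

Lemma Uge_eq N k (a b a' b' : seq N) : elem_equiv M N -> a =i a' -> b =i b' ->
  Uge k a b -> Uge k a' b'.
Proof.
move=> eN aa; elim: k b b' => // k IH b b' bb [c [dc Uc]].
exists c; split; last by apply: IH Uc => x; rewrite !mem_cat bb.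
have E (u v : seq N) : u =i v -> delta u = delta v by apply: delta_eq.
rewrite (E (a' ++ b' ++ c) (a ++ b ++ c)); last by move=> x; rewrite !mem_cat aa bb.
rewrite (E (a' ++ b') (a ++ b)); last by move=> x; rewrite !mem_cat aa bb.
rewrite (E b' b); last by move=> x; rewrite bb.
by rewrite (E (b' ++ c) (b ++ c)) // => x; rewrite !mem_cat bb.
Qed.

(** Every drop costs at least one, so the length of a chain is bounded by [d(a/b)]; this makes the
    rank finite. *)
Lemma Uge_delta N k (a b : seq N) : elem_equiv M N -> Uge k a b ->
  (k + delta b <= delta (a ++ b))%N.
Proof.
move=> eN; elim: k b => [|k IH] b; last by move=> [c [dc /IH]]; lia.
by move=> _; apply: delta_sub => // x; rewrite mem_cat orbC => ->.
Qed.

Lemma Uge_pred N k (a b : seq N) : Uge k.+1 a b -> Uge k a b.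
Proof. by elim: k b => // k IH b [c [dc /IH Uc]]; exists c. Qed.

Lemma Uge_leq N k j (a b : seq N) : (j <= k)%N -> Uge k a b -> Uge j a b.
Proof. by move=> /subnK <-; elim: (k - j)%N => // d IH; rewrite addSn => /Uge_pred. Qed.

(** The first parameter of the chain absorbs [c]: the drop only grows, since [d(a/bc) <= d(a/b)]. *)
Lemma Uge_cat N k (a b c : seq N) : elem_equiv M N -> Uge k a (b ++ c) -> Uge k a b.
Proof.
move=> eN; case: k => // k [e []]; rewrite -!catA => de Ue; exists (c ++ e); split=> //.
have := delta_submod a b c eN; lia.
Qed.

Lemma Uge_sub N k (a b c : seq N) : elem_equiv M N -> {subset b <= c} ->
  Uge k a c -> Uge k a b.
Proof.
move=> eN bc Uc; apply: (@Uge_cat _ _ _ _ c) => //; apply: Uge_eq Uc => // x.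
by rewrite mem_cat orb_idl //; apply: bc.
Qed.

(** The parameter [e] of the first drop is replaced by a copy [e'] over [ab] with
    [d(e'/abc) = d(e'/ab)]. By transitivity [a] is then independent from [c] over [be'] too, so the
    drop at [e'] persists over [bc] and the induction goes on. *)
Lemma Uge_indep N k (a b c : seq N) : elem_equiv M N ->
  (delta (a ++ b ++ c) + delta b = delta (a ++ b) + delta (b ++ c))%N ->
  Uge k a b -> Uge k a (b ++ c).
Proof.
move=> eN; elim: k b => // k IH b abc [e [de Ue]].
have [e' [se E dE]] := delta_ext e (a ++ b) c eN.
have E' := tpeq_catC se E; rewrite -!catA in E'.
have Ue' : Uge k a (b ++ e') by apply: Uge_tpeq Ue => //; apply: tpeq_sym.
have Ebe : delta (b ++ e') = delta (b ++ e) := delta_tpeq (tpeq_catr erefl E').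
have Eabe : delta (a ++ b ++ e') = delta (a ++ b ++ e) := delta_tpeq E'.
have S := delta_submod e' b c eN.
have S' := delta_submod a (b ++ e') c eN.
have D1 : delta (e ++ a ++ b) = delta (a ++ b ++ e) by delta_sets.
have D2 : delta (e' ++ (a ++ b) ++ c) = delta (a ++ (b ++ e') ++ c) by delta_sets.
have D3 : delta (e' ++ b ++ c) = delta ((b ++ e') ++ c) by delta_sets.
have D4 : delta (e' ++ b) = delta (b ++ e') by delta_sets.
have D5 : delta (a ++ (b ++ c) ++ e') = delta (a ++ (b ++ e') ++ c) by delta_sets.
have D6 : delta ((b ++ c) ++ e') = delta ((b ++ e') ++ c) by delta_sets.
have D7 : delta ((a ++ b) ++ c) = delta (a ++ b ++ c) by rewrite catA.
exists e'; split; first by lia.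
apply: (@Uge_eq _ _ a ((b ++ e') ++ c)) => //; first by mem_cases.
by apply: IH => //; lia.
Qed.

Lemma Uge_absorb N k (a b c : seq N) : elem_equiv M N -> {subset b <= c} ->
  Uge k a c -> Uge k (a ++ b) c.
Proof.
move=> eN; elim: k c => // k IH c bc [e [de Ue]].
exists e; split; last by apply: IH Ue => x /bc; rewrite mem_cat => ->.
have D1 : delta ((a ++ b) ++ c ++ e) = delta (a ++ c ++ e).
  apply: delta_eq => // x; move: (bc x); rewrite !mem_cat.
  by case: (x \in b); case: (x \in a) => //= ->.
have D2 : delta ((a ++ b) ++ c) = delta (a ++ c).
  apply: delta_eq => // x; move: (bc x); rewrite !mem_cat.
  by case: (x \in b); case: (x \in a) => //= ->.
lia.
Qed.

(** The drops of [b] are made first, at parameters chosen independent from [a] over [bc], which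
    leaves the chain for [a] intact. When they are used up, [b] joins the base and the drops of [a]
    follow. *)
Lemma Lascar_ge N i j (a b c : seq N) : elem_equiv M N ->
  Uge i b c -> Uge j a (b ++ c) -> Uge (i + j) (a ++ b) c.
Proof.
move=> eN; elim: i c => [|i IH] c.
  move=> _ Ua; apply: (@Uge_sub _ _ _ _ (b ++ c)) => //; first by move=> x; rewrite mem_cat orbC => ->.
  by apply: Uge_absorb => // x; rewrite mem_cat => ->.
move=> [e [de Ue]] Ua.
have [e' [se E dE]] := delta_ext e (b ++ c) a eN.
have E' := tpeq_catC se E; rewrite -!catA in E'.
have Ue' : Uge i b (c ++ e') by apply: Uge_tpeq Ue => //; apply: tpeq_sym.
have E1 : delta (c ++ e') = delta (c ++ e) := delta_tpeq (tpeq_catr erefl E').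
have E2 : delta (b ++ c ++ e') = delta (b ++ c ++ e) := delta_tpeq E'.
have D1 : delta (e ++ b ++ c) = delta (b ++ c ++ e) by delta_sets.
have D2 : delta (e' ++ (b ++ c) ++ a) = delta (a ++ (b ++ c) ++ e') by delta_sets.
have D3 : delta ((b ++ c) ++ a) = delta (a ++ b ++ c) by delta_sets.
have D4 : delta ((b ++ c) ++ e') = delta (b ++ c ++ e') by rewrite catA.
have D5 : delta ((a ++ b) ++ c ++ e') = delta (a ++ (b ++ c) ++ e') by rewrite -!catA.
have D6 : delta ((a ++ b) ++ c) = delta (a ++ b ++ c) by rewrite catA.
exists e'; split; first by lia.
apply: IH => //; rewrite catA; apply: Uge_indep => //; lia.
Qed.

(** By additivity of [d], a drop of [ab] is a drop of [b] over [c] or of [a] over [bc]; it is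
    credited to [b] whenever [b] drops. *)
Lemma Lascar_le N k (a b c : seq N) : elem_equiv M N -> Uge k (a ++ b) c ->
  exists i j, [/\ (i + j = k)%N, Uge i b c & Uge j a (b ++ c)].
Proof.
move=> eN; elim: k c => [|k IH] c; first by exists 0, 0.
move=> [e [de /IH[i [j [ij Ub Ua]]]]].
have D1 : delta ((a ++ b) ++ c ++ e) = delta (a ++ (b ++ c) ++ e) by rewrite -!catA.
have D2 : delta ((a ++ b) ++ c) = delta (a ++ b ++ c) by rewrite catA.
have D3 : delta ((b ++ c) ++ e) = delta (b ++ c ++ e) by rewrite catA.
have Ub' := Uge_cat eN Ub.
have Ua' : Uge j a (b ++ c) by rewrite catA in Ua; apply: Uge_cat Ua.
case: (ltnP (delta (b ++ c ++ e) + delta c) (delta (b ++ c) + delta (c ++ e))) => hb.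
  by exists i.+1, j; split=> //; [lia|exists e].
exists i, j.+1; split=> //; first by lia.
exists e; split; last by rewrite -catA.
lia.
Qed.

(** The candidate for the SU-rank of [tp(a/b)] with [b] finite. The range of [k] loses nothing, as
    no chain is longer than [delta (a ++ b)]. *)
Definition U N (a b : seq N) := \max_(k < (delta (a ++ b)).+1 | `[< Uge k a b >]) k.

Lemma UgeP N k (a b : seq N) : elem_equiv M N -> Uge k a b <-> (k <= U a b)%N.
Proof.
move=> eN; split=> [Uk|].
  have lk : (k < (delta (a ++ b)).+1)%N by have := Uge_delta eN Uk; lia.
  by apply: (@leq_bigmax_cond _ _ (fun i : 'I__ => i : nat) (Ordinal lk)); apply/asboolP.
move=> /Uge_leq; apply.
have [|i /asboolP Ui E] := @eq_bigmax_cond _ (fun k : 'I_(delta (a ++ b)).+1 => `[< Uge k a b >]) (fun i => i : nat).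
  by apply/card_gt0P; exists ord0; apply/asboolP.
by rewrite /U E.
Qed.

Lemma U_tpeq N N' (a b : seq N) (a' b' : seq N') : elem_equiv M N -> elem_equiv M N' ->
  size a = size a' -> tpeq (a ++ b) (a' ++ b') -> U a b = U a' b'.
Proof.
move=> eN eN' sa E; apply/eqP; rewrite eqn_leq.
apply/andP; split; apply/UgeP => //.
  by apply: (Uge_tpeq _ _ _ E) => //; apply/UgeP.
by apply: (Uge_tpeq _ _ _ (tpeq_sym E)) => //; apply/UgeP.
Qed.

Lemma U_eq N (a b a' b' : seq N) : elem_equiv M N -> a =i a' -> b =i b' -> U a b = U a' b'.
Proof.
move=> eN aa bb; apply/eqP; rewrite eqn_leq; apply/andP; split; apply/UgeP => //.
  by apply: (@Uge_eq _ _ a b) => //; apply/UgeP.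
by apply: (@Uge_eq _ _ a' b') => //; apply/UgeP.
Qed.

Lemma U_sub N (a b c : seq N) : elem_equiv M N -> {subset b <= c} -> (U a c <= U a b)%N.
Proof. by move=> eN bc; apply/UgeP => //; apply: (@Uge_sub _ _ _ _ c) => //; apply/UgeP. Qed.

Lemma U_indep N (a b c : seq N) : elem_equiv M N ->
  (delta (a ++ b ++ c) + delta b = delta (a ++ b) + delta (b ++ c))%N ->
  U a (b ++ c) = U a b.
Proof.
move=> eN E; apply/eqP; rewrite eqn_leq U_sub //=; last by move=> x; rewrite mem_cat => ->.
by apply/UgeP => //; apply: Uge_indep => //; apply/UgeP.
Qed.

Lemma U_drop N (a b c : seq N) : elem_equiv M N ->
  (delta (a ++ b ++ c) + delta b < delta (a ++ b) + delta (b ++ c))%N ->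
  (U a (b ++ c) < U a b)%N.
Proof.
by move=> eN E; apply/UgeP => //; exists c; split=> //; apply/UgeP.
Qed.

Lemma U_add N (a b c : seq N) : elem_equiv M N -> U (a ++ b) c = (U b c + U a (b ++ c))%N.
Proof.
move=> eN; apply/eqP; rewrite eqn_leq; apply/andP; split; last first.
  by apply/UgeP => //; apply: Lascar_ge => //; apply/UgeP.
have /(Lascar_le eN)[i [j [<- /(UgeP _ _ _ eN) hi /(UgeP _ _ _ eN) hj]]] : Uge (U (a ++ b) c) (a ++ b) c.
  by apply/UgeP.
exact: leq_add.
Qed.

(** * Dividing formulas drop the dimension *)

(* The measure of [X] as a [D]-dimensional set: lower-dimensional sets and the
   empty set get [0], which makes it additive below dimension [D]. *)
Definition dmeas (D : nat) n (X : set ('I_n -> M)) : R :=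
  if `[< X !=set0 >] && ((h X).1 == D) then (h X).2 else 0%R.

Definition ledim (D : nat) n (X : set ('I_n -> M)) := X !=set0 -> ((h X).1 <= D)%N.

Lemma dmeas0 D n : dmeas D (set0 : set ('I_n -> M)) = 0%R.
Proof. by rewrite /dmeas; case: asboolP => // -[]. Qed.

Lemma dmeas_ge0 D b n (X : set ('I_n -> M)) : (0 < n)%N -> tinv b X -> (0 <= dmeas D X)%R.
Proof.
move=> n0 iX; rewrite /dmeas; case: asboolP => //= X0; case: ifP => // _.
exact/ltW/(dm_pos hm)/(tinv_inDef n0 iX).
Qed.

Lemma ledim_sub D b n (X Y : set ('I_n -> M)) : (0 < n)%N -> tinv b X -> tinv b Y ->
  X `<=` Y -> ledim D Y -> ledim D X.
Proof.
move=> n0 iX iY XY hY X0; have Y0 : Y !=set0 by case: X0 => x /XY; exists x.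
by apply: leq_trans (hY Y0); apply: (dim_mono) => //; apply: (tinv_inDef (b := b)).
Qed.

Lemma dmeasU D b n (X Y : set ('I_n -> M)) : (0 < n)%N -> tinv b X -> tinv b Y ->
  X `&` Y = set0 -> ledim D X -> ledim D Y -> dmeas D (X `|` Y) = (dmeas D X + dmeas D Y)%R.
Proof.
move=> n0 iX iY XY hX hY.
have [X0|X0] := pselect (X !=set0); last first.
  by have -> : X = set0; [apply: contrapT => /eqP/set0P|rewrite set0U dmeas0 add0r].
have [Y0|Y0] := pselect (Y !=set0); last first.
  by have -> : Y = set0; [apply: contrapT => /eqP/set0P|rewrite setU0 dmeas0 addr0].
have dX := tinv_inDef n0 iX X0; have dY := tinv_inDef n0 iY Y0.
have XY0 : X `|` Y !=set0 by case: X0 => x Xx; exists x; left.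
rewrite /dmeas !asboolT //= (dm_dimU hm dX dY).
have := hX X0; have := hY Y0; rewrite /maxn => lY lX.
case: (ltngtP (h X).1 (h Y).1) => XYd.
- rewrite (dm_measU_lt hm dX dY XY XYd) (_ : (h X).1 == D = false) ?add0r //; lia.
- rewrite setUC (dm_measU_lt hm dY dX _ XYd) 1?setIC // (_ : (h Y).1 == D = false) ?addr0 //; lia.
- by rewrite (dm_measU_eq hm dX dY XY XYd) XYd; case: ifP => // _; rewrite addr0.
Qed.

Lemma tinv_setI b n (X Y : set ('I_n -> M)) : tinv b X -> tinv b Y -> tinv b (X `&` Y).
Proof. by move=> iX iY x y E [/(iX _ _ E) ? /(iY _ _ E)]. Qed.

Lemma tinv_setD b n (X Y : set ('I_n -> M)) : tinv b X -> tinv b Y -> tinv b (X `\` Y).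
Proof.
move=> iX iY x y E [/(iX _ _ E) ? nY]; split=> // /(iY _ _ (tpeq_sym E)); exact: nY.
Qed.

Lemma tinv_setU b n (X Y : set ('I_n -> M)) : tinv b X -> tinv b Y -> tinv b (X `|` Y).
Proof. by move=> iX iY x y E [/(iX _ _ E)|/(iY _ _ E)]; [left|right]. Qed.

Lemma dmeas_split D b n (X Y : set ('I_n -> M)) : (0 < n)%N -> tinv b X -> tinv b Y ->
  ledim D X -> dmeas D X = (dmeas D (X `&` Y) + dmeas D (X `\` Y))%R.
Proof.
move=> n0 iX iY hX; rewrite -(@dmeasU D b) //.
- congr dmeas; apply/seteqP; split=> x; last by move=> [[]|[]].
  by move=> Xx; case: (pselect (Y x)); [left|right].
- exact: tinv_setI.
- exact: tinv_setD.
- by apply/seteqP; split=> // x [[_ ?] []].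
- by apply: (@ledim_sub _ b) hX => //; apply: tinv_setI.
- by apply: (@ledim_sub _ b) hX => //; apply: tinv_setD.
Qed.

(** Double counting, by induction on the list: the head [Y] cuts [Z] in two, and on [Z] inside [Y]
    one of the allowed memberships is used up. *)
Lemma dmeas_count D b n (l : seq (set ('I_n -> M))) (Z : set ('I_n -> M)) c : (0 < n)%N ->
  tinv b Z -> (forall Y, List.In Y l -> tinv b Y) -> ledim D Z ->
  (forall z, Z z -> (count (fun Y : set _ => `[< Y z >]) l <= c)%N) ->
  (\sum_(Y <- l) dmeas D (Z `&` Y) <= dmeas D Z *+ c)%R.
Proof.
move=> n0; elim: l Z c => [|Y l IH] Z c iZ il hZ hc.
  by rewrite big_nil mulrn_wge0 //; apply: (@dmeas_ge0 _ b).
have iY : tinv b Y by apply: il; left.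
have il' Y' : List.In Y' l -> tinv b Y' by move=> ?; apply: il; right.
have iZY := tinv_setI iZ iY; have iZD := tinv_setD iZ iY.
have hZY : ledim D (Z `&` Y) by apply: (@ledim_sub _ b) hZ.
have hZD : ledim D (Z `\` Y) by apply: (@ledim_sub _ b) hZ.
have [ZY0|ZY0] := pselect (Z `&` Y !=set0); last first.
  have ZYE : Z `&` Y = set0 by apply: contrapT => /eqP/set0P.
  rewrite big_cons ZYE dmeas0 add0r; apply: IH => // z Zz; apply: leq_trans (hc z Zz).
  exact: leq_addl.
case: c hc => [|c] hc.
  by case: ZY0 => z [Zz Yz]; have := hc z Zz; rewrite /= asboolT.
have H1 : (\sum_(Y' <- l) dmeas D ((Z `&` Y) `&` Y') <= dmeas D (Z `&` Y) *+ c)%R.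
  by apply: IH => // z [Zz Yz]; have := hc z Zz; rewrite /= asboolT.
have H2 : (\sum_(Y' <- l) dmeas D ((Z `\` Y) `&` Y') <= dmeas D (Z `\` Y) *+ c.+1)%R.
  by apply: IH => // z [Zz Yz]; have := hc z Zz; rewrite /= asboolF.
have -> : (\sum_(Y' <- Y :: l) dmeas D (Z `&` Y') = dmeas D (Z `&` Y) +
    (\sum_(Y' <- l) dmeas D ((Z `&` Y) `&` Y') + \sum_(Y' <- l) dmeas D ((Z `\` Y) `&` Y')))%R.
  rewrite big_cons -big_split /=; congr (_ + _)%R.
  elim: l il' {IH il hc H1 H2} => [|Y' l IHl] il; first by rewrite !big_nil.
  rewrite !big_cons IHl; last by move=> ? ?; apply: il; right.
  congr (_ + _)%R; have iY' : tinv b Y' by apply: il; left.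
  have hZY' : ledim D (Z `&` Y') by apply: (@ledim_sub _ b) hZ => //; apply: tinv_setI.
  rewrite (dmeas_split n0 (tinv_setI iZ iY') iY hZY').
  by congr (_ + _)%R; congr dmeas; apply/seteqP; split=> x [[]].
rewrite (dmeas_split n0 iZ iY hZ) mulrnDl mulrS -addrA lerD2l.
exact: lerD.
Qed.

(** The type [t] over some [b] may live in an extension [N]; here it is transported to a copy [b0]
    of [b] in [M], where [h] can measure its realisations. *)
Definition rset N n (b0 : seq M) (t : seq N) : set ('I_n -> M) :=
  [set x | tpeq (codom x ++ b0) t].
Arguments rset {N} n b0 t.

Lemma rset_tinv N n b0 (t : seq N) : tinv b0 (rset n b0 t).
Proof. by move=> x y E Ex; apply: tpeq_trans Ex; apply: tpeq_sym. Qed.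

Lemma rset_nonempty N n b0 (a b : seq N) : elem_equiv M N -> size a = n -> tpeq b0 b ->
  rset n b0 (a ++ b) !=set0.
Proof.
move=> eN sa E; have [s sz E'] := tpeq_ext a eN eM (tpeq_sym E).
by have [x xs] := codom_of_seq (etrans (esym sz) sa); exists x; rewrite /rset /= xs; apply: tpeq_sym.
Qed.

Lemma rset_dim N n b0 (a b : seq N) : elem_equiv M N -> (0 < n)%N -> size a = n ->
  tpeq b0 b -> ((h (rset n b0 (a ++ b))).1 + delta b = delta (a ++ b))%N.
Proof.
move=> eN n0 sa E; have [x xE] := rset_nonempty eN sa E.
rewrite -(delta_tpeq xE) -(delta_tpeq E) (delta_cat_cls) //; congr ((h _).1 + _)%N.
apply/seteqP; split=> y; first by move=> yE; apply: tpeq_trans yE (tpeq_sym xE).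
by move=> yx; apply: tpeq_trans yx xE.
Qed.

Lemma rset_conj N n b0 b1 (t : seq N) : (0 < n)%N -> rset n b0 t !=set0 -> tpeq b0 b1 ->
  rset n b1 t !=set0 /\ h (rset n b1 t) = h (rset n b0 t).
Proof.
move=> n0 X0 E; apply: (h_conj (b := b0) (b' := b1)) => //; try exact: rset_tinv.
move=> x x' E'; split=> H; first exact: tpeq_trans (tpeq_sym E') H.
exact: tpeq_trans E' H.
Qed.

Lemma flat_copy N n (c : nat -> 'I_n -> N) (b : seq N) K : elem_equiv M N ->
  exists (f : nat -> 'I_n -> M) b0, tpeq (flat f K ++ b0) (flat c K ++ b) /\ tpeq b0 b.
Proof.
move=> eN; have [b0 E0] := tpeq_copy b eN.
have [d0 _] : exists d0 : 'I_n -> M, True.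
  have [s Es] := tpeq_copy (codom (c 0)) eN.
  by have [d _] := codom_of_seq (etrans (tpeq_size Es) (size_codom_ord _)); exists d.
suff [f E] : exists f : nat -> 'I_n -> M, tpeq (flat f K ++ b0) (flat c K ++ b) by exists f, b0.
elim: K => [|K [f E]]; first by exists (fun=> d0).
have [s sz E'] := tpeq_ext (codom (c K)) eN eM (tpeq_sym E).
have [d ds] := codom_of_seq (etrans (esym sz) (size_codom_ord _)).
exists (fun i => if i == K then d else f i); rewrite !flatS eqxx -!catA ds.
suff -> : flat (fun i => if i == K then d else f i) K = flat f K by apply: tpeq_sym.
rewrite /flat; congr flatten; apply/eq_in_map => i.
by rewrite mem_rev mem_iota /= add0n => /ltn_eqF->.
Qed.

Lemma divides_drop N (A : set N) n (th : pformula N n) (a : 'I_n -> N) (b : seq N) :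
  elem_equiv M N -> (0 < n)%N -> {subset b <= A} -> psat th a -> divides A th ->
  (delta (codom a ++ b ++ codom (pparam th)) + delta b <
   delta (codom a ++ b) + delta (b ++ codom (pparam th)))%N.
Proof.
move=> eN n0 bA tha [N' [g [c [k [eg cA inc]]]]].
have eN' : elem_equiv M N' := elem_equiv_trans eN (elementary_equiv eg).
set e := codom (pparam th).
have := delta_submod (codom a) b e eN; rewrite leq_eqVlt => /orP[/eqP E|//].
exfalso; pose gb := map g b.
have gA : {subset gb <= g @` A} by apply: map_sub_image.
have tc i : tpeq (e ++ b) (codom (c i) ++ gb).
  apply: tpeq_trans (tpeq_map _ eg) _; rewrite map_cat -codom_comp.
  exact: same_type_tpeq gA (cA i).
have tb : tpeq b gb by apply: tpeq_map.
have [e0 [b1 [se0 Eeb]]] := tpeq_copy2 e b eN.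
have E1 := tpeq_catr se0 Eeb.
have sa := size_codom_ord a.
pose nu := (h (rset n (e0 ++ b1) (codom a ++ e ++ b))).2.
pose mu := (h (rset n b1 (codom a ++ b))).2.
have nu0 : (0 < nu)%R.
  apply: (dm_pos hm); apply: tinv_inDef => //; first exact: rset_tinv.
  exact: rset_nonempty.
have mu0 : (0 <= mu)%R.
  apply/ltW/(dm_pos hm); apply: tinv_inDef => //; first exact: rset_tinv.
  exact: rset_nonempty.
(* Enough copies of measure [nu] to outweigh [k] times the measure of [tp(a/b)]. *)
pose K := Num.bound (mu *+ k / nu)%R.
have hK : (mu *+ k < nu *+ K)%R.
  rewrite -[ltRHS]mulr_natr mulrC -ltr_pdivrMr //; apply: archi_boundP.
  by rewrite divr_ge0 ?mulrn_wge0 // ltW.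
(* The inconsistent conjugates live in [N']; finitely many of them are copied into [M]. *)
have [f [b0 [Ef Eb0]]] := flat_copy c gb K eN'.
have Efi i : (i < K)%N -> tpeq (codom (f i) ++ b0) (codom (c i) ++ gb).
  move=> iK; apply: (tpeq_sub Ef); first by rewrite !size_cat !size_codom_ord (tpeq_size Eb0).
  move=> x; rewrite !zip_cat ?size_flat ?size_codom_ord // !mem_cat.
  by move=> /orP[/(zip_flat iK)->|->]; rewrite ?orbT.
have Eb : tpeq b0 b by apply: tpeq_trans Eb0 (tpeq_sym tb).
have Efe i : (i < K)%N -> tpeq (codom (f i) ++ b0) (e ++ b).
  by move=> iK; apply: tpeq_trans (Efi i iK) (tpeq_sym (tc i)).
pose Y i := rset n (codom (f i) ++ b0) (codom a ++ e ++ b).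
pose Z := rset n b0 (codom a ++ b).
have hY i : (i < K)%N -> Y i !=set0 /\ h (Y i) = h (rset n (e0 ++ b1) (codom a ++ e ++ b)).
  move=> iK; apply: rset_conj => //; first exact: rset_nonempty.
  exact: tpeq_trans Eeb (tpeq_sym (Efe i iK)).
have [Z0 hZ] : Z !=set0 /\ h Z = h (rset n b1 (codom a ++ b)).
  apply: rset_conj => //; first exact: rset_nonempty.
  exact: tpeq_trans E1 (tpeq_sym Eb).
have YZ i : Y i `<=` Z.
  move=> x; rewrite /Y /Z /rset /=; apply: tpeq_catm; first by rewrite !size_codom_ord.
  by rewrite !size_codom_ord.
(* Here the absence of a drop enters: the sets [Y i] have the full dimension of [Z], so their
   measures count. *)
have dYZ i : (i < K)%N -> (h (Y i)).1 = (h Z).1.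
  move=> iK; have := rset_dim eN n0 sa (Efe i iK); have := rset_dim eN n0 sa Eb.
  have D1 : delta (e ++ b) = delta (b ++ e).
    by apply: delta_eq => // x; rewrite !mem_cat orbC.
  have D2 : delta (codom a ++ e ++ b) = delta (codom a ++ b ++ e).
    by apply: delta_eq => // x; rewrite !mem_cat [(x \in e) || _]orbC.
  by rewrite /Y /Z D1 D2; lia.
have : (nu *+ K <= mu *+ k)%R; last by rewrite leNgt hK.
have -> : (nu *+ K = \sum_(Y' <- [seq Y i | i <- iota 0 K]) dmeas (h Z).1 (Z `&` Y'))%R.
  rewrite big_map big_seq (eq_bigr (fun=> nu)); last first.
    move=> i; rewrite mem_iota /= add0n => iK; have [Y0 hYi] := hY i iK.
    by rewrite (setIidr (@YZ i)) /dmeas asboolT // (dYZ i iK) eqxx /= hYi.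
  by rewrite -big_seq big_const_seq count_predT size_iota iter_addr_0.
have -> : (mu = dmeas (h Z).1 Z)%R by rewrite /dmeas asboolT // eqxx /= hZ.
apply: (@dmeas_count _ (flat f K ++ b0)) => //.
- by apply: (@tinv_sub b0); [move=> x; rewrite mem_cat orbC => ->|apply: rset_tinv].
- move=> Y' YY; have [i [<- iK]] := iffLR (List.in_map_iff Y (iota 0 K) Y') YY; have {iK} := In_mem iK; rewrite mem_iota /= add0n => iK.
  apply: (@tinv_sub (codom (f i) ++ b0)); last exact: rset_tinv.
  by move=> x; rewrite !mem_cat => /orP[/(mem_flat (f := f) iK)->|->]; rewrite ?orbT.
(* A point in more than [k] of the sets [Y i], carried back to [N'], would satisfy [k] of the
   inconsistent instances at once. *)
move=> z _; rewrite leqNgt; apply/negP; rewrite count_map -size_filter.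
set s := seq.filter _ _ => ks.
pose s' (j : 'I_k) := nth 0 s j.
have sj (j : 'I_k) : (j < size s)%N by apply: ltn_trans ks; apply: ltn_ord.
have s'inj : injective s'.
  move=> i j /eqP; rewrite nth_uniq //; first by move=> /eqP/val_inj.
  by rewrite filter_uniq // iota_uniq.
have s'P j : (s' j < K)%N /\ Y (s' j) z.
  have := mem_nth 0 (sj j); rewrite mem_filter mem_iota /= add0n => /andP[/asboolP ? ?].
  by split.
have [t st Et] := tpeq_ext (codom z) eM eN' Ef.
have [u ut] := codom_of_seq (etrans (esym st) (size_codom_ord z)).
apply: (inc s' s'inj); exists u => j; have [jK Yj] := s'P j.
apply: psat_tpeq tha; rewrite ut.
have E2 : tpeq (codom z ++ codom (f (s' j)) ++ b0) (t ++ codom (c (s' j)) ++ gb).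
  apply: (tpeq_sub Et); first by rewrite !size_cat !size_codom_ord -st size_codom_ord (tpeq_size Eb0).
  move=> x; rewrite !zip_cat ?size_flat ?size_codom_ord -?st ?size_codom_ord // !mem_cat.
  by move=> /orP[->//|/orP[/(zip_flat jK)->|->]]; rewrite ?orbT.
have := tpeq_trans (tpeq_sym Yj) E2; rewrite !catA => H.
by apply: tpeq_catl H; rewrite !size_cat !size_codom_ord -st size_codom_ord.
Qed.

(** * Dimension drops give dividing formulas *)

(* [a] is independent from [A] over its finite subset [b]. *)
Definition base N (A : set N) (a b : seq N) := {subset b <= A} /\
  forall c : seq N, {subset c <= A} ->
  (delta (a ++ b ++ c) + delta b = delta (a ++ b) + delta (b ++ c))%N.

Lemma delta_le_cat N (a b : seq N) : elem_equiv M N -> (delta b <= delta (a ++ b))%N.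
Proof. by move=> eN; apply: delta_sub => // x; rewrite mem_cat orbC => ->. Qed.

(** Local character: choose [b] among the finite tuples from [A] so that the natural number [d(a/b)]
    is least. *)
Lemma base_exists N (A : set N) (a : seq N) : elem_equiv M N -> exists b, base A a b.
Proof.
move=> eN; pose P k := `[< exists2 b : seq N, {subset b <= A} & (delta (a ++ b) - delta b)%N = k >].
have exP : exists k, P k.
  by exists (delta (a ++ [::]) - delta (Nil N))%N; apply/asboolP; exists [::].
case: (ex_minnP exP) => k /asboolP[b bA bk] kmin.
exists b; split=> // c cA.
have : P (delta (a ++ b ++ c) - delta (b ++ c))%N.
  by apply/asboolP; exists (b ++ c) => // x; rewrite mem_cat => /orP[/bA|/cA].
move=> /kmin; have := delta_submod a b c eN.
have := delta_le_cat a b eN; have := delta_le_cat a (b ++ c) eN; lia.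
Qed.

Lemma base_cat N (A : set N) (a b c : seq N) : elem_equiv M N -> {subset c <= A} ->
  base A a b -> base A a (b ++ c).
Proof.
move=> eN cA [bA hb]; split; first by move=> x; rewrite mem_cat => /orP[/bA|/cA].
move=> d dA; have := hb c cA; have := hb (c ++ d); rewrite -!catA => H1 H2.
have {}H1 : (delta (a ++ b ++ c ++ d) + delta b = delta (a ++ b) + delta (b ++ c ++ d))%N.
  by apply: H1 => x; rewrite mem_cat => /orP[/cA|/dA].
lia.
Qed.

Lemma base_catl N (A : set N) (a b c : seq N) : elem_equiv M N -> {subset c <= A} ->
  base A a b -> base A a (c ++ b).
Proof.
move=> eN cA /(base_cat eN cA)[bcA hbc]; split.
  by move=> x; rewrite mem_cat orbC -mem_cat => /bcA.
move=> d dA; have := hbc d dA.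
have -> : delta (a ++ (b ++ c) ++ d) = delta (a ++ (c ++ b) ++ d) by delta_sets.
have -> : delta (b ++ c) = delta (c ++ b) by delta_sets.
have -> : delta (a ++ (b ++ c)) = delta (a ++ (c ++ b)) by delta_sets.
by have -> : delta ((b ++ c) ++ d) = delta ((c ++ b) ++ d) by delta_sets.
Qed.

(* A non-forking extension of [tp(a/b)] to the possibly infinite set [A]. *)
Lemma indep_realize N (A : set N) (a b : seq N) : elem_equiv M N ->
  exists N' (g : N -> N') a', [/\ elementary g, size a' = size a,
    tpeq (a' ++ map g b) (a ++ b) &
    forall c : seq N, {subset c <= A} ->
    (delta (a' ++ map g b ++ map g c) + delta b = delta (a ++ b) + delta (b ++ c))%N].
Proof.
move=> eN; set p := size a.
pose l (c : seq N) : seq ('I_p + N) :=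
  [seq inl i | i <- enum 'I_p] ++ map inr b ++ map inr c.
(* The conditions are indexed by all lists, and are void for those not contained in [A]. *)
pose Q (c : seq N) (s : seq M) := {subset c <= A} ->
  tpeq (take (p + size b) s) (a ++ b) /\
  (delta s + delta b = delta (a ++ b) + delta (b ++ c))%N.
have lE N' (v : 'I_p -> N') (g : N -> N') c :
    map (sumv v g) (l c) = codom v ++ map g b ++ map g c.
  by rewrite /l !map_cat -(map_comp _ inl) -2!(map_comp _ inr) (codomE v).
have [|N' [g [v [eg Hv]]]] := type_compactness (l := l) (Q := Q) eN.
  (* Finitely many conditions involve only the finite part [A0] of [A], over which an independent
     copy of [a] exists. *)
  move=> js; pose A0 := flatten [seq c <- js | `[< {subset c <= A} >]].
  have [a' [sa Ea da]] := delta_ext a b A0 eN.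
  have [v va] := codom_of_seq sa.
  exists v => c cjs; rewrite lE map_id va.
  have [s Es] := tpeq_copy (a' ++ b ++ c) eN; exists s; last by rewrite map_id.
  move=> cA; have sz := tpeq_size Es; rewrite !size_cat sa in sz.
  have Et : tpeq (take (p + size b) s) (a' ++ b).
    move: Es; rewrite -{1}(cat_take_drop (p + size b) s) catA; apply: tpeq_catl.
    by rewrite size_takel ?size_cat ?sa //; lia.
  split; first exact: tpeq_trans Et Ea.
  rewrite (delta_tpeq Es).
  have cA0 : {subset c <= A0}.
    by move=> x xc; apply/flattenP; exists c => //; rewrite mem_filter cjs andbT; apply/asboolP.
  have S1 := delta_submod a' b c eN.
  have S2 := delta_submod a' (b ++ c) A0 eN.
  have D1 : delta (a' ++ (b ++ c) ++ A0) = delta (a' ++ b ++ A0) by delta_sets_with cA0.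
  have D2 : delta ((b ++ c) ++ A0) = delta (b ++ A0) by delta_sets_with cA0.
  have D3 : delta (a' ++ b) = delta (a ++ b) := delta_tpeq Ea.
  lia.
exists N', g, (codom v); split=> //.
- exact: size_codom_ord.
- have [s Qs] := Hv [::]; rewrite lE cats0 => Es.
  have hn : {subset Nil N <= A} by [].
  have [Et _] := Qs hn.
  have ss : size s = (p + size b)%N by rewrite (tpeq_size Es) size_cat size_codom_ord size_map.
  by rewrite -ss take_size in Et; apply: tpeq_trans (tpeq_sym Es) Et.
- by move=> c cA; have [s /(_ cA)[_ <-] Es] := Hv c; rewrite lE in Es; rewrite (delta_tpeq Es).
Qed.

(** If there were no drop, a copy [x] of [a] over [be], independent from all parameters of the
    dividing formulas, would still have dimension [d(a/b)] over them. But [x] satisfies one of these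
    formulas, which does force a drop. *)
Lemma forks_drop N (A : set N) n (th : pformula N n) (a : 'I_n -> N) (b : seq N) :
  elem_equiv M N -> (0 < n)%N -> {subset b <= A} -> psat th a -> forks A th ->
  (delta (codom a ++ b ++ codom (pparam th)) + delta b <
   delta (codom a ++ b) + delta (b ++ codom (pparam th)))%N.
Proof.
move=> eN n0 bA tha [N' [f [k [psi [ef psiA thpsi]]]]].
have eN' : elem_equiv M N' := elem_equiv_trans eN (elementary_equiv ef).
set e := codom (pparam th).
have := delta_submod (codom a) b e eN; rewrite leq_eqVlt => /orP[/eqP E|//].
exfalso; pose es := flatten [seq codom (pparam (psi j)) | j <- enum 'I_k].
pose fb := map f b; pose fe := map f e; pose fa := map f (codom a).
have [x' [sx Ex dx]] := delta_ext fa (fb ++ fe) es eN'.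
have [x xx] := codom_of_seq (etrans sx (etrans (size_map f _) (size_codom_ord a))).
have Efx : tpeq (codom a ++ b ++ e) (codom x ++ fb ++ fe).
  apply: tpeq_trans (tpeq_map _ ef) _; rewrite !map_cat xx; exact: tpeq_sym.
have sax : size (codom a) = size (codom x) by rewrite !size_codom_ord.
have thx : psat (ppush f th) x.
  apply: psat_tpeq tha; rewrite (codom_comp f (pparam th)); apply: tpeq_catm Efx => //.
  by rewrite size_map.
have [j pj] := thpsi x thx; set ej := codom (pparam (psi j)).
have fbA : {subset fb <= f @` A} by apply: map_sub_image.
have := divides_drop eN' n0 fbA pj (psiA j); rewrite -/ej.
have ejes : {subset ej <= es}.
  by move=> y yj; apply/flattenP; exists ej => //; apply: map_f; rewrite mem_enum.
have S := delta_submod (codom x) (fb ++ ej) (fe ++ es) eN'.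
have D1 : delta (codom x ++ (fb ++ ej) ++ fe ++ es) = delta (codom x ++ (fb ++ fe) ++ es)
  by delta_sets_with ejes.
have D2 : delta ((fb ++ ej) ++ fe ++ es) = delta ((fb ++ fe) ++ es) by delta_sets_with ejes.
have D3 : delta (fa ++ fb ++ fe) = delta (codom a ++ b ++ e).
  by rewrite -!map_cat; apply/esym/delta_tpeq/tpeq_map.
have D4 : delta (fb ++ fe) = delta (b ++ e).
  by rewrite -!map_cat; apply/esym/delta_tpeq/tpeq_map.
have D5 : delta fb = delta b by apply/esym/delta_tpeq/tpeq_map.
have D6 : delta (codom x ++ fb) = delta (codom a ++ b).
  have := Efx; rewrite !catA => H; apply/esym/delta_tpeq/(tpeq_catl _ H).
  by rewrite !size_cat sax /fb size_map.
rewrite xx in D1 D6 S *; lia.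
Qed.


(** Each term copies [e] over [b] and [A0], independently from the previous terms. As [e] is
    independent from [A0] over [b], each adds exactly [d(e/b)] to the dimension over [b]. *)
Lemma indep_sequence N (A : set N) p (e : 'I_p -> N) (b A0 : seq N) : elem_equiv M N ->
  base A (codom e) b -> {subset A0 <= A} -> exists f : nat -> 'I_p -> N,
  (forall i, tpeq (codom (f i) ++ b ++ A0) (codom e ++ b ++ A0)) /\
  (forall m, delta (flat f m ++ b) = m * (delta (codom e ++ b) - delta b) + delta b)%N.
Proof.
move=> eN [bA hb] A0A.
have /choice[F HF] : forall s : seq N, exists v : 'I_p -> N,
    tpeq (codom v ++ b ++ A0) (codom e ++ b ++ A0) /\
    (delta (codom v ++ (b ++ A0) ++ s) + delta (b ++ A0) =
     delta (codom e ++ b ++ A0) + delta ((b ++ A0) ++ s))%N.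
  move=> s; have [v' [sv Ev dv]] := delta_ext (codom e) (b ++ A0) s eN.
  by have [v vv] := codom_of_seq (etrans sv (size_codom_ord e)); exists v; rewrite vv.
pose fl := fix fl m := if m is m.+1 then codom (F (fl m)) ++ fl m else [::].
pose f m := F (fl m).
have flE m : flat f m = fl m by elim: m => // m IH; rewrite flatS IH.
exists f; split; first by move=> i; have [] := HF (fl i).
elim=> // m IH; rewrite flatS; have [Ev dv] := HF (flat f m).
rewrite -[F _]/(F (flat f m)) flE in Ev dv *; rewrite -[F (fl m)]/(f m) -flE in Ev dv *.
have H := hb A0 A0A.
have S1 := delta_submod (codom (f m)) (b ++ flat f m) A0 eN.
have S2 := delta_submod (codom (f m)) b (flat f m) eN.
have D1 : delta (codom (f m) ++ b) = delta (codom e ++ b).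
  by move: Ev; rewrite !catA => Ev; apply/delta_tpeq/(tpeq_catl _ Ev); rewrite !size_cat !size_codom_ord.
have D2 : delta (codom (f m) ++ (b ++ flat f m) ++ A0) = delta (codom (f m) ++ (b ++ A0) ++ flat f m).
  by delta_sets.
have D3 : delta ((b ++ flat f m) ++ A0) = delta ((b ++ A0) ++ flat f m) by delta_sets.
have D4 : delta ((codom (f m) ++ flat f m) ++ b) = delta (codom (f m) ++ b ++ flat f m) by delta_sets.
have D5 : delta (b ++ flat f m) = delta (flat f m ++ b) by delta_sets.
have := delta_le_cat (codom e) b eN; rewrite mulSn; lia.
Qed.

(** The formula [q] isolates [tp(ae)]. Placing [b] among the entries of [e] ensures that each
    instance of [q] also fixes the type over [b]. *)
Lemma drop_divides N (A : set N) n p (a : 'I_n -> N) (e : 'I_p -> N) (b : seq N) :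
  elem_equiv M N -> {subset b <= codom e} -> base A (codom e) b ->
  (delta (codom a ++ codom e) + delta b < delta (codom a ++ b) + delta (codom e))%N ->
  exists q : formula L (n + p), sat (fcat a e) q /\ divides A (PFormula q e).
Proof.
move=> eN be bs drop.
have [q hq] := definable_types (fun s => tpeq s (codom a ++ codom e)) (n + p).
exists q; split.
  apply/hq => //; have [s Es] := tpeq_copy (codom a ++ codom e) eN.
  by exists s => //; rewrite codom_fcat.
have eb : delta (codom e ++ b) = delta (codom e) by delta_sets_with be.
pose dd := (delta (codom e) - delta b)%N.
(* The variable [(i, t)] is entry [t] of the copy [c_i]. Condition [inl (i, c)] gives [c_i] the type
   of [e] over [c], for [c] in [A]; condition [inr m] gives the first [m] copies the largest
   possible dimension over [b], which is their independence. *)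
pose l (j : (nat * seq N) + nat) : seq (nat * 'I_p + N) := match j with
  | inl (i, c) => [seq inl (i, t) | t <- enum 'I_p] ++ map inr c
  | inr m => flatten [seq [seq inl (i, t) | t <- enum 'I_p] | i <- rev (iota 0 m)] ++ map inr b
  end.
pose Q (j : (nat * seq N) + nat) (s : seq M) := match j with
  | inl (i, c) => {subset c <= A} -> tpeq s (codom e ++ c)
  | inr m => delta s = (m * dd + delta b)%N
  end.
have lE1 N' (v : nat -> 'I_p -> N') (g : N -> N') i c :
    map (sumv (fun x => v x.1 x.2) g) (l (inl (i, c))) = codom (v i) ++ map g c.
  by rewrite /l map_cat -(map_comp _ (fun t => inl (i, t))) -(map_comp _ inr) (codomE (v i)).
have lE2 N' (v : nat -> 'I_p -> N') (g : N -> N') m :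
    map (sumv (fun x => v x.1 x.2) g) (l (inr m)) = flat v m ++ map g b.
  rewrite /l map_cat -(map_comp _ inr) map_flatten -map_comp; congr (flatten _ ++ _).
  by apply: eq_map => i /=; rewrite -map_comp codomE.
have [|N' [g [v [eg Hv]]]] := type_compactness (l := l) (Q := Q) eN.
  move=> js; pose A0 := flatten [seq (if j is inl (_, c) then c else [::]) |
    j <- js & `[< if j is inl (_, c) then {subset c <= A} else True >]].
  have A0A : {subset A0 <= A}.
    move=> x /flattenP[y /mapP[j]]; rewrite mem_filter => /andP[/asboolP cA _] ->.
    by case: j cA => [[i c]|m] // cA /cA.
  have [f [f1 f2]] := indep_sequence eN bs A0A.
  exists (fun x => f x.1 x.2) => -[[i c]|m] jjs.
    rewrite lE1 map_id; have [s Es] := tpeq_copy (codom (f i) ++ c) eN.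
    exists s => // cA; apply: tpeq_trans Es _.
    have cA0 : {subset c <= A0}.
      move=> x xc; apply/flattenP; exists c => //; apply/mapP; exists (inl (i, c)) => //.
      by rewrite mem_filter jjs andbT; apply/asboolP.
    apply: (tpeq_params _ (f1 i)); last by rewrite !size_codom_ord.
    by move=> x /cA0; rewrite mem_cat orbC => ->.
  rewrite lE2 map_id; have [s Es] := tpeq_copy (flat f m ++ b) eN.
  by exists s => //; rewrite /Q (delta_tpeq Es) f2 eb.
have eN' : elem_equiv M N' := elem_equiv_trans eN (elementary_equiv eg).
pose c i : 'I_p -> N' := fun t => v (i, t).
have vE : v = (fun x => c x.1 x.2) by apply/funext => -[].
rewrite {}vE in Hv.
have Hc i d : {subset d <= A} -> tpeq (codom e ++ d) (codom (c i) ++ map g d).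
  move=> dA; have [s Qs] := Hv (inl (i, d)); rewrite lE1 => Es.
  exact: tpeq_trans (tpeq_sym (Qs dA)) Es.
have Hm m : delta (flat c m ++ map g b) = (m * dd + delta b)%N.
  by have [s Qs] := Hv (inr m); rewrite lE2 => Es; rewrite -(delta_tpeq Es).
have [bA _] := bs; set gb := map g b in Hm.
(* The bound is [d(a/b) + 1]: a common realisation [x] loses dimension once per instance, and starts
   with [d(x/b) = d(a/b)]. *)
exists N', g, c, (delta (codom a ++ b) - delta b).+1; split=> //.
  move=> i; apply: tpeq_same_type => d /subset_image[d' d'A ->].
  by rewrite codom_comp; apply: tpeq_trans (Hc i d' d'A); rewrite -map_cat; apply/tpeq_sym/tpeq_map.
move=> s sinj [x hx].
have Ex j : tpeq (codom a ++ codom e) (codom x ++ codom (c (s j))).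
  have /(hq _ _ eN')[t Qt] := hx j; rewrite codom_fcat => Et.
  exact: tpeq_trans (tpeq_sym Qt) Et.
have sax : size (codom a) = size (codom x) by rewrite !size_codom_ord.
have sec i : size (codom e) = size (codom (c i)) by rewrite !size_codom_ord.
have szb : size b = size gb by rewrite size_map.
have gbc i : {subset zip b gb <= zip (codom e) (codom (c i))}.
  by apply: tpeq_zip_sub => //; apply: Hc.
have Exb : tpeq (codom a ++ b) (codom x ++ gb).
  apply: (tpeq_sub (Ex ord0)); first by rewrite !size_cat sax szb.
  by move=> y; rewrite !zip_cat // !mem_cat => /orP[->//|/gbc ->]; rewrite orbT.
have gbcs i : {subset gb <= codom (c i)}.
  move=> y; have -> : gb = unzip2 (zip b gb) by rewrite unzip2_zip // szb.
  move=> /mapP[[u w] /(gbc i) uw /= ->].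
  have -> : codom (c i) = unzip2 (zip (codom e) (codom (c i))) by rewrite unzip2_zip // -(sec i).
  exact: (map_f snd uw).
(* Seen from the copies: [d(c_i/xb)] is at most [d(e/b)], and smaller if [x] realises the instance
   at [c_i], because by additivity the drop of [a] at [e] is one of [e] at [a]. *)
have step i : (delta (codom (c i) ++ codom x ++ gb) + (i \in codom s) <= dd + delta (codom x ++ gb))%N.
  have gbci := gbcs i.
  have dgb : delta gb = delta b by apply/esym/delta_tpeq/tpeq_map.
  have dc : delta (codom (c i)) = delta (codom e).
    by have := Hc i [::] ; rewrite !cats0 => E; apply/esym/delta_tpeq/E.
  have be' := delta_sub eN be.
  have D1 : delta (codom (c i) ++ gb) = delta (codom (c i)) by delta_sets_with gbci.
  case: (boolP (i \in codom s)) => [/codomP[j ->]|_].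
    have gbcj := gbcs (s j).
    have D2 : delta (codom (c (s j)) ++ codom x ++ gb) = delta (codom x ++ codom (c (s j))).
      by delta_sets_with gbcj.
    by rewrite D2 -(delta_tpeq (Ex j)) -(delta_tpeq Exb) /dd; lia.
  have := delta_submod (codom (c i)) gb (codom x) eN'.
  have D2 : delta (codom (c i) ++ gb ++ codom x) = delta (codom (c i) ++ codom x ++ gb) by delta_sets.
  have D3 : delta (gb ++ codom x) = delta (codom x ++ gb) by delta_sets.
  rewrite /dd; lia.
(* The deficits add up along the sequence. As the copies alone have dimension [m * dd] over [b], the
   total deficit cannot exceed [d(x/b)]. *)
have upper m : (delta (codom x ++ flat c m ++ gb) + count (mem (codom s)) (iota 0 m) <=
    m * dd + delta (codom x ++ gb))%N.
  elim: m => [|m IH]; first by rewrite /= addn0.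
  have := step m; have := delta_submod (codom (c m)) (codom x ++ gb) (flat c m) eN'.
  have D1 : delta (codom (c m) ++ (codom x ++ gb) ++ flat c m) =
    delta (codom x ++ flat c m.+1 ++ gb) by rewrite flatS; delta_sets.
  have D2 : delta ((codom x ++ gb) ++ flat c m) = delta (codom x ++ flat c m ++ gb) by delta_sets.
  have Cm : count (mem (codom s)) (iota 0 m.+1) = (count (mem (codom s)) (iota 0 m) + (m \in codom s))%N.
    by rewrite -(addn1 m) iotaD count_cat /= add0n addn0.
  rewrite D1 D2 Cm mulSn; lia.
pose m := (\max_(j < (delta (codom a ++ b) - delta b).+1) s j).+1.
have km : ((delta (codom a ++ b) - delta b).+1 <= count (mem (codom s)) (iota 0 m))%N.
  rewrite -size_filter -[leqLHS](size_codom_ord s); apply: uniq_leq_size.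
    exact/injectiveP.
  move=> y ys; rewrite mem_filter; apply/andP; split=> //; rewrite mem_iota /= add0n ltnS.
  by case/codomP: ys => j ->; apply: (leq_bigmax j).
have := upper m; have := delta_le_cat (codom x) (flat c m ++ gb) eN'; rewrite Hm.
rewrite -(delta_tpeq Exb); lia.
Qed.

(** * Comparison with SU-rank *)

(** Transitivity: if [a] is independent from [A] over [b], and [c] from [A] over [ab], then [a] is
    independent from [A] and [c] together over [bc]. *)
Lemma base_add N (A : set N) (a b c : seq N) (B : set N) : elem_equiv M N ->
  base A a b -> B = A `|` [set` c] ->
  (forall d : seq N, {subset d <= A} ->
    delta (c ++ a ++ b ++ d) + delta (a ++ b) = delta (c ++ a ++ b) + delta (a ++ b ++ d))%N ->
  base B a (b ++ c).
Proof.
move=> eN [bA hb] -> hc; split.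
  move=> x; rewrite mem_cat => /orP[/bA/set_mem Ax|xc]; apply/mem_set; [by left|by right].
move=> d dB; have [w wA dw] : exists2 w : seq N, {subset w <= A} & {subset d <= w ++ c}.
  exists [seq x <- d | `[< A x >]].
    by move=> x; rewrite mem_filter => /andP[/asboolP Ax _]; apply/mem_set.
  move=> x xd; rewrite mem_cat mem_filter xd andbT.
  by have /set_mem[Ax|/= ->] := dB x xd; rewrite ?orbT // asboolT.
have H1 := hc w wA; have H2 := hb w wA.
have S1 := delta_submod c b w eN.
have S2 := delta_submod a ((b ++ c) ++ d) w eN.
have S3 := delta_submod a (b ++ c) d eN.
have D1 : delta (a ++ ((b ++ c) ++ d) ++ w) = delta (c ++ a ++ b ++ w) by delta_sets_with dw.
have D2 : delta (((b ++ c) ++ d) ++ w) = delta (c ++ b ++ w) by delta_sets_with dw.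
have D3 : delta (c ++ a ++ b) = delta (a ++ b ++ c) by delta_sets.
have D4 : delta (c ++ b) = delta (b ++ c) by delta_sets.
lia.
Qed.

(** For dividing over all of [A], the parameters must be independent from [A] over a finite tuple.
    So [b] is enlarged within [A], which leaves [d(a/b)] unchanged since [b] is a base for [a]. *)
Lemma drop_type_forks N (A B : set N) n (a : 'I_n -> N) (b c : seq N) : elem_equiv M N ->
  base A (codom a) b -> {subset b ++ c <= B} -> A `<=` B ->
  (delta (codom a ++ b ++ c) + delta b < delta (codom a ++ b) + delta (b ++ c))%N ->
  type_forks A B a.
Proof.
move=> eN [bA hb] bcB AB drop.
have [b1 hb1] := base_exists A (c ++ b) eN.
have [] := base_catl eN bA hb1; set bb := b ++ b1 => bbA hbb.
have [e Ee] := codom_of_seq (erefl (size (c ++ bb))).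
have [b1A _] := hb1; have H1 := hb b1 b1A.
have be : {subset bb <= codom e} by move=> x xb; rewrite Ee mem_cat xb orbT.
have bs : base A (codom e) bb.
  split=> // d dA; have := hbb d dA; rewrite Ee.
  have -> : delta ((c ++ b) ++ bb ++ d) = delta ((c ++ bb) ++ bb ++ d) by rewrite /bb; delta_sets.
  by have -> : delta ((c ++ b) ++ bb) = delta ((c ++ bb) ++ bb) by rewrite /bb; delta_sets.
have [|q [qe dq]] := drop_divides (a := a) (e := e) eN be bs.
  have S := delta_submod (codom a) (b ++ c) b1 eN.
  rewrite Ee.
  have D1 : delta (codom a ++ (b ++ c) ++ b1) = delta (codom a ++ c ++ bb) by rewrite /bb; delta_sets.
  have D2 : delta ((b ++ c) ++ b1) = delta (c ++ bb) by rewrite /bb; delta_sets.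
  rewrite -/bb in H1; lia.
exists (PFormula q e); split=> //.
  move=> i; apply/set_mem; have : e i \in codom e by apply: codom_f.
  rewrite Ee mem_cat => /orP[ec|/bbA/set_mem Ae]; last by apply/mem_set/AB.
  by apply: bcB; rewrite mem_cat ec orbT.
exists N, id, 1, (fun=> PFormula q e); split; first exact: elementary_id.
- by move=> _; rewrite image_id.
- by move=> x xq; exists ord0.
Qed.

(** A forking extension gives a drop over a base of the larger set. Conversely a drop at [c] is
    realised at a copy [c'] independent from [A] over [ab]; then [bc'] is a base over [A] with [c']
    added, and the induction applies. *)
Lemma SU_geP N (A : set N) n (a : 'I_n -> N) (b : seq N) k : elem_equiv M N -> (0 < n)%N ->
  base A (codom a) b -> SU_ge k A a <-> Uge k (codom a) b.
Proof.
move=> eN n0; elim: k N A a b eN => [//|k IH] N A a b eN bs; split.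
  move=> [N' [f [B [ef fAB [th [thB tha fth]] SB]]]].
  have eN' : elem_equiv M N' := elem_equiv_trans eN (elementary_equiv ef).
  have [b' bs'] := base_exists B (codom (f \o a)) eN'.
  set e := codom (pparam th); set fb := map f b.
  have [bA _] := bs.
  have fbA : {subset fb <= f @` A} by apply: map_sub_image.
  have cB : {subset fb ++ e <= B}.
    move=> x; rewrite mem_cat => /orP[/fbA/set_mem/fAB Bx|/codomP[i ->]]; exact/mem_set.
  have /(IH _ _ _ _ eN' (base_catl eN' cB bs')) Uk := SB.
  have drop := forks_drop eN' n0 fbA tha fth.
  have S := delta_submod (codom (f \o a)) (fb ++ e) b' eN'.
  have : Uge k.+1 (codom (f \o a)) fb.
    exists (e ++ b'); split; last by rewrite catA.
    have D1 : delta (codom (f \o a) ++ fb ++ e ++ b') = delta (codom (f \o a) ++ (fb ++ e) ++ b').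
      by rewrite !catA.
    have D2 : delta (fb ++ e ++ b') = delta ((fb ++ e) ++ b') by rewrite !catA.
    rewrite -/e in drop; lia.
  apply: Uge_tpeq => //; first by rewrite !size_codom_ord.
  by rewrite codom_comp -map_cat; apply/tpeq_sym/tpeq_map.
move=> [c [drop Uc]].
have [N' [g [c' [eg sc Ec hc]]]] := indep_realize A c (codom a ++ b) eN.
have eN' : elem_equiv M N' := elem_equiv_trans eN (elementary_equiv eg).
pose gb := map g b; pose ga := codom (g \o a).
have gaE : ga = map g (codom a) by rewrite /ga codom_comp.
have Ec' : tpeq (codom a ++ b ++ c) (ga ++ gb ++ c').
  by rewrite !catA gaE -map_cat; apply/tpeq_sym/tpeq_catC.
have sa : size (codom a) = size ga by rewrite gaE size_map.
have E1 : delta (ga ++ gb ++ c') = delta (codom a ++ b ++ c) by apply/esym/delta_tpeq.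
have E2 : delta (gb ++ c') = delta (b ++ c) by apply/esym/delta_tpeq/(tpeq_catr sa Ec').
have E3 : delta gb = delta b by apply/esym/delta_tpeq/tpeq_map.
have E4 : delta (ga ++ gb) = delta (codom a ++ b).
  by rewrite gaE -map_cat; apply/esym/delta_tpeq/tpeq_map.
have gbs : base (g @` A) ga gb.
  have [bA hb] := bs; split; first exact: map_sub_image.
  move=> _ /subset_image[d dA ->].
  have F1 : delta (ga ++ gb ++ map g d) = delta (codom a ++ b ++ d).
    by rewrite gaE -!map_cat; apply/esym/delta_tpeq/tpeq_map.
  have F2 : delta (gb ++ map g d) = delta (b ++ d).
    by rewrite -!map_cat; apply/esym/delta_tpeq/tpeq_map.
  have := hb d dA; lia.
pose B := g @` A `|` [set` c'].
exists N', g, B; split=> //.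
- by move=> x Ax; left.
- apply: (drop_type_forks eN' gbs (c := c')).
  + move=> x; rewrite mem_cat => /orP[xb|xc]; apply/mem_set; last by right.
    by left; apply/set_mem; case: gbs => + _; apply.
  + by move=> x Ax; left.
  + by rewrite -/ga; lia.
- apply/(IH _ _ _ (gb ++ c') eN'); last first.
    apply: (Uge_tpeq eN eN' _ _ Uc); first by rewrite !size_codom_ord.
    exact: Ec'.
  apply: (base_add eN' gbs) => // _ /subset_image[d dA ->].
  have F1 : delta (ga ++ gb ++ map g d) = delta ((codom a ++ b) ++ d).
    by rewrite gaE -!map_cat catA; apply/esym/delta_tpeq/tpeq_map.
  have F2 : delta (c' ++ ga ++ gb ++ map g d) = delta (c' ++ map g (codom a ++ b) ++ map g d).
    by rewrite gaE map_cat -!catA.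
  have F3 : delta (c' ++ ga ++ gb) = delta (c ++ codom a ++ b).
    by rewrite gaE -map_cat; apply: delta_tpeq.
  rewrite F1 F2 F3 E4; exact: hc.
Qed.

Lemma SU_eqP N (A : set N) n (a : 'I_n -> N) (b : seq N) : elem_equiv M N -> (0 < n)%N ->
  base A (codom a) b -> SU_eq A a (U (codom a) b).
Proof.
move=> eN n0 bs; split; first by apply/(SU_geP _ eN n0 bs)/(UgeP).
by move=> /(SU_geP _ eN n0 bs)/(UgeP _ _ _ eN); rewrite ltnn.
Qed.

(** Enlarging the parameters from those of [th] to [A] cannot raise the rank, and an independent
    extension keeps it. So the maximum over types over [A] is already attained by types over the
    parameters of [th], which are realised in [M]. *)
Lemma SU_max_types n (A : set M) (th : pformula M n) r : (0 < n)%N -> pover A th ->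
  (exists2 x, psat th x & U (codom x) (codom (pparam th)) = r) ->
  (forall x, psat th x -> (U (codom x) (codom (pparam th)) <= r)%N) -> SU_max A th r.
Proof.
set e := codom (pparam th) => n0 thA [x thx xr] hr; split.
  have [N [f [a' [ef sa Ea ha]]]] := indep_realize A (codom x) e eM.
  have eN : elem_equiv M N := elementary_equiv ef.
  have [a aE] := codom_of_seq (etrans sa (size_codom_ord x)).
  rewrite -{}aE in Ea ha sa.
  exists N, f, a; split=> //.
    by apply: psat_tpeq thx; rewrite (codom_comp f (pparam th)); apply: tpeq_sym.
  have bs : base (f @` A) (codom a) (map f e).
    split; first by apply: map_sub_image => y /codomP[i ->]; apply/mem_set/thA.
    move=> _ /subset_image[d dA ->]; have := ha d dA.
    have -> : delta (codom a ++ map f e) = delta (codom x ++ e) by apply: delta_tpeq.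
    have -> : delta (map f e) = delta e by apply/esym/delta_tpeq/tpeq_map.
    by rewrite -!map_cat -(delta_tpeq (tpeq_map (e ++ d) ef)).
  have := SU_eqP eN n0 bs; congr (SU_eq _ _ _).
  by rewrite -xr; apply: U_tpeq.
move=> N f a ef tha; have eN : elem_equiv M N := elementary_equiv ef.
have [b bs] := base_exists (f @` A) (codom a) eN.
have eA : {subset map f e <= f @` A}.
  by apply: map_sub_image => y /codomP[i ->]; apply/mem_set/thA.
exists (U (codom a) (map f e ++ b)); last first.
  by apply: SU_eqP => //; apply: base_catl.
apply: leq_trans (U_sub (b := map f e) (codom a) eN _) _.
  by move=> y; rewrite mem_cat => ->.
have [s sz E] := tpeq_ext (codom a) eN eM (tpeq_sym (tpeq_map e ef)).
have [y ys] := codom_of_seq (etrans (esym sz) (size_codom_ord a)); rewrite -{}ys in E sz.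
rewrite (U_tpeq eN eM sz E); apply: hr.
by apply: (psat_tpeq (th := ppush f th)) tha; rewrite (codom_comp f (pparam th)).
Qed.

(** * The measure on sets of maximal rank *)

Definition tpdim b n (x : 'I_n -> M) : nat := (h (cls b x)).1.

Lemma tpdimE b n (x : 'I_n -> M) : (0 < n)%N -> delta (codom x ++ b) = (tpdim b x + delta b)%N.
Proof. exact: delta_cat_cls. Qed.

Lemma tpdim_tpeq b b' n (x x' : 'I_n -> M) : (0 < n)%N ->
  tpeq (codom x ++ b) (codom x' ++ b') -> tpdim b x = tpdim b' x'.
Proof.
move=> n0 E; have := delta_tpeq E; have Eb := delta_tpeq (tpeq_catr _ E).
by rewrite !tpdimE // Eb ?size_codom_ord //; lia.
Qed.

Lemma tpdim_le b n (X : set ('I_n -> M)) x : (0 < n)%N -> tinv b X -> X x ->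
  (tpdim b x <= (h X).1)%N.
Proof.
move=> n0 iX Xx; apply: (dim_mono); first exact: cls_inDef.
  by apply: (tinv_inDef n0 iX); exists x.
by move=> y yx; apply: iX Xx; apply: tpeq_sym.
Qed.

Lemma U_le_tpdim b n (x : 'I_n -> M) : (0 < n)%N -> (U (codom x) b <= tpdim b x)%N.
Proof.
move=> n0; have := Uge_delta (k := U (codom x) b) (a := codom x) (b := b) eM.
rewrite tpdimE // leq_add2r; apply; exact/(UgeP).
Qed.

Definition is_rank b n (X : set ('I_n -> M)) k :=
  (exists2 x, X x & U (codom x) b = k) /\ forall x, X x -> (U (codom x) b <= k)%N.

Definition rank b n (X : set ('I_n -> M)) : nat := xget 0 [set k | is_rank b X k].

Lemma is_rank_uniq b n (X : set ('I_n -> M)) k j : is_rank b X k -> is_rank b X j -> k = j.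
Proof.
move=> [[x Xx <-] hk] [[y Xy <-] hj]; apply/eqP; rewrite eqn_leq.
by rewrite hk // hj.
Qed.

Lemma rankP b n (X : set ('I_n -> M)) : (0 < n)%N -> tinv b X -> X !=set0 -> is_rank b X (rank b X).
Proof.
move=> n0 iX [x Xx]; apply: (xgetPex 0).
pose P k := `[< exists2 x, X x & U (codom x) b = k >].
have exP : exists k, P k by exists (U (codom x) b); apply/asboolP; exists x.
have [|k /asboolP Pk kmax] := ex_maxnP (m := (h X).1) exP.
  move=> _ /asboolP[y Xy <-]; exact: leq_trans (U_le_tpdim b y n0) (tpdim_le n0 iX Xy).
by exists k; split=> // y Xy; apply: kmax; apply/asboolP; exists y.
Qed.

Lemma rankE b n (X : set ('I_n -> M)) k : is_rank b X k -> rank b X = k.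
Proof. by move=> hk; apply: (is_rank_uniq _ hk); apply: (xgetPex 0); exists k. Qed.

Definition top_part b n (X : set ('I_n -> M)) (k : nat) : set ('I_n -> M) :=
  [set x | [/\ X x, U (codom x) b = rank b X & tpdim b x = k]].

(* [X] is assumed to be invariant over [b]; [top_part b X k] is empty for
   [k > (h X).1]. *)
Definition SU_meas b n (X : set ('I_n -> M)) : R :=
  (\sum_(0 <= k < (h X).1.+1) dmeas k (top_part b X k))%R.

Lemma top_part_tinv b n (X : set ('I_n -> M)) k : (0 < n)%N -> tinv b X -> tinv b (top_part b X k).
Proof.
move=> n0 iX x y E [Xx Ux dx]; split; first exact: iX E Xx.
  rewrite -Ux; apply: U_tpeq => //; last exact: tpeq_sym.
  by rewrite !size_codom_ord.
by rewrite -dx; apply: tpdim_tpeq => //; apply: tpeq_sym.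
Qed.

Lemma homogeneous_dim b n (X : set ('I_n -> M)) k : (0 < n)%N -> tinv b X -> X !=set0 ->
  (forall x, X x -> tpdim b x = k) -> (h X).1 = k.
Proof.
by move=> n0 iX X0 hX; have [x Xx <-] := types_max n0 iX X0; apply: hX.
Qed.

Lemma top_part_dim b n (X : set ('I_n -> M)) k : (0 < n)%N -> tinv b X -> top_part b X k !=set0 ->
  (h (top_part b X k)).1 = k.
Proof.
by move=> n0 iX X0; apply: (@homogeneous_dim b) => //; [apply: top_part_tinv|move=> x []].
Qed.

Lemma top_part_ledim b n (X : set ('I_n -> M)) k : (0 < n)%N -> tinv b X -> ledim k (top_part b X k).
Proof. by move=> n0 iX X0; rewrite top_part_dim. Qed.

Lemma top_part0 b n (X : set ('I_n -> M)) k : (0 < n)%N -> tinv b X -> ((h X).1 < k)%N ->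
  top_part b X k = set0.
Proof.
move=> n0 iX hk; apply/seteqP; split=> // x [Xx _ dx].
by have := tpdim_le n0 iX Xx; rewrite dx leqNgt hk.
Qed.

Lemma SU_meas_bound b n (X : set ('I_n -> M)) K : (0 < n)%N -> tinv b X -> ((h X).1 < K)%N ->
  SU_meas b X = (\sum_(0 <= k < K) dmeas k (top_part b X k))%R.
Proof.
move=> n0 iX hK; rewrite (big_cat_nat _ (n := (h X).1.+1)) //= [X in _ = (_ + X)%R]big1_seq ?addr0 // => k.
by rewrite mem_index_iota => /andP[_ /andP[hk _]]; rewrite top_part0 ?dmeas0.
Qed.

Lemma SU_meas_pos b n (X : set ('I_n -> M)) : (0 < n)%N -> tinv b X -> X !=set0 -> (0 < SU_meas b X)%R.
Proof.
move=> n0 iX X0; have [[x Xx Ux] _] := rankP n0 iX X0.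
have tx : top_part b X (tpdim b x) x by split.
have k0 k : (0 <= dmeas k (top_part b X k))%R.
  exact: (dmeas_ge0 _ n0 (top_part_tinv n0 iX)).
have lk : (tpdim b x < (h X).1.+1)%N by rewrite ltnS; apply: tpdim_le.
rewrite /SU_meas big_mkord (bigD1 (Ordinal lk)) //=; apply: ltr_wpDr.
  by apply: sumr_ge0 => k _.
have T0 : top_part b X (tpdim b x) !=set0 by exists x.
rewrite /dmeas asboolT // top_part_dim // eqxx /=; apply: (dm_pos hm).
by apply: (tinv_inDef n0 _ T0); apply: top_part_tinv.
Qed.

(** A point of maximal rank over [b] has a conjugate over [b] that is independent from [c], and this
    one keeps its rank. *)
Lemma rank_refine b c n (X : set ('I_n -> M)) : (0 < n)%N -> tinv b X -> X !=set0 ->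
  {subset b <= c} -> rank c X = rank b X.
Proof.
move=> n0 iX X0 bc; have [[x Xx Ux] hU] := rankP n0 iX X0; apply: rankE; split.
  have [x' [sx Ex dx]] := delta_ext (codom x) b c eM.
  have [y yx] := codom_of_seq (etrans sx (size_codom_ord x)); rewrite -{}yx in sx Ex dx.
  exists y; first by apply: iX Xx; apply: tpeq_sym.
  rewrite -Ux -(U_tpeq eM eM sx Ex) -(U_indep (a := codom y) (b := b) (c := c)) //.
    apply: U_eq => // z; rewrite mem_cat orb_idl //; exact: bc.
  by rewrite -(delta_tpeq Ex) in dx.
by move=> y Xy; apply: leq_trans (hU y Xy); apply: U_sub.
Qed.

(** A point of maximal rank over [c] cannot drop from [b] to [c], as a drop would lower the rank; so
    it has the same dimension over both. Conversely a point of the top part over [b] that does not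
    drop keeps its rank. *)
Lemma SU_meas_refine b c n (X : set ('I_n -> M)) : (0 < n)%N -> tinv b X -> X !=set0 ->
  {subset b <= c} -> SU_meas c X = SU_meas b X.
Proof.
move=> n0 iX X0 bc; apply: eq_bigr => k _.
have iXc := tinv_sub bc iX.
have iT : tinv c (top_part b X k) by apply: tinv_sub bc _; apply: top_part_tinv.
have iT' : tinv c (top_part c X k) by apply: top_part_tinv.
rewrite [RHS](dmeas_split n0 iT iT'); last exact: top_part_ledim.
have bcE (x : 'I_n -> M) : delta (codom x ++ b ++ c) = (tpdim c x + delta c)%N.
  rewrite -tpdimE //; apply: delta_eq => // z; rewrite !mem_cat.
  by have := bc z; case: (z \in b) => // /(_ isT) ->; rewrite !orbT.
have bcE' : delta (b ++ c) = delta c.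
  by apply: delta_eq => // z; rewrite mem_cat orb_idl //; apply: bc.
have sub : top_part c X k `<=` top_part b X k.
  move=> x [Xx Ux dx].
  have [_ hU] := rankP n0 iX X0; have hUx := hU x Xx.
  rewrite (rank_refine n0 iX X0 bc) in Ux.
  have UE : U (codom x) (b ++ c) = U (codom x) c.
    by apply: U_eq => // z; rewrite mem_cat orb_idl //; apply: bc.
  have hs := U_sub (codom x) eM bc.
  split=> //; first by lia.
  have S := delta_submod (codom x) b c eM.
  have : ~ (delta (codom x ++ b ++ c) + delta b < delta (codom x ++ b) + delta (b ++ c))%N.
    by move=> /(U_drop eM); lia.
  by move: S; rewrite bcE bcE' tpdimE // dx; lia.
rewrite (setIidr sub).
suff -> : dmeas k (top_part b X k `\` top_part c X k) = 0%R by rewrite addr0.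
rewrite /dmeas; case: asboolP => //= D0.
(* If the difference had dimension [k], it would contain a point of dimension [k] over [c], which
   does not drop and so belongs to the top part over [c]. *)
have [x [[Xx Ux dx] nT] dE] := types_max n0 (tinv_setD iT iT') D0.
case: eqP => // Ek; exfalso; apply: nT; rewrite Ek in dE.
split=> //; rewrite -(rank_refine n0 iX X0 bc) in Ux; rewrite -Ux.
have UE : U (codom x) (b ++ c) = U (codom x) c.
  by apply: U_eq => // z; rewrite mem_cat orb_idl //; apply: bc.
rewrite -UE; apply: U_indep => //.
by rewrite bcE bcE' tpdimE // dx /tpdim dE; lia.
Qed.

Definition SU_dm : dim_meas_fun R M := fun n X =>
  if pselect (exists b, tinv b X) is left e
  then (rank (projT1 (cid e)) X, SU_meas (projT1 (cid e)) X) else (0, 0%R).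

(** The tuple picked by choice in [SU_dm] is compared with [b] through their concatenation. *)
Lemma SU_dmE b n (X : set ('I_n -> M)) : (0 < n)%N -> tinv b X -> X !=set0 ->
  SU_dm X = (rank b X, SU_meas b X).
Proof.
move=> n0 iX X0; rewrite /SU_dm; case: pselect => [e|[]]; last by exists b.
case: (cid e) => c iXc /=.
have bb : {subset b <= b ++ c} by move=> x; rewrite mem_cat => ->.
have cb : {subset c <= b ++ c} by move=> x; rewrite mem_cat orbC => ->.
rewrite -(rank_refine n0 iX X0 bb) -(rank_refine n0 iXc X0 cb).
by rewrite -(SU_meas_refine n0 iX X0 bb) -(SU_meas_refine n0 iXc X0 cb).
Qed.

(** * The axioms of a dimension-measure *)

Definition conj_sets b b' n (X X' : set ('I_n -> M)) := forall x x' : 'I_n -> M,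
  tpeq (codom x ++ b) (codom x' ++ b') -> X x <-> X' x'.

Lemma conj_sets_sym b b' n (X X' : set ('I_n -> M)) : conj_sets b b' X X' -> conj_sets b' b X' X.
Proof. by move=> H x x' /tpeq_sym E; apply: iff_sym; apply: H. Qed.

Lemma conj_ext b b' n (x : 'I_n -> M) : tpeq b b' ->
  exists x' : 'I_n -> M, tpeq (codom x ++ b) (codom x' ++ b').
Proof.
move=> E; have [s sz E'] := tpeq_ext (codom x) eM eM E.
by have [y yx] := codom_of_seq (etrans (esym sz) (size_codom_ord x)); exists y; rewrite yx.
Qed.

Lemma is_rank_conj b b' n (X X' : set ('I_n -> M)) k : tpeq b b' -> conj_sets b b' X X' ->
  is_rank b X k -> is_rank b' X' k.
Proof.
have UE (x x' : 'I_n -> M) : tpeq (codom x ++ b) (codom x' ++ b') -> U (codom x) b = U (codom x') b'.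
  exact: (U_tpeq eM eM (size_codom_eq x x')).
move=> E H [[x Xx Ux] hk]; split.
  have [x' Ex] := conj_ext x E; exists x'; first exact/(H _ _ Ex).
  by rewrite -(UE _ _ Ex).
move=> x' X'x'; have [y /tpeq_sym Ey] := conj_ext x' (tpeq_sym E).
by rewrite -(UE _ _ Ey); apply/hk/(H _ _ Ey).
Qed.

Lemma rank_conj b b' n (X X' : set ('I_n -> M)) : (0 < n)%N -> X !=set0 -> tinv b X ->
  tpeq b b' -> conj_sets b b' X X' -> rank b' X' = rank b X.
Proof.
by move=> n0 X0 iX E H; apply/rankE/(is_rank_conj E H)/(rankP).
Qed.

Lemma top_part_conj b b' n (X X' : set ('I_n -> M)) k : (0 < n)%N -> X !=set0 -> tinv b X ->
  tpeq b b' -> conj_sets b b' X X' -> conj_sets b b' (top_part b X k) (top_part b' X' k).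
Proof.
move=> n0 X0 iX E H x x' Ex.
have UE : U (codom x) b = U (codom x') b'.
  by apply: U_tpeq => //; rewrite !size_codom_ord.
rewrite /top_part /= -(rank_conj n0 X0 iX E H) UE (tpdim_tpeq n0 Ex).
by split=> -[Xx Ux dx]; split=> //; apply/(H _ _ Ex).
Qed.

Lemma conj_nonempty b b' n (X X' : set ('I_n -> M)) : tpeq b b' -> conj_sets b b' X X' ->
  X !=set0 -> X' !=set0.
Proof. by move=> E H [x Xx]; have [x' Ex] := conj_ext x E; exists x'; apply/(H _ _ Ex). Qed.

Lemma dmeas_conj k b b' n (X X' : set ('I_n -> M)) : (0 < n)%N -> tinv b X -> tinv b' X' ->
  tpeq b b' -> conj_sets b b' X X' -> dmeas k X' = dmeas k X.
Proof.
move=> n0 iX iX' E H; have [X0|X0] := pselect (X !=set0).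
  have [X'0 hE] := h_conj n0 X0 iX iX' E H.
  by rewrite /dmeas !asboolT // hE.
have X'0 : ~ (X' !=set0) by move=> X'0; apply/X0/(conj_nonempty (tpeq_sym E) (conj_sets_sym H)).
by rewrite /dmeas !asboolF.
Qed.

Lemma SU_dm_conj b b' n (X X' : set ('I_n -> M)) : (0 < n)%N -> X !=set0 -> tinv b X ->
  tinv b' X' -> tpeq b b' -> conj_sets b b' X X' -> SU_dm X' = SU_dm X.
Proof.
move=> n0 X0 iX iX' E H; have [X'0 hE] := h_conj n0 X0 iX iX' E H.
rewrite (SU_dmE n0 iX X0) (SU_dmE n0 iX' X'0) (rank_conj n0 X0 iX E H).
congr pair; rewrite /SU_meas hE; apply: eq_bigr => k _.
exact: (dmeas_conj k n0 (top_part_tinv n0 iX) (top_part_tinv n0 iX') E (top_part_conj k n0 X0 iX E H)).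
Qed.

Lemma fibre_tinv n m (phi : formula L (n + m)) (b : 'I_m -> M) : tinv (codom b) (fibre phi b).
Proof. by move=> x y; apply: (psat_tinv (th := PFormula phi b)). Qed.

Lemma fibre_conj n m (phi : formula L (n + m)) (b b' : 'I_m -> M) :
  conj_sets (codom b) (codom b') (fibre phi b) (fibre phi b').
Proof. by move=> x x'; rewrite -!codom_fcat /fibre /= => /tpeq_codom. Qed.

(** With constant rank and constant dimension only the last term of the sum is nonzero, and it is
    the old measure. Types and points are of this kind. *)
Lemma SU_dm_homogeneous b n (X : set ('I_n -> M)) r k : (0 < n)%N -> tinv b X -> X !=set0 ->
  (forall x, X x -> U (codom x) b = r /\ tpdim b x = k) -> SU_dm X = (r, (h X).2).
Proof.
move=> n0 iX X0 H; rewrite (SU_dmE n0 iX X0).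
have rE : rank b X = r.
  by apply: rankE; split=> [|x /H[-> _]//]; have [x Xx] := X0; exists x => //; case: (H x Xx).
have hE : (h X).1 = k by apply: (homogeneous_dim n0 iX X0) => x /H[].
rewrite rE; congr pair; rewrite /SU_meas big_nat_recr //= big1_seq ?add0r.
  have -> : top_part b X (h X).1 = X.
    apply/seteqP; split=> [x []//|x Xx]; have [Ux dx] := H x Xx.
    by split=> //; rewrite ?rE ?hE.
  by rewrite /dmeas asboolT // eqxx.
move=> j; rewrite mem_index_iota => /andP[_ /andP[_ jk]].
have -> : top_part b X j = set0; last by rewrite dmeas0.
apply/seteqP; split=> // x [Xx _ dx]; have [_ dx'] := H x Xx.
by move: jk; rewrite hE -dx' dx ltnn.
Qed.

Lemma SU_dm_cls b n (x : 'I_n -> M) : (0 < n)%N -> SU_dm (cls b x) = (U (codom x) b, (h (cls b x)).2).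
Proof.
move=> n0; apply: (@SU_dm_homogeneous b _ _ _ (tpdim b x)) => //.
- exact: tinv_cls.
- by exists x; apply: cls_refl.
- move=> y yx; split; last exact: tpdim_tpeq.
  by apply: U_tpeq => //; rewrite !size_codom_ord.
Qed.

Lemma SU_dm_point n (a : 'I_n -> M) : (0 < n)%N -> SU_dm [set a] = (0, 1%R).
Proof.
move=> n0; have iA : tinv (codom a) [set a].
  move=> x y E xa; rewrite xa in E; apply: codom_inj.
  apply: (@tpeq_dcl _ _ _ (codom a) (codom a) (codom a)) => //; last exact: tpeq_refl.
  exact: tpeq_catC (size_codom_eq _ _) E.
have d0 : tpdim (codom a) a = 0.
  have := tpdimE (codom a) a n0.
  rewrite (delta_eq (t := codom a)) //; first by lia.
  by move=> x; rewrite mem_cat orbb.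
rewrite (@SU_dm_homogeneous (codom a) _ _ 0 0) ?dm_point //; first by exists a.
move=> x ->; split=> //; apply/eqP; rewrite -leqn0 -d0; exact: U_le_tpdim.
Qed.

Lemma common_params n (X Y : set ('I_n -> M)) : inDef X -> inDef Y ->
  exists b, tinv b X /\ tinv b Y.
Proof.
move=> [_ _ /definable_tinv[b iX]] [_ _ /definable_tinv[c iY]]; exists (b ++ c).
by split; [apply: tinv_sub iX|apply: tinv_sub iY] => x; rewrite mem_cat => ->; rewrite ?orbT.
Qed.

Lemma is_rankU b n (X Y : set ('I_n -> M)) j k : is_rank b X j -> is_rank b Y k ->
  is_rank b (X `|` Y) (maxn j k).
Proof.
move=> [[x Xx Ux] hX] [[y Yy Uy] hY]; split.
  by case: (leqP j k) => jk; [exists y|exists x] => //; [right|left].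
by move=> z [/hX|/hY] hz; rewrite leq_max hz ?orbT.
Qed.

Lemma top_partU b n (X Y : set ('I_n -> M)) k : (0 < n)%N -> tinv b X -> tinv b Y ->
  X !=set0 -> Y !=set0 ->
  top_part b (X `|` Y) k = (if (rank b Y <= rank b X)%N then top_part b X k else set0) `|`
    (if (rank b X <= rank b Y)%N then top_part b Y k else set0).
Proof.
move=> n0 iX iY X0 Y0; have hX := rankP n0 iX X0; have hY := rankP n0 iY Y0.
have [_ hX'] := hX; have [_ hY'] := hY.
apply/seteqP; rewrite /top_part (rankE (is_rankU hX hY)); split=> x.
  move=> [[Xx|Yx] Ux dx].
    left; have := hX' x Xx; rewrite Ux geq_max => /andP[_ h2].
    by rewrite h2; split=> //; rewrite Ux; apply/maxn_idPl.
  right; have := hY' x Yx; rewrite Ux geq_max => /andP[h2 _].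
  by rewrite h2; split=> //; rewrite Ux; apply/maxn_idPr.
case; case: ifP => // hl [Xx Ux dx]; split=> //; try by [left|right].
  by rewrite Ux; apply/esym/maxn_idPl.
by rewrite Ux; apply/esym/maxn_idPr.
Qed.

Lemma SU_dm_dimU n (X Y : set ('I_n -> M)) : inDef X -> inDef Y ->
  (SU_dm (X `|` Y)).1 = maxn (SU_dm X).1 (SU_dm Y).1.
Proof.
move=> dX dY; have [b [iX iY]] := common_params dX dY.
have [n0 X0 _] := dX; have [_ Y0 _] := dY.
have XY0 : X `|` Y !=set0 by case: X0 => x Xx; exists x; left.
rewrite (SU_dmE n0 iX X0) (SU_dmE n0 iY Y0).
rewrite (SU_dmE n0 (tinv_setU iX iY) XY0) /=.
by apply/rankE/is_rankU; apply: rankP.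
Qed.

(** A set of smaller rank contributes nothing, whatever its [h]-dimension; for equal ranks the top
    parts are added dimension by dimension. *)
Lemma SU_meas_union b n (X Y : set ('I_n -> M)) : (0 < n)%N -> tinv b X -> tinv b Y ->
  X !=set0 -> Y !=set0 -> X `&` Y = set0 ->
  SU_meas b (X `|` Y) = ((if (rank b Y <= rank b X)%N then SU_meas b X else 0) +
    (if (rank b X <= rank b Y)%N then SU_meas b Y else 0))%R.
Proof.
move=> n0 iX iY X0 Y0 XY.
have iXY := tinv_setU iX iY.
pose K := (maxn (h (X `|` Y)).1 (maxn (h X).1 (h Y).1)).+1.
rewrite (SU_meas_bound (K := K) n0 iX) ?(SU_meas_bound (K := K) n0 iY)
  ?(SU_meas_bound (K := K) n0 iXY); try by rewrite /K; lia.
have iT k : tinv b (top_part b X k) := top_part_tinv n0 iX.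
have iT' k : tinv b (top_part b Y k) := top_part_tinv n0 iY.
have i0 : tinv b (set0 : set ('I_n -> M)) by [].
have l0 k : ledim k (set0 : set ('I_n -> M)) by move=> [].
have E k : dmeas k (top_part b (X `|` Y) k) = (dmeas k (if (rank b Y <= rank b X)%N then top_part b X k else set0) +
    dmeas k (if (rank b X <= rank b Y)%N then top_part b Y k else set0))%R.
  rewrite top_partU //; apply: (dmeasU (b := b)) => //.
  - by case: ifP.
  - by case: ifP.
  - apply/seteqP; split=> // x [+ +]; case: ifP => // _ [Xx _ _]; case: ifP => // _ [Yx _ _].
    by have : (X `&` Y) x by []; rewrite XY.
  - by case: ifP => // _; apply: top_part_ledim.
  - by case: ifP => // _; apply: top_part_ledim.
rewrite (eq_bigr _ (fun k _ => E k)) big_split /=; congr (_ + _)%R.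
  by case: ifP => // _; rewrite big1 // => k _; rewrite dmeas0.
by case: ifP => // _; rewrite big1 // => k _; rewrite dmeas0.
Qed.

Lemma SU_dm_measU_eq n (X Y : set ('I_n -> M)) : inDef X -> inDef Y -> X `&` Y = set0 ->
  (SU_dm X).1 = (SU_dm Y).1 -> (SU_dm (X `|` Y)).2 = ((SU_dm X).2 + (SU_dm Y).2)%R.
Proof.
move=> dX dY XY; have [b [iX iY]] := common_params dX dY.
have [n0 X0 _] := dX; have [_ Y0 _] := dY.
have XY0 : X `|` Y !=set0 by case: X0 => x Xx; exists x; left.
rewrite (SU_dmE n0 iX X0) (SU_dmE n0 iY Y0).
rewrite (SU_dmE n0 (tinv_setU iX iY) XY0) /= => E.
by rewrite SU_meas_union // E leqnn.
Qed.

Lemma SU_dm_measU_lt n (X Y : set ('I_n -> M)) : inDef X -> inDef Y -> X `&` Y = set0 ->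
  ((SU_dm X).1 < (SU_dm Y).1)%N -> (SU_dm (X `|` Y)).2 = (SU_dm Y).2.
Proof.
move=> dX dY XY; have [b [iX iY]] := common_params dX dY.
have [n0 X0 _] := dX; have [_ Y0 _] := dY.
have XY0 : X `|` Y !=set0 by case: X0 => x Xx; exists x; left.
rewrite (SU_dmE n0 iX X0) (SU_dmE n0 iY Y0).
rewrite (SU_dmE n0 (tinv_setU iX iY) XY0) /= => lt.
by rewrite SU_meas_union // leqNgt lt /= (ltnW lt) add0r.
Qed.

Lemma SU_dm_pos n (X : set ('I_n -> M)) : inDef X -> (0 < (SU_dm X).2)%R.
Proof.
move=> [n0 X0 /definable_tinv[b iX]]; rewrite (SU_dmE n0 iX X0).
exact: SU_meas_pos.
Qed.

Lemma SU_dm_fibre n m (phi : formula L (n + m)) (b b' : 'I_m -> M) : (0 < n)%N ->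
  tpeq (codom b) (codom b') -> fibre phi b !=set0 ->
  fibre phi b' !=set0 /\ SU_dm (fibre phi b') = SU_dm (fibre phi b).
Proof.
move=> n0 E b0; have C := @fibre_conj _ _ phi b b'.
split; first exact: (conj_nonempty E C).
by apply: (SU_dm_conj n0 b0 _ _ E C); apply: fibre_tinv.
Qed.

Lemma SU_dm_fin n m (phi : formula L (n + m)) : (0 < n)%N ->
  finite_set [set SU_dm (fibre phi b) | b in [set b | fibre phi b !=set0]].
Proof.
move=> n0; have [l hl] := finite_types m [::].
apply: (@sub_finite_set _ _ [set` [seq SU_dm (fibre phi y) | y <- l]]); last exact: finite_seq.
move=> _ [b /= b0 <-]; have [y yl] := hl b; rewrite !cats0 => E.
have [_ <-] := SU_dm_fibre n0 E b0.
by rewrite /=; apply: In_map_mem.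
Qed.

(** The value depends only on the type of the parameters, and every union of types is definable
    without parameters. *)
Lemma SU_dm_def n m (phi : formula L (n + m)) (v : nat * R) : (0 < n)%N ->
  definable0 [set b : 'I_m -> M | fibre phi b !=set0 /\ SU_dm (fibre phi b) = v].
Proof.
move=> n0; set B := [set b | _].
have [q hq] := definable_types (fun s => exists2 b, B b & s = codom b) m.
exists q; apply/seteqP; split=> b.
  by move=> Bb; apply/hq => //; exists (codom b); [exists b|apply: tpeq_refl].
move=> /(hq _ _ eM)[_ [c [c0 cv] ->]] E; have [b0 bE] := SU_dm_fibre n0 E c0.
by split=> //; rewrite bE.
Qed.

(** * Fubini *)

Section Fubini.




Variables (n m : nat) (s : 'I_m -> 'I_n).
Hypotheses (mn : (1 <= m < n)%N) (s_inj : injective s).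

Let n0 : (0 < n)%N. Proof. by lia. Qed.
Let m0 : (0 < m)%N. Proof. by lia. Qed.

Definition slice (X : set ('I_n -> M)) (a : 'I_m -> M) := coord_proj s @^-1` [set a] `&` X.

Lemma mem_zip_codom (p : nat) (x y : 'I_p -> M) i : (x i, y i) \in zip (codom x) (codom y).
Proof. by rewrite !codomE zip_map (map_f (fun i => (x i, y i))) // mem_enum. Qed.

Lemma coord_proj_tpeq (x y : 'I_n -> M) b c : tpeq (codom x ++ b) (codom y ++ c) ->
  tpeq (codom (coord_proj s x) ++ b) (codom (coord_proj s y) ++ c).
Proof.
move=> E; have := tpeq_size E; rewrite !size_cat !size_codom_ord => sz.
apply: (tpeq_sub E); first by rewrite !size_cat !size_codom_ord; lia.
move=> z; rewrite !zip_cat ?size_codom_ord // !mem_cat => /orP[|->]; last by rewrite orbT.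
rewrite !codomE zip_map => /mapP[i _ ->].
by have := mem_zip_codom x y (s i); rewrite !codomE => ->.
Qed.

Lemma coord_proj_conj (x x' : 'I_n -> M) (a a' : 'I_m -> M) b b' :
  tpeq (codom x ++ codom a ++ b) (codom x' ++ codom a' ++ b') ->
  coord_proj s x = a -> coord_proj s x' = a'.
Proof.
move=> E xa; apply/funext => i.
apply/(tpeq_eq E (x := x (s i)) (y := x' (s i)) (x' := a i)); last by rewrite -xa.
  by rewrite zip_cat ?size_codom_ord // mem_cat mem_zip_codom.
by rewrite zip_cat ?size_codom_ord // mem_cat zip_cat ?size_codom_ord // mem_cat mem_zip_codom orbT.
Qed.

Lemma slice_conj b (X : set ('I_n -> M)) (a a' : 'I_m -> M) : tinv b X ->
  conj_sets (codom a ++ b) (codom a' ++ b) (slice X a) (slice X a').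
Proof.
move=> iX x x' E; have E' : tpeq (codom x ++ b) (codom x' ++ b) := tpeq_catm (size_codom_eq _ _) (size_codom_eq _ _) E.
split=> -[/= xa Xx]; split.
- exact: coord_proj_conj E xa.
- exact: iX E' Xx.
- exact: coord_proj_conj (tpeq_sym E) xa.
- exact: iX (tpeq_sym E') Xx.
Qed.

Lemma slice_tinv b (X : set ('I_n -> M)) (a : 'I_m -> M) : tinv b X ->
  tinv (codom a ++ b) (slice X a).
Proof. by move=> iX x y E; have [] := slice_conj iX E. Qed.

Lemma coord_proj_mem (x : 'I_n -> M) : {subset codom (coord_proj s x) <= codom x}.
Proof. by move=> y /codomP[i ->]; apply: codom_f. Qed.

Lemma U_coord_proj b (x : 'I_n -> M) : U (codom x) b =
  (U (codom (coord_proj s x)) b + U (codom x) (codom (coord_proj s x) ++ b))%N.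
Proof.
rewrite -U_add //; apply: U_eq => // y.
by rewrite mem_cat orb_idr //; apply: coord_proj_mem.
Qed.

Lemma tpdim_coord_proj b (x : 'I_n -> M) : tpdim b x =
  (tpdim b (coord_proj s x) + tpdim (codom (coord_proj s x) ++ b) x)%N.
Proof.
have E1 := tpdimE b x n0; have E2 := tpdimE b (coord_proj s x) m0.
have E3 := tpdimE (codom (coord_proj s x) ++ b) x n0.
have : delta (codom x ++ codom (coord_proj s x) ++ b) = delta (codom x ++ b).
  apply: delta_eq => // y; rewrite !mem_cat orbA; congr orb.
  by rewrite orb_idr //; apply: coord_proj_mem.
lia.
Qed.

(** The sums for [X] and for a slice are matched term by term: Fubini for [h] turns term [j] of the
    slice into term [d(a0/b) + j] of [X], with the measure of [tp(a0/b)] as common factor. *)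
Lemma Fubini_type b (X : set ('I_n -> M)) (a0 : 'I_m -> M) k nu : tinv b X ->
  coord_proj s @` X = cls b a0 ->
  (forall a, cls b a0 a -> SU_dm (slice X a) = (k, nu)) ->
  SU_dm X = ((SU_dm (cls b a0)).1 + k, (SU_dm (cls b a0)).2 * nu)%R.
Proof.
move=> iX piX hX; rewrite SU_dm_cls //=.
have slice0 a : cls b a0 a -> slice X a !=set0.
  by rewrite -piX => -[x Xx <-]; exists x.
have hX' a : cls b a0 a -> rank (codom a ++ b) (slice X a) = k /\ SU_meas (codom a ++ b) (slice X a) = nu.
  move=> aa; have := hX a aa; rewrite (SU_dmE n0 (slice_tinv iX) (slice0 a aa)).
  by case.
have a0a0 : cls b a0 a0 := cls_refl b a0.
have X0 : X !=set0 by have [x [_ Xx]] := slice0 _ a0a0; exists x.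
have Xcls x : X x -> cls b a0 (coord_proj s x) by move=> Xx; rewrite -piX; exists x.
have Ua a : cls b a0 a -> U (codom a) b = U (codom a0) b.
  by move=> aa; apply: (U_tpeq eM eM (size_codom_eq _ _) aa).
have da a : cls b a0 a -> tpdim b a = tpdim b a0 by move=> aa; apply: tpdim_tpeq.
have rankX : rank b X = (U (codom a0) b + k)%N.
  apply: rankE; split.
    have [[x [/= xa Xx] Ux] _] := rankP n0 (slice_tinv iX) (slice0 _ a0a0).
    by exists x => //; rewrite U_coord_proj xa Ux; have [-> _] := hX' _ a0a0.
  move=> x Xx; have aa := Xcls x Xx; rewrite U_coord_proj (Ua _ aa) leq_add2l.
  have [_ hU] := rankP n0 (slice_tinv iX) (slice0 _ aa).
  by have [<- _] := hX' _ aa; apply: hU.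
(* Rank and dimension of [x] over [b] both split off those of its projection, which are constant on
   [cls b a0] and cancel. *)
have top_partE j a : cls b a0 a ->
    slice (top_part b X (tpdim b a0 + j)) a = top_part (codom a ++ b) (slice X a) j.
  move=> aa; have [rka _] := hX' a aa; apply/seteqP; split=> x.
    move=> [/= xa [Xx Ux dx]]; split; first by split.
      by move: Ux; rewrite rka rankX U_coord_proj xa (Ua _ aa) => /addnI.
    by move: dx; rewrite tpdim_coord_proj xa (da _ aa) => /addnI.
  move=> [[/= xa Xx] Ux dx]; split=> //; split=> //.
    by rewrite U_coord_proj xa (Ua _ aa) Ux rka rankX.
  by rewrite tpdim_coord_proj xa (da _ aa) dx.
pose T j := top_part b X (tpdim b a0 + j).
have iT j : tinv b (T j) := top_part_tinv n0 iX.
have dmeasT j : (dmeas (tpdim b a0 + j) (T j) =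
    (h (cls b a0)).2 * dmeas j (top_part (codom a0 ++ b) (slice X a0) j))%R.
  have [T0|T0] := pselect (T j !=set0); last first.
    have -> : T j = set0 by apply: contrapT => /eqP/set0P.
    rewrite dmeas0 -top_partE // (_ : slice _ a0 = set0) ?dmeas0 ?mulr0 //.
    by apply/seteqP; split=> // x [_ Tx]; apply: T0; exists x.
  have sT0 a : cls b a0 a -> slice (T j) a !=set0 /\
      h (slice (T j) a) = (j, (h (slice (T j) a0)).2).
    move=> aa; have [x Tx] := T0; have xa : cls b a0 (coord_proj s x) by apply: Xcls; case: Tx.
    have ne a' : cls b a0 a' -> slice (T j) a' !=set0.
      move=> aa'; apply: (conj_nonempty _ (slice_conj (iT j))) (ex_intro _ x _) => //.
      exact: tpeq_trans xa (tpeq_sym aa').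
    have [_ E] := h_conj n0 (ne a0 a0a0) (slice_tinv (iT j)) (slice_tinv (iT j))
      (tpeq_sym aa) (slice_conj (iT j)).
    split; first exact: ne.
    rewrite E; apply: pair_ext => //=; rewrite top_partE //; apply/esym/(top_part_dim n0).
      exact: slice_tinv.
    by rewrite -top_partE //; apply: ne.
  have piT : coord_proj s @` T j = cls b a0.
    apply/seteqP; split=> [_ [x [Xx _ _] <-]|a aa]; first exact: Xcls.
    by have [[x [/= xa Tx]] _] := sT0 a aa; exists x.
  have [] := dm_fubini hm (s := s) (X := T j) (k := j) (nu := (h (slice (T j) a0)).2) mn s_inj.
  - exact: (tinv_inDef n0 (iT j) T0).
  - by move=> a; rewrite piT => aa; have [] := sT0 a aa.
  rewrite piT => E1 E2; rewrite /dmeas !asboolT //; last first.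
    by rewrite -top_partE //; case: (sT0 a0 a0a0).
  have [_ E3] := sT0 a0 a0a0.
  by rewrite -top_partE // -/(T j) E3 E1 E2 !eqxx.
rewrite (SU_dmE n0 iX X0) rankX; congr pair.
pose K := (maxn (h X).1 (h (slice X a0)).1).+1.
rewrite (SU_meas_bound (K := (tpdim b a0 + K)%N) n0 iX); last by rewrite /K; lia.
have [_ <-] := hX' _ a0a0.
rewrite (SU_meas_bound (K := K) n0 (slice_tinv iX)); last by rewrite /K; lia.
(* Points of [X] project into [cls b a0], so none has dimension below [d(a0/b)]; these terms vanish
   and the others are shifted. *)
rewrite (big_cat_nat _ (n := tpdim b a0)) ?leq_addr //= big1_seq ?add0r.
  rewrite -{1}[tpdim b a0]add0n big_addn addKn mulr_sumr; apply: eq_bigr => j _.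
  by rewrite addnC dmeasT.
move=> l; rewrite mem_index_iota => /andP[_ /andP[_ ll]].
have -> : top_part b X l = set0; last by rewrite dmeas0.
apply/seteqP; split=> // x [Xx _ dx]; move: ll.
by rewrite -dx tpdim_coord_proj (da _ (Xcls x Xx)) ltnNge leq_addr.
Qed.

(** Types over [b] are added to the projection one by one. Taking preimages shifts every rank by the
    same [k], so the same additivity rule applies above and below. *)
Lemma Fubini_general b (Y : set ('I_m -> M)) k nu : tinv b Y -> Y !=set0 ->
  forall X : set ('I_n -> M), tinv b X -> coord_proj s @` X = Y ->
  (forall a, Y a -> SU_dm (slice X a) = (k, nu)) ->
  SU_dm X = ((SU_dm Y).1 + k, (SU_dm Y).2 * nu)%R.
Proof.
apply: (tinv_ind (P := fun Y => forall X : set ('I_n -> M), tinv b X ->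
  coord_proj s @` X = Y -> (forall a, Y a -> SU_dm (slice X a) = (k, nu)) ->
  SU_dm X = ((SU_dm Y).1 + k, (SU_dm Y).2 * nu)%R)).
  by move=> a X iX piX hX; apply: Fubini_type.
move=> {}Y a iY Y0 Ya IH X iX piX hX.
have iC := tinv_cls (b := b) (a := a).
pose pre (Z : set ('I_m -> M)) := X `&` coord_proj s @^-1` Z.
have ipre Z : tinv b Z -> tinv b (pre Z).
  by move=> iZ x y E [Xx Zx]; split; [apply: iX E Xx|apply: iZ (coord_proj_tpeq E) Zx].
have pipre Z : Z `<=` Y `|` cls b a -> coord_proj s @` pre Z = Z.
  move=> ZY; apply/seteqP; split=> [_ [x [Xx Zx] <-]//|c Zc].
  have : (Y `|` cls b a) c by apply: ZY.
  by rewrite -piX => -[x Xx xc]; exists x => //; split=> //=; rewrite xc.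
have slpre Z c : Z c -> slice (pre Z) c = slice X c.
  move=> Zc; apply/seteqP; split=> x; first by move=> [/= xc [Xx _]].
  by move=> [/= xc Xx]; split=> //; split=> //=; rewrite xc.
have sY : Y `<=` Y `|` cls b a by left.
have sC : cls b a `<=` Y `|` cls b a by right.
have H1 := IH _ (ipre Y iY) (pipre Y sY) (fun c Yc => etrans (congr1 _ (slpre Y c Yc)) (hX c (sY c Yc))).
have H2 := Fubini_type (ipre _ iC) (pipre _ sC) (fun c Cc => etrans (congr1 _ (slpre _ c Cc)) (hX c (sC c Cc))).
have XE : X = pre Y `|` pre (cls b a).
  apply/seteqP; split=> x; last by move=> [[]|[]].
  move=> Xx; have : (Y `|` cls b a) (coord_proj s x) by rewrite -piX; exists x.
  by move=> [Yx|Cx]; [left|right].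
have pre0 Z : Z `<=` Y `|` cls b a -> Z !=set0 -> pre Z !=set0.
  by move=> ZY [c Zc]; move: Zc; rewrite -{1}(pipre Z ZY) => -[x hx _]; exists x.
have C0 : cls b a !=set0 by exists a; apply: cls_refl.
have dY : inDef Y := tinv_inDef m0 iY Y0.
have dC : inDef (cls b a) := tinv_inDef m0 iC C0.
have dPY := tinv_inDef n0 (ipre Y iY) (pre0 Y sY Y0).
have dPC := tinv_inDef n0 (ipre _ iC) (pre0 _ sC C0).
have PYC : pre Y `&` pre (cls b a) = set0.
  apply/seteqP; split=> // x [[_ Yx] [_ Cx]].
  by have : (Y `&` cls b a) (coord_proj s x) by []; rewrite Ya.
apply: pair_ext; rewrite /= XE.
  rewrite (SU_dm_dimU dY dC) (SU_dm_dimU dPY dPC) H1 H2 /=; lia.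
case: (ltngtP (SU_dm Y).1 (SU_dm (cls b a)).1) => cmp.
- rewrite (SU_dm_measU_lt dY dC Ya cmp) (SU_dm_measU_lt dPY dPC PYC) ?H2 //=.
  by rewrite H1 /= ltn_add2r.
- rewrite setUC (setUC (pre _)) (SU_dm_measU_lt dC dY _ cmp) 1?setIC //.
  rewrite (SU_dm_measU_lt dPC dPY) ?H1 //=; first by rewrite setIC.
  by rewrite H2 /= ltn_add2r.
- rewrite (SU_dm_measU_eq dY dC Ya cmp) (SU_dm_measU_eq dPY dPC PYC).
    by rewrite H1 H2 /= mulrDl.
  by rewrite H1 H2 /= cmp.
Qed.

Lemma SU_dm_fubini (X : set ('I_n -> M)) k nu : inDef X ->
  (forall a, (coord_proj s @` X) a -> SU_dm (slice X a) = (k, nu)) ->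
  (SU_dm X).1 = ((SU_dm (coord_proj s @` X)).1 + k)%N /\
  (SU_dm X).2 = ((SU_dm (coord_proj s @` X)).2 * nu)%R.
Proof.
move=> [_ [x Xx] /definable_tinv[b iX]] hX.
have iP : tinv b (coord_proj s @` X).
  move=> a a' E [y Xy ya].
  have [y' Ey] := conj_ext y E; rewrite -ya in Ey.
  exists y'; first by apply: iX Xy; apply: tpeq_catm Ey; rewrite !size_codom_ord.
  exact: coord_proj_conj Ey erefl.
have P0 : coord_proj s @` X !=set0 by exists (coord_proj s x); exists x.
by rewrite (Fubini_general iP P0 iX erefl hX).
Qed.

End Fubini.

End DimensionMeasure.
End OmegaCategorical.

(** * Assembly of the dimension-measure given by SU-rank *)

Theorem corollary2p22 (R : realType) (L : language) (M : structure L)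
    (Mcat : omega_categorical M) :
  (forall h : dim_meas_fun R M, dimension_measure h ->
     exists h' : dim_meas_fun R M,
       [/\ dimension_measure h', dim_is_SU h' & agree_on_types h h']) /\
  (MS_measurable R M ->
     exists h' : dim_meas_fun R M, dimension_measure h' /\ dim_is_SU h').
Proof.
suff H (h : dim_meas_fun R M) : dimension_measure h ->
     exists h' : dim_meas_fun R M,
       [/\ dimension_measure h', dim_is_SU h' & agree_on_types h h'].
  by split=> // -[h /H[h' [hm hSU _]]]; exists h'.
move=> hm; have eM := @elem_equiv_refl L M; exists (SU_dm h); split.
- split.
  + by move=> n X; apply: SU_dm_pos.
  + by move=> n m phi; apply: SU_dm_fin.
  + by move=> n m phi v; apply: SU_dm_def.
  + by move=> n a; apply: SU_dm_point.
  + by move=> n X Y; apply: SU_dm_dimU.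
  + by move=> n X Y; apply: SU_dm_measU_eq.
  + by move=> n X Y; apply: SU_dm_measU_lt.
  + by move=> n m s X k nu mn sinj dX hX; apply: SU_dm_fubini.
(* The rank must be correct for every formula defining [X] over any [A]; the parameters of [th] can
   serve as [b], since the value of [SU_dm] does not depend on that choice. *)
- move=> n X [n0 X0 _] A th thA XE.
  have iX : tinv (codom (pparam th)) X by rewrite XE => x y; apply: psat_tinv.
  rewrite (SU_dmE Mcat hm n0 iX X0) /=; have [rX hX] := rankP Mcat hm n0 iX X0.
  by apply: (SU_max_types Mcat hm) => //; rewrite -XE.
- move=> n m phi a b n0 [aphi iso].
  have iX := @fibre_tinv L M n m phi b.
  have X0 : fibre phi b !=set0 by exists a.
  (* If [q] failed at [a], its negation would hold on the whole fibre; so [phi] decides every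
     formula, and the fibre is a single type. *)
  have XE x : fibre phi b x -> tpeq (codom x ++ codom b) (codom a ++ codom b).
    move=> xphi; rewrite -!codom_fcat; apply/tpeq_codom => q; split=> hq.
      apply: contrapT => nq; exact: (iso (Neg q) nq x xphi).
    exact: (iso q hq x xphi).
  rewrite (@SU_dm_homogeneous _ _ Mcat _ _ hm _ _ _ (U h (codom a) (codom b)) (tpdim h (codom b) a) n0 iX X0) //.
  move=> x /XE E; split; last exact: (tpdim_tpeq Mcat hm n0 E).
  by apply: (U_tpeq Mcat hm) => //; rewrite !size_codom_ord.
Qed.
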